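(* Let $X=\{X_n\}_{n\ge 0}$ be a time-homogeneous Markov chain with state space a Borel set $S\subseteq\mathbb{R}$ such that $\limsup_{n\to\infty}X_n=\infty$ almost surely. Assume that there is a random variable $\xi$ such that $\xi(x)\Rightarrow\xi$ (convergence in distribution) as $x\to\infty$, and that there is a random variable $\Xi$ with $\mathbb{E}\,\Xi<\infty$ such that $$|\xi(x)|\le_{\rm st}\Xi\qquad\text{for all }x.$$ Assume that there exist a bounded function $v(x)>0$, a function $\widetilde t(x)\uparrow\infty$ and a constant $C_H<\infty$ such that, for any function $t(x)\uparrow\infty$ satisfying $t(x)\le\widetilde t(x)$, $$\frac{v(x)\,H(x,x+t(x)]}{t(x)}\to C_H\qquad\text{as }x\to\infty.$$ (a) If $\xi$ is non-lattice, then $v(x)H(x,x+h]\to C_Hh$ as $x\to\infty$, for every fixed $h>0$. (b) If the chain $X_n$ is integer valued and $\mathbb{Z}$ is the minimal lattice for $\xi$, then $v(k)H\{k\}\to C_H$ as $k\to\infty$.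
   Context: For a time-homogeneous Markov chain $X_n$ with state space a Borel set $S\subseteq\mathbb{R}$, $\xi(x)$ denotes a random variable with the distribution of the jump of the chain from state $x\in S$, i.e. $\mathbb{P}\{\xi(x)\in B\}=\mathbb{P}\{X_{n+1}-X_n\in B\mid X_n=x\}$ for Borel $B\subseteq\mathbb{R}$. All conditions involving $\xi(x)$ are understood for $x\in S$. For random variables, $\xi\le_{\rm st}\eta$ means $\mathbb{P}\{\xi>t\}\le\mathbb{P}\{\eta>t\}$ for all $t\in\mathbb{R}$. The renewal measure (Green function) of the chain is $H(B):=\sum_{n=0}^\infty\mathbb{P}\{X_n\in B\}$ for Borel $B\subseteq\mathbb{R}$. The notation $t(x)\uparrow\infty$ means that $t$ increases to infinity as $x\to\infty$. *)

(* Defs.v *)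
From HB Require Import structures.
From mathcomp Require Import all_boot all_order all_algebra.
From mathcomp Require Import all_classical all_reals all_analysis.
From mathcomp Require Import measurable_realfun.

Set Implicit Arguments.
Unset Strict Implicit.
Unset Printing Implicit Defensive.

Import Order.TTheory GRing.Theory Num.Theory.
Import numFieldNormedType.Exports.

Local Open Scope classical_set_scope.
Local Open Scope ring_scope.
Local Open Scope ereal_scope.

(* sigma(X_0, ..., X_n) *)
Definition natural_filtration (R : realType) (Omega : Type)
    (X : nat -> Omega -> R) (n : nat) : set_system Omega :=
  <<s \bigcup_(i in `I_n.+1)
        preimage_set_system setT (X i) measurable >>.

(* The kernel K is total on R; only its values at points of S matter.  The last
   clause says P{X_(n+1) in B | X_0, ..., X_n} = K (X_n) B almost surely, with
   one kernel for all n (time-homogeneity); the law of X_0 is arbitrary. *)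
Definition markov_chain (R : realType) (d : measure_display)
    (Omega : measurableType d) (P : probability Omega R)
    (S : set R)
    (K : R.-pker R ~> R)
    (X : nat -> {RV P >-> R}) : Prop :=
  [/\ forall x, S x -> K x S = 1,
      forall n w, S (X n w) &
      forall n A B, natural_filtration X n A -> measurable B ->
        P (A `&` X n.+1 @^-1` B) = \int[P]_(w in A) K (X n w) B].

Definition renewal_measure (R : realType) (d : measure_display)
    (Omega : measurableType d) (P : probability Omega R)
    (X : nat -> {RV P >-> R})
    (B : set R) : \bar R :=
  \sum_(0 <= n <oo) P (X n @^-1` B).

(* The measure K x, bundled as a probability. *)
Section step_law.
Context (R : realType) (K : R.-pker R ~> R).
Variable x : R.

Definition step_law : set R -> \bar R := K x.

HB.instance Definition _ := Measure.on step_law.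

Let step_law_setT : step_law setT = 1.
Proof. exact: prob_kernel. Qed.

HB.instance Definition _ :=
  Measure_isProbability.Build _ _ _ step_law step_law_setT.

(* xi(x), realised on the probability space (R, Borel, K x): the next state y
   of the chain started from x is mapped to the jump y - x. *)
Definition jump_fun (y : R) : R := (y - x)%R.

Let measurable_jump_fun : measurable_fun setT jump_fun.
Proof.
exact: measurable_funB.
Qed.

HB.instance Definition _ :=
  isMeasurableFun.Build _ _ _ _ jump_fun measurable_jump_fun.

Definition jump : {RV step_law >-> R} := jump_fun.

End step_law.

(* Weak convergence on R: convergence of the distribution functions at every
   continuity point of the limiting one. *)
Definition cvg_in_distribution (R : realType) (I : Type) (F : set_system I)
    (d d' : measure_display) (T : measurableType d) (T' : measurableType d')
    (P_ : I -> probability T R)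
    (xi_ : forall i, {RV (P_ i) >-> R})
    (P : probability T' R) (xi : {RV P >-> R}) : Prop :=
  forall r : R, {for r, continuous (cdf xi)} ->
    cdf (xi_ i) r @[i --> F] --> cdf xi r.

Definition st_le (R : realType) (d d' : measure_display)
    (T : measurableType d) (T' : measurableType d')
    (P : probability T R) (xi : T -> R)
    (P' : probability T' R) (eta : T' -> R) : Prop :=
  forall t : R, P [set w | (t < xi w)%R] <= P' [set w | (t < eta w)%R].

(* d Z: lattices are subgroups of R, without shift. *)
Definition lattice (R : realType) (d : R) : set R :=
  [set (k%:~R * d)%R | k in [set: int]].

Definition concentrated_on (R : realType) (d : measure_display)
    (T : measurableType d) (P : probability T R)
    (xi : {RV P >-> R}) (L : set R) : Prop :=
  P (xi @^-1` L) = 1.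

Definition non_lattice (R : realType) (d : measure_display)
    (T : measurableType d) (P : probability T R)
    (xi : {RV P >-> R}) : Prop :=
  ~ exists2 h : R, (0 < h)%R & concentrated_on xi (lattice h).

Definition minimal_lattice (R : realType) (d : measure_display)
    (T : measurableType d) (P : probability T R)
    (xi : {RV P >-> R}) (h : R) : Prop :=
  [/\ (0 < h)%R, concentrated_on xi (lattice h) &
      forall h' : R, (0 < h')%R -> concentrated_on xi (lattice h') ->
        lattice h `<=` lattice h'].

Definition increases_to_infinity (R : realType) (t : R -> R) : Prop :=
  {homo t : x y / (x <= y)%R} /\ t x @[x --> +oo%R] --> +oo%R.

(* Main.v *)
Require Import Defs.
From HB Require Import structures.
From mathcomp Require Import all_boot all_order all_algebra.
From mathcomp Require Import all_classical all_reals all_analysis.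
From mathcomp Require Import measurable_realfun.
From mathcomp Require Import ring lra.
Import Order.TTheory GRing.Theory Num.Theory.
Import numFieldNormedType.Exports.

Set Implicit Arguments.
Unset Strict Implicit.
Unset Printing Implicit Defensive.

Local Open Scope classical_set_scope.
Local Open Scope ring_scope.

(** Let [H] be the renewal measure and test it against the tent [phi_s] of
    half-width [w] centred at [x + s].  Since [H] dominates the image of itself
    under the kernel, the limit points, as [x] tends to infinity, of
    [s |-> v(x) * int phi_s dH] are superharmonic for the random walk with steps
    [xi], and the hypothesis on slowly growing windows prescribes their averages
    over long intervals.

    If [C_H > 0], the hypothesis forces [v(x + s) / v(x) --> 1], so the averages
    of a limit point are the same in both directions.  A superharmonic function
    with this property is harmonic, hence, by a maximum-principle argument of
    Choquet-Deny type, its periods form a closed group containing all the values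
    charged by [xi].  It is thus [w]-periodic, and equal to its average.

    If [C_H = 0], only averages to the right of [x] are controlled, and they
    vanish.  Harmonicity then needs [E xi >= 0]: were the drift negative, the
    chain, which is unbounded above, would re-enter a bounded interval with
    conditional probability at least 1/2 after every passage above it, and [H]
    would be infinite on that interval.  Bounds on [H] to the left of [x] being
    unavailable, the tents are truncated at a cost before taking limits. *)

(** * Lipschitz functions *)

(** The truncation replaces a tent mass by the infimum, over h >= 0, of v(x) times the [H]-integral
    of (tent - h)^+, plus k * h. This lies in [0, k] and is (k / w)-Lipschitz in s, so it converges
    for all s at once along any ultrafilter finer than the neighbourhoods of +oo; the true limit
    exists as soon as all these ultrafilters give the same value. Superharmonicity survives because
    [H >= H K] can be applied to (tent - h)^+ for each h separately. If C_H > 0 and k is large, the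
    truncation is inactive. If C_H = 0, a small infimum forces a small h, and (tent - h)^+ still
    dominates half of a narrower tent.

    Only first moments of the jumps are at hand. Hence expectations are handled as functionals of
    Lipschitz functions; weak convergence and stochastic order enter through ramps, whose means are
    integrals of tail probabilities; and harmonicity is proved from averages over [s, s + T], for
    which errors o(T) are harmless. *)

Definition lipschitz_fun (R : realType) (f : R -> R) : Prop :=
  exists k, forall x y, `|f x - f y| <= k * `|x - y|.

Section lipschitz_fun.
Context (R : realType).
Implicit Types f g : R -> R.

Lemma lipschitz_fun_ge0 f : lipschitz_fun f ->
  exists2 k, 0 <= k & forall x y, `|f x - f y| <= k * `|x - y|.
Proof.
move=> [k fk]; exists `|k| => // x y.
by apply: le_trans (fk x y) _; rewrite ler_wpM2r// ler_norm.
Qed.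

Lemma lipschitz_fun_cst (c : R) : lipschitz_fun (fun=> c).
Proof. by exists 0 => x y; rewrite subrr normr0 mul0r. Qed.

Lemma lipschitz_fun_id : lipschitz_fun (fun y : R => y).
Proof. by exists 1 => x y; rewrite mul1r. Qed.

Lemma lipschitz_funD f g : lipschitz_fun f -> lipschitz_fun g ->
  lipschitz_fun (fun y => f y + g y).
Proof.
move=> [k fk] [l gl]; exists (k + l) => x y.
rewrite opprD addrACA mulrDl.
by apply: le_trans (ler_normD _ _) _; exact: lerD.
Qed.

Lemma lipschitz_funZ (a : R) f : lipschitz_fun f ->
  lipschitz_fun (fun y => a * f y).
Proof.
move=> [k fk]; exists (`|a| * k) => x y.
by rewrite -mulrBr normrM -mulrA ler_wpM2l.
Qed.

Lemma lipschitz_funN f : lipschitz_fun f -> lipschitz_fun (fun y => - f y).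
Proof.
by move=> [k fk]; exists k => x y; rewrite -opprD normrN.
Qed.

Lemma lipschitz_funB f g : lipschitz_fun f -> lipschitz_fun g ->
  lipschitz_fun (fun y => f y - g y).
Proof. by move=> lf lg; apply: lipschitz_funD => //; exact: lipschitz_funN. Qed.

Lemma lipschitz_fun_comp f g : lipschitz_fun f -> lipschitz_fun g ->
  lipschitz_fun (fun y => f (g y)).
Proof.
move=> /lipschitz_fun_ge0[k k0 fk] [l gl]; exists (k * l) => x y.
by apply: le_trans (fk _ _) _; rewrite -mulrA ler_wpM2l.
Qed.

Lemma lipschitz_fun_norm f : lipschitz_fun f -> lipschitz_fun (fun y => `|f y|).
Proof.
move=> [k fk]; exists k => x y; apply: le_trans (fk x y).
exact: ler_dist_dist.
Qed.

Lemma lipschitz_fun_max f g : lipschitz_fun f -> lipschitz_fun g ->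
  lipschitz_fun (fun y => Num.max (f y) (g y)).
Proof.
move=> lf lg.
suff -> : (fun y => Num.max (f y) (g y)) =
          (fun y => 2^-1 * ((f y + g y) + `|f y - g y|)).
  apply: lipschitz_funZ; apply: lipschitz_funD; first exact: lipschitz_funD.
  by apply: lipschitz_fun_norm; exact: lipschitz_funB.
by apply/funext => y; rewrite maxr_absE mulrC.
Qed.

Lemma lipschitz_fun_min f g : lipschitz_fun f -> lipschitz_fun g ->
  lipschitz_fun (fun y => Num.min (f y) (g y)).
Proof.
move=> lf lg.
suff -> : (fun y => Num.min (f y) (g y)) =
          (fun y => - Num.max (- f y) (- g y)).
  by apply: lipschitz_funN; apply: lipschitz_fun_max; exact: lipschitz_funN.
by apply/funext => y; rewrite oppr_max !opprK.
Qed.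

Lemma lipschitz_fun_reflect f (s : R) : lipschitz_fun f ->
  lipschitz_fun (fun y => f (s - y)).
Proof.
move=> lf; apply: (@lipschitz_fun_comp f (fun y => s - y)) => //.
apply: lipschitz_funB; first exact: lipschitz_fun_cst.
exact: lipschitz_fun_id.
Qed.

Lemma lipschitz_fun_sum (I : Type) (r : seq I) (F : I -> R -> R) :
  (forall i, lipschitz_fun (F i)) -> lipschitz_fun (fun y => \sum_(i <- r) F i y).
Proof.
move=> lF; elim: r => [|i r IH].
  under eq_fun do rewrite big_nil.
  exact: lipschitz_fun_cst.
under eq_fun do rewrite big_cons.
exact: lipschitz_funD.
Qed.

Lemma lipschitz_fun_continuous f : lipschitz_fun f -> continuous f.
Proof.
move=> /lipschitz_fun_ge0[k k0 fk] x; apply/cvgrPdist_le => e e0; near=> y.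
apply: le_trans (fk _ _) _.
rewrite (@le_trans _ _ ((k + 1) * `|x - y|)) ?ler_wpM2r ?lerDl//.
rewrite -ler_pdivlMl ?ltr_wpDl//.
near: y; apply: (@cvgr_dist_le _ _ _ (nbhs x) _ id); first exact: cvg_id.
by rewrite mulr_gt0// invr_gt0 ltr_wpDl.
Unshelve. all: end_near. Qed.

End lipschitz_fun.

(** * Removing quadratic errors by subdivision *)

Section subdivision.
Context (R : realType).

(** Archimedean substitute for letting an error C / n tend to 0. *)
Lemma ler_bounded_multiples (x C : R) : (forall n, n.+1%:R * x <= C) -> x <= 0.
Proof.
move=> xC; rewrite leNgt; apply/negP => x0.
have C0 : 0 <= C / x.
  by rewrite divr_ge0 ?(ltW x0)//; apply: le_trans (ltW x0) _; have := xC 0; rewrite mul1r.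
have := xC (Num.bound (C / x)); rewrite leNgt => /negP; apply.
rewrite -ltr_pdivrMr//; apply: lt_le_trans (archi_boundP C0) _.
by rewrite ler_nat.
Qed.

(* Cutting [0, T] into [n] steps divides the quadratic error by [n]. *)
Lemma subdivision_le (Phi : R -> R) (K C T : R) : 0 <= T ->
  (forall t h, 0 <= t -> 0 <= h -> t + h <= T ->
     Phi (t + h) - Phi t <= K * h + C * h ^+ 2) ->
  Phi T - Phi 0 <= K * T.
Proof.
move=> T0 PhiP.
rewrite -subr_le0; apply: (@ler_bounded_multiples _ (C * T ^+ 2)) => n.
have n0 : 0 < n.+1%:R :> R by [].
pose h := T / n.+1%:R.
have h0 : 0 <= h by exact: divr_ge0.
have nh : n.+1%:R * h = T by rewrite /h mulrC divfK// gt_eqF.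
have sub k : (k <= n.+1)%N ->
    Phi (k%:R * h) - Phi 0 <= k%:R * (K * h + C * h ^+ 2).
  elim: k => [_|k IH kn]; first by rewrite !mul0r subrr.
  have := PhiP (k%:R * h) h (mulr_ge0 (ler0n _ _) h0) h0.
  have -> : k%:R * h + h = k.+1%:R * h by rewrite -natr1 mulrDl mul1r.
  rewrite -{1}nh ler_wpM2r ?ler_nat// => /(_ isT).
  have := IH (ltnW kn); rewrite -natr1; lra.
have := sub _ (leqnn _); rewrite nh => le_sub.
have -> : C * T ^+ 2 = n.+1%:R * (n.+1%:R * (C * h ^+ 2)) by rewrite -nh; ring.
rewrite ler_pM2l//; apply: le_trans (lerB le_sub (lexx _)) _.
rewrite -[in K * T]nh; lra.
Qed.

(** A first-order bound on increments is already a Lipschitz bound, since the quadratic error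
    disappears under subdivision; applied to [Phi] and to [- Phi]. *)
Lemma abs_subdivision_le (Phi : R -> R) (K C : R) :
  (forall t h, 0 <= h -> `|Phi (t + h) - Phi t| <= K * h + C * h ^+ 2) ->
  forall s t, `|Phi s - Phi t| <= K * `|s - t|.
Proof.
move=> PhiP.
have le_st s t : s <= t -> `|Phi t - Phi s| <= K * (t - s).
  move=> st; rewrite ler_norml lerNl.
  have ts0 : 0 <= t - s by rewrite subr_ge0.
  have h1 : Phi (s + (t - s)) - Phi (s + 0) <= K * (t - s).
    apply: (@subdivision_le (fun x => Phi (s + x)) K C) => // x h _ h0 _.
    rewrite addrA; apply: le_trans (PhiP _ _ h0); exact: ler_norm.
  have h2 : - Phi (s + (t - s)) - - Phi (s + 0) <= K * (t - s).
    apply: (@subdivision_le (fun x => - Phi (s + x)) K C) => // x h _ h0 _.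
    rewrite addrA -opprD; apply: le_trans (PhiP _ _ h0).
    by rewrite -normrN; exact: ler_norm.
  have e : s + (t - s) = t by lra.
  move: h1 h2; rewrite addr0 e => h1 h2.
  by rewrite opprB h1 andbT; lra.
move=> s t; have [st|/ltW ts] := leP s t.
  by rewrite distrC [`|s - t|]distrC (ger0_norm (x := t - s)) ?subr_ge0 ?le_st.
by rewrite (ger0_norm (x := s - t)) ?subr_ge0 ?le_st.
Qed.

End subdivision.

(** * Expectations as functionals and superharmonic functions *)

Ltac lipschitz := repeat first
  [ assumption
  | match goal with H : forall _, _ |- _ => exact: H end
  | match goal with H : lipschitz_fun ?f |- lipschitz_fun (fun y => ?f (?s - y)) =>
      exact: (lipschitz_fun_reflect s H) end
  | exact: lipschitz_fun_id
  | exact: lipschitz_fun_cst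
  | apply: lipschitz_funB
  | apply: lipschitz_funD
  | apply: lipschitz_funN
  | apply: lipschitz_funZ
  | apply: lipschitz_fun_norm
  | apply: lipschitz_fun_max
  | apply: lipschitz_fun_min
  | apply: lipschitz_fun_reflect ].

(* The expectation E f(xi) of an integrable xi, seen as a functional of the
   Lipschitz function f. *)
Record lipschitz_mean (R : realType) (E : (R -> R) -> R) : Prop := {
  mean_cst : forall c, E (fun=> c) = c ;
  mean_linear : forall a f g, lipschitz_fun f -> lipschitz_fun g ->
    E (fun y => a * f y + g y) = a * E f + E g ;
  mean_mono : forall f g, lipschitz_fun f -> lipschitz_fun g ->
    (forall y, f y <= g y) -> E f <= E g ;
  mean_tail : forall e, 0 < e ->
    exists2 A, 0 < A & E (fun y => Num.max (`|y| - A) 0) <= e }.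

Section mean.
Context (R : realType) (E : (R -> R) -> R).
Hypothesis hE : lipschitz_mean E.
Implicit Types f g : R -> R.

Lemma meanZ a f : lipschitz_fun f -> E (fun y => a * f y) = a * E f.
Proof.
move=> lf; transitivity (E (fun y => a * f y + 0)).
  by congr E; apply/funext => y; rewrite addr0.
rewrite (mean_linear hE)// ?(mean_cst hE) ?addr0//; lipschitz.
Qed.

Lemma meanD f g : lipschitz_fun f -> lipschitz_fun g ->
  E (fun y => f y + g y) = E f + E g.
Proof.
move=> lf lg; transitivity (E (fun y => 1 * f y + g y)).
  by congr E; apply/funext => y; rewrite mul1r.
by rewrite (mean_linear hE)// mul1r.
Qed.

Lemma meanN f : lipschitz_fun f -> E (fun y => - f y) = - E f.
Proof.
move=> lf; transitivity (E (fun y => -1 * f y)).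
  by congr E; apply/funext => y; rewrite mulN1r.
by rewrite meanZ// mulN1r.
Qed.

Lemma meanB f g : lipschitz_fun f -> lipschitz_fun g ->
  E (fun y => f y - g y) = E f - E g.
Proof. by move=> lf lg; rewrite meanD ?meanN//; lipschitz. Qed.

Lemma mean_le_cst f c : lipschitz_fun f -> (forall y, f y <= c) -> E f <= c.
Proof.
by move=> lf fc; rewrite -(mean_cst hE c); apply: (mean_mono hE) => //; lipschitz.
Qed.

Lemma mean_ge_cst f c : lipschitz_fun f -> (forall y, c <= f y) -> c <= E f.
Proof.
by move=> lf fc; rewrite -(mean_cst hE c); apply: (mean_mono hE) => //; lipschitz.
Qed.

Lemma mean_sum (I : Type) (r : seq I) (F : I -> R -> R) :
  (forall i, lipschitz_fun (F i)) ->
  E (fun y => \sum_(i <- r) F i y) = \sum_(i <- r) E (F i).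
Proof.
move=> lF; elim: r => [|i r IH].
  by rewrite big_nil -[RHS](mean_cst hE); congr E; apply/funext => y; rewrite big_nil.
rewrite big_cons -IH -meanD//; last exact: lipschitz_fun_sum.
by congr E; apply/funext => y; rewrite big_cons.
Qed.

End mean.

(* The defect [b s - E (b (s - y))] is the derivative of
   [W s = E (B s - B (s - y))], so [W] is nondecreasing; averaged over long
   intervals it is [E id] times the average of [b], and [flux] says that the
   averages far to the right do not exceed those far to the left.  Hence [W] is
   constant and the defect vanishes. *)
Section superharmonic.
Context (R : realType) (E : (R -> R) -> R).
Hypothesis hE : lipschitz_mean E.
Variables (b B D : R -> R) (c L s0 : R).
Hypothesis b_bounds : forall s, 0 <= b s <= c.
Hypothesis b_lip : forall s t, `|b s - b t| <= L * `|s - t|.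
Hypothesis B_prim : forall s h, `|B (s + h) - B s - h * b s| <= L * h ^+ 2.
Hypothesis D_prim : forall s h, `|D (s + h) - D s - h * B s| <= c * h ^+ 2.
Hypothesis b_super : forall s, E (fun y => b (s - y)) <= b s.
Hypothesis flux : forall s1 s2 e, s0 <= s2 -> 0 < e -> forall T0, exists2 T, T0 <= T &
  E id * ((B (s2 + T) - B s2) - (B s1 - B (s1 - T))) <= e * T.

Let lb : lipschitz_fun b. Proof. by exists L. Qed.

Let c_ge0 : 0 <= c.
Proof. by have /andP[] := b_bounds 0; exact: le_trans. Qed.

Let B_lip s t : `|B s - B t| <= c * `|s - t|.
Proof.
apply: (@abs_subdivision_le _ _ _ L) => {}s h h0.
have := B_prim s h; have /andP[b0 bc] := b_bounds s.
rewrite !ler_norml => /andP[h1 h2].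
have p0 : 0 <= h * b s by exact: mulr_ge0.
have p1 : h * b s <= c * h by rewrite mulrC ler_wpM2r.
by apply/andP; split; lra.
Qed.

Let lB : lipschitz_fun B. Proof. by exists c. Qed.

Let DD_lip T s t :
  `|(D (s + T) - D s) - (D (t + T) - D t)| <= c * `|T| * `|s - t|.
Proof.
apply: (@abs_subdivision_le _ (fun s => D (s + T) - D s) _ (2 * c)) => {}s h h0.
have := D_prim (s + T) h; have := D_prim s h; have := B_lip (s + T) s.
rewrite [s + h + T]addrAC.
have -> : s + T - s = T by ring.
rewrite !ler_norml => /andP[h1 h2] /andP[h3 h4] /andP[h5 h6].
have := ler_wpM2l h0 h1; have := ler_wpM2l h0 h2 => h7 h8.
by apply/andP; split; lra.
Qed.

Let lDD T : lipschitz_fun (fun s => D (s + T) - D s).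
Proof. by exists (c * `|T|); exact: DD_lip. Qed.

Let W s := E (fun y => B s - B (s - y)).

Let u s := b s - E (fun y => b (s - y)).

(** First-order form of W' = u. The factor 2 counts the Taylor errors of [B] at s and at s - y. *)
Let W_incr s h : 0 <= h -> h * u s - 2 * L * h ^+ 2 <= W (s + h) - W s.
Proof.
move=> h0; rewrite /W -(meanB hE); [|lipschitz..].
have -> : h * u s - 2 * L * h ^+ 2 =
    E (fun y => (h * b s - 2 * L * h ^+ 2) - h * b (s - y)).
  rewrite (meanB hE) ?(mean_cst hE) ?(meanZ hE)/u; [|lipschitz..].
  by ring.
apply: (mean_mono hE); [lipschitz..|move=> y].
have := B_prim s h; have := B_prim (s - y) h.
rewrite [s - y + h]addrAC !ler_norml => /andP[h1 h2] /andP[h3 h4].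
lra.
Qed.

(** The integral of B (s + t) - B (s + t - y) over t in [0, T]; its mean over y is the integral of
    [W] over [s, s + T]. *)
Let d T s y := (D (s + T) - D s) - (D (s - y + T) - D (s - y)).

Let ld T s : lipschitz_fun (d T s).
Proof.
apply: lipschitz_funB; first exact: lipschitz_fun_cst.
exact: (lipschitz_fun_reflect s (lDD T)).
Qed.

Let mean_d_incr s t h : 0 <= h ->
  `|E (d (t + h) s) - E (d t s) - h * W (s + t)| <= 2 * c * h ^+ 2.
Proof.
move=> h0; rewrite /W -(meanZ hE); [|lipschitz].
rewrite -!(meanB hE) //; [|lipschitz..].
have dE y : `|d (t + h) s y - d t s y - h * (B (s + t) - B (s + t - y))|
    <= 2 * c * h ^+ 2.
  have := D_prim (s + t) h; have := D_prim (s + t - y) h; rewrite /d.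
  have -> : s + t - y + h = s - y + (t + h) by ring.
  have -> : s + t + h = s + (t + h) by ring.
  have -> : s + t - y = s - y + t by ring.
  rewrite !ler_norml => /andP[h1 h2] /andP[h3 h4].
  by apply/andP; split; lra.
rewrite ler_norml; apply/andP; split.
  apply: (mean_ge_cst hE); [lipschitz|move=> y].
  by have := dE y; rewrite ler_norml => /andP[].
apply: (mean_le_cst hE); [lipschitz|move=> y].
by have := dE y; rewrite ler_norml => /andP[].
Qed.

Let W_homo s T : 0 <= T -> W s <= W (s + T).
Proof.
move=> T0; rewrite -lerN2 -subr_le0.
have := @subdivision_le _ (fun t => - W (s + t)) 0 (2 * L) T T0.
rewrite addr0 mul0r; apply => t h t0 h0 _.
rewrite mul0r add0r addrA -opprD lerNl; apply: le_trans (W_incr (s + t) h0).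
have : 0 <= h * u (s + t) by rewrite mulr_ge0// subr_ge0.
lra.
Qed.

Let d0 s : E (d 0 s) = 0.
Proof.
rewrite -[RHS](mean_cst hE); congr E; apply/funext => y.
by rewrite /d !addr0; ring.
Qed.

(** Since [W] is nondecreasing, its integral over [s, s + T] lies between T times its values at the
    two ends; this is the lower half. *)
Let W_le_mean_d s T : 0 <= T -> T * W s <= E (d T s).
Proof.
move=> T0.
have := @subdivision_le _ (fun t => - E (d t s)) (- W s) (2 * c) T T0.
rewrite d0 oppr0 subr0 => PhiP.
suff : - E (d T s) <= - W s * T by lra.
apply: PhiP => t h t0 h0 _.
have := mean_d_incr s t h0; rewrite ler_norml => /andP[h1 _].
have := ler_wpM2l h0 (W_homo s t0).
lra.
Qed.

Let mean_d_le_W s T : 0 <= T -> E (d T s) <= T * W (s + T).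
Proof.
move=> T0.
have := @subdivision_le _ (fun t => E (d t s)) (W (s + T)) (2 * c) T T0.
rewrite d0 subr0 => PhiP; rewrite mulrC; apply: PhiP => t h t0 h0 thT.
have := mean_d_incr s t h0; rewrite ler_norml => /andP[_ h1].
have := @W_homo (s + t) (T - t); have -> : s + t + (T - t) = s + T by ring.
have tT : t <= T by apply: le_trans thT; rewrite lerDl.
rewrite subr_ge0 => /(_ tT) WtT.
have := ler_wpM2l h0 WtT; lra.
Qed.

(** In the other order of integration, [d T s y] is the integral of B (r + T) - B r over r from s -
    y to s. For [|y| <= 2 * A] it is Taylor expanded in y; for larger y both terms are at most c * T
    * |y|, and |y| <= 2 * (|y| - A). The mean of the error over y is thus a constant plus T times a
    small tail. *)
Let d_approx A T s y : 0 < A -> 0 <= T ->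
  `|d T s y - y * (B (s + T) - B s)| <=
  4 * c * A * `|y| + 4 * c * T * Num.max (`|y| - A) 0.
Proof.
move=> A0 T0.
have [yA|yA] := leP `|y| (2 * A).
  have := D_prim (s + T) (- y); have := D_prim s (- y); rewrite /d.
  have -> : s + T - y = s - y + T by ring.
  have yy : c * (- y) ^+ 2 <= 2 * c * A * `|y|.
    rewrite sqrrN -[y ^+ 2]real_normK ?num_real// expr2 mulrA.
    by rewrite ler_wpM2r// [2 * c]mulrC -mulrA ler_wpM2l.
  have m0 : 0 <= 4 * c * T * Num.max (`|y| - A) 0.
    by rewrite !mulr_ge0// le_max lexx orbT.
  rewrite !ler_norml => /andP[h1 h2] /andP[h3 h4].
  apply/andP; split. lra. lra.
have yT : `|y| / 2 <= Num.max (`|y| - A) 0 by rewrite le_max; apply/orP; left; lra.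
have h1 : `|d T s y| <= c * T * `|y|.
  have := DD_lip T s (s - y); rewrite (ger0_norm T0).
  by have -> : s - (s - y) = y by ring.
have h2 : `|y * (B (s + T) - B s)| <= c * T * `|y|.
  rewrite normrM mulrC ler_wpM2r//; apply: le_trans (B_lip _ _) _.
  by rewrite addrAC subrr add0r ger0_norm.
have h3 : 0 <= 4 * c * A * `|y| by rewrite !mulr_ge0// ltW.
have := ler_wpM2l (mulr_ge0 c_ge0 T0) yT => h4.
apply: le_trans (ler_normB _ _) _; lra.
Qed.

(** [W s2] is at most its average over [s2, s2 + T], and [W s1] at least its average over
    [s1 - T, s1]. Up to o(T), the two integrals differ by the quantity bounded in [flux]. *)
Let W_cst s1 s2 : W s2 <= W s1.
Proof.
(* [flux] is available only for s2 >= s0, and monotonicity of [W] allows s2 to be moved up to s0. *)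
wlog s02 : s2 / s0 <= s2 => [H|].
  have [/H//|s20] := leP s0 s2; apply: le_trans (H _ (lexx s0)).
  have := @W_homo s2 (s0 - s2); rewrite subr_ge0 => /(_ (ltW s20)).
  by have -> : s2 + (s0 - s2) = s0 by ring.
rewrite -subr_le0; apply/ler_addgt0Pr => e e0; rewrite add0r.
pose M := E (fun y => `|y|).
have M0 : 0 <= M by apply: (mean_ge_cst hE) => //; lipschitz.
(* The tail beyond A, the flux and the small jumps (through the lower bound on T) each contribute at
   most e * T / 4. *)
have [A A0 MA] : exists2 A, 0 < A &
    E (fun y => Num.max (`|y| - A) 0) <= e / (32 * (c + 1)).
  by apply: (mean_tail hE); rewrite divr_gt0// mulr_gt0// ltr_wpDl.
have [T T0 fluxT] := flux s1 s02 (divr_gt0 e0 (ltr0n _ 4))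
  (1 + 32 * c * A * M / e).
have T_gt0 : 0 < T.
  by apply: lt_le_trans T0; rewrite ltr_pwDl// divr_ge0 ?(ltW e0)// !mulr_ge0// ltW.
have T_ge0 := ltW T_gt0.
have eT : 32 * c * A * M <= e * T.
  by rewrite [e * T]mulrC -ler_pdivrMr//; apply: le_trans T0; rewrite lerDr.
set r2 := B (s2 + T) - B s2 in fluxT.
set r1 := B s1 - B (s1 - T) in fluxT.
have h1 := W_le_mean_d s2 T_ge0.
have h2 := mean_d_le_W (s1 - T) T_ge0.
rewrite subrK in h2.
pose err (y : R) := 2 * (4 * c * A * `|y| + 4 * c * T * Num.max (`|y| - A) 0).
have h3 : E (d T s2) - E (d T (s1 - T)) <= E (fun y => (r2 - r1) * y + err y).
  rewrite -(meanB hE)//; apply: (mean_mono hE); rewrite /err; [lipschitz..|move=> y].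
  have := d_approx s2 y A0 T_ge0; have := d_approx (s1 - T) y A0 T_ge0.
  rewrite subrK -/r1 -/r2 !ler_norml => /andP[h4 h5] /andP[h6 h7]; lra.
have errE : E err = 2 * (4 * c * A * M + 4 * c * T *
    E (fun y => Num.max (`|y| - A) 0)).
  rewrite /err (meanZ hE); last by lipschitz.
  rewrite (meanD hE); [|by lipschitz..].
  by rewrite !(meanZ hE)//; lipschitz.
have cM : 4 * c * T * E (fun y => Num.max (`|y| - A) 0) <= e * T / 8.
  have -> : e * T / 8 = 4 * (c + 1) * T * (e / (32 * (c + 1))).
    by field; rewrite gt_eqF// ltr_wpDl.
  apply: (@le_trans _ _ (4 * (c + 1) * T * E (fun y => Num.max (`|y| - A) 0))).
    rewrite ler_wpM2r//; last by rewrite ler_wpM2r// ler_wpM2l// lerDl.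
    by apply: (mean_ge_cst hE) => [|y]; [lipschitz|rewrite le_max lexx orbT].
  by rewrite ler_wpM2l// !mulr_ge0// addr_ge0.
have h4 : E (fun y => (r2 - r1) * y + err y) = (r2 - r1) * E id + E err.
  by rewrite (mean_linear hE)// /err; lipschitz.
rewrite errE in h4.
rewrite h4 in h3; clear h4 errE.
have : T * (W s2 - W s1) <= T * e.
  rewrite mulrBr; move: (E (fun y => Num.max _ _)) cM h3 => tail cM h3.
  move: (W s1) (W s2) (E id) (E _) (E _) r1 r2 h1 h2 h3 fluxT => w1 w2 ei e1 e2 q1 q2 h1 h2 h3 h5.
  have := mulr_ge0 (ltW e0) T_ge0; lra.
by rewrite ler_pM2l.
Qed.

Lemma superharmonic_harmonic s : E (fun y => b (s - y)) = b s.
Proof.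
apply/eqP; rewrite eq_le b_super/= -subr_le0 -/(u s).
(* With [W] constant, [W_incr] at h = 1 / (n + 1) leaves (n + 1) * u s <= 2 * L. *)
apply: (@ler_bounded_multiples _ _ (2 * L)) => n.
have n0 : 0 < n.+1%:R :> R by [].
have h0 : 0 <= n.+1%:R^-1 :> R by rewrite invr_ge0.
have := le_trans (W_incr s h0) _; move=> /(_ 0); rewrite subr_le0 W_cst => /(_ isT).
rewrite subr_le0 => h1.
have := ler_wpM2l (mulr_ge0 (ltW n0) (ltW n0)) h1.
have -> : n.+1%:R * n.+1%:R * (n.+1%:R^-1 * u s) = n.+1%:R * u s.
  by field; rewrite gt_eqF.
have -> // : n.+1%:R * n.+1%:R * (2 * L * n.+1%:R^-1 ^+ 2) = 2 * L.
by field; rewrite gt_eqF.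
Qed.

End superharmonic.

(** * Primitives and closed subgroups of the line *)

Section primitive.
Context (R : realType).
Implicit Types f F : R -> R.

Lemma continuous_primitive f : continuous f ->
  exists F : R -> R, forall x : R, is_derive x 1 F (f x).
Proof.
move=> cf.
have intf a b : lebesgue_measure.-integrable `[a, b] (EFin \o f).
  apply: continuous_compact_integrable; first exact: segment_compact.
  exact: continuous_subspaceT.
pose F x := \int[lebesgue_measure]_(t in `[0, x]) f t -
            \int[lebesgue_measure]_(t in `[x, 0]) f t.
have int_empty x y : y <= x -> \int[lebesgue_measure]_(t in `[x, y]) f t = 0.
  rewrite le_eqVlt => /predU1P[->|yx].
    by rewrite set_itv1 Rintegral_set1.
  by rewrite set_itv_ge ?Rintegral_set0// bnd_simp -ltNge.
(* The fundamental theorem concerns integrals from a fixed left endpoint; from a base point a below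
   both 0 and x, such an integral differs from [F] by a constant. *)
have FE a x : a < 0 -> a < x ->
    \int[lebesgue_measure]_(t in `[a, x]) f t
    - \int[lebesgue_measure]_(t in `[a, 0]) f t = F x.
  move=> a0 ax; rewrite /F; have [x0|/ltW x0] := leP 0 x.
    rewrite (int_empty x 0)// subr0.
    rewrite (@Rintegral_itvB _ _ (BLeft a) (BRight x) 0) ?bnd_simp ?(ltW a0)//.
    rewrite Rintegral_itv_obnd_cbnd//.
    apply: integrableS (intf 0 x) => //; apply: subset_itvr.
    by rewrite bnd_simp.
  rewrite (int_empty 0 x)// sub0r -opprB; congr (- _).
  rewrite (@Rintegral_itvB _ _ (BLeft a) (BRight 0) x) ?bnd_simp ?(ltW ax)//.
  rewrite Rintegral_itv_obnd_cbnd//.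
  apply: integrableS (intf x 0) => //; apply: subset_itvr.
  by rewrite bnd_simp.
exists F => x.
pose a := - (`|x| + 1).
have a0 : a < 0 by rewrite oppr_lt0 ltr_wpDl.
have ax : a < x by rewrite ltrNl (le_lt_trans (ler_norm _))// normrN ltrDl.
have [dG G'] := @continuous_FTC1 R f (BLeft a) x (x + 1) (ltr_pwDr ltr01 (lexx x))
  (intf _ _) ax (cf x).
have dGx := derivableP dG; rewrite -derive1E G' in dGx.
have : is_derive x 1 (fun y => \int[lebesgue_measure]_(t in `[a, y]) f t -
    \int[lebesgue_measure]_(t in `[a, 0]) f t) (f x).
  rewrite -[f x]subr0; apply: is_deriveB.
apply: near_eq_is_derive; near=> y.
apply: FE => //; near: y; exact: lt_nbhsr.
Unshelve. all: end_near. Qed.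

Lemma primitive_taylor f F L : (forall x : R, is_derive x 1 F (f x)) ->
  (forall s t, `|f s - f t| <= L * `|s - t|) ->
  forall s h, `|F (s + h) - F s - h * f s| <= L * h ^+ 2.
Proof.
move=> dF fL.
have cF x : {for x, continuous F}.
  apply: differentiable_continuous; apply/derivable1_diffP.
  exact: (@ex_derive _ _ _ _ _ _ _ (dF x)).
have mvt x y : x < y -> exists2 c, x < c < y & F y - F x = f c * (y - x).
  move=> xy; have cF' : {within `[x, y], continuous F} by exact: continuous_subspaceT.
  by have [c] := MVT xy (fun z _ => dF z) cF'; rewrite in_itv/=; exists c.
have key s c h : `|c - s| <= `|h| -> `|f c * h - h * f s| <= L * h ^+ 2.
  move=> ch; have L0 : 0 <= L * `|h|.
    have [->|h0] := eqVneq h 0; first by rewrite normr0 mulr0.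
    apply: mulr_ge0 => //; have := fL (s + h) s.
    rewrite addrAC subrr add0r => /(le_trans (normr_ge0 _)).
    by rewrite pmulr_lge0// normr_gt0.
  rewrite [h * _]mulrC -mulrBl normrM -[h ^+ 2]real_normK ?num_real//.
  rewrite expr2 mulrA ler_wpM2r//; apply: le_trans (fL _ _) _.
  have [h0|h0] := eqVneq h 0.
    by move: ch; rewrite h0 normr0 normr_le0 => /eqP ->; rewrite normr0.
  by rewrite ler_wpM2l//; move: L0; rewrite pmulr_lge0// normr_gt0.
move=> s h; have [h0|h0|->] := ltgtP h 0.
- have [|c /andP[c1 c2] E] := mvt (s + h) s; first by rewrite gtrDl.
  have -> : F (s + h) - F s = f c * h by rewrite -opprB E; ring.
  by apply: key; rewrite (ltr0_norm h0) ler_norml; apply/andP; split; lra.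
- have [|c /andP[c1 c2] E] := mvt s (s + h); first by rewrite ltrDl.
  have -> : F (s + h) - F s = f c * h by rewrite E; ring.
  by apply: key; rewrite (gtr0_norm h0) ler_norml; apply/andP; split; lra.
- by rewrite addr0 subrr mul0r subrr normr0 expr0n/= mulr0.
Qed.

End primitive.

Section closed_subgroup.
Context (R : realType) (G : set R).
Hypothesis G0 : G 0.
Hypothesis GB : forall x y, G x -> G y -> G (x - y).
Hypothesis Gc : closed G.

Let GN x : G x -> G (- x). Proof. by move=> Gx; rewrite -sub0r; exact: GB. Qed.

Let GD x y : G x -> G y -> G (x + y).
Proof. by move=> Gx Gy; rewrite -[y]opprK; apply: GB => //; exact: GN. Qed.

Let Gn n x : G x -> G (n%:R * x).
Proof.
move=> Gx; elim: n => [|n IH]; first by rewrite mul0r.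
by rewrite -natr1 mulrDl mul1r; exact: GD.
Qed.

Let Gz (k : int) x : G x -> G (k%:~R * x).
Proof.
move=> Gx; case: (intP k) => [|n|n]; first by rewrite mul0r.
  exact: Gn.
by rewrite rmorphN mulNr; apply: GN; exact: Gn.
Qed.

(** Consider the infimum of the positive elements: if it is 0, the group is dense, hence everything;
    if it is positive, it is attained and generates. *)
Lemma closed_subgroup :
  [\/ G = setT, G `<=` [set 0] | exists2 d, 0 < d & G = lattice d].
Proof.
have [[p [Gp p0]]|noG] := pselect (exists p, G p /\ 0 < p); last first.
  apply: Or32 => x Gx /=; apply/eqP/negPn/negP => x0; apply: noG.
  have [x1|x1] := ltP 0 x; first by exists x.
  exists (- x); split; first exact: GN.
  by rewrite oppr_gt0 lt_neqAle x0.
pose P := [set x | G x /\ 0 < x].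
have infP : has_inf P by split; [exists p|exists 0 => x [_ /ltW]].
have inf0 : 0 <= inf P by apply: lb_le_inf; [exists p|move=> x [_ /ltW]].
have remainder x d : 0 < d -> G d -> G x ->
    exists k : int, G (x - k%:~R * d) /\ 0 <= x - k%:~R * d < d.
  move=> d0 Gd Gx; exists (Num.floor (x / d)); split.
    by apply: GB => //; exact: Gz.
  have /andP[h1 h2] := floor_itv (x / d).
  rewrite ler_pdivlMr// in h1; rewrite ltr_pdivrMr// rmorphD mulrDl mul1r in h2.
  by apply/andP; split; lra.
move: inf0; rewrite le_eqVlt => /predU1P[inf0|inf0].
  apply: Or31; apply/seteqP; split=> // x _.
  rewrite (closure_id G).1// => U /nbhs_ballP[e /= e0 eU].
  have [g [Gg g0]] := inf_adherent e0 infP; rewrite -inf0 add0r => ge.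
  exists ((Num.floor (x / g))%:~R * g); split; first exact: Gz.
  apply: eU; rewrite /ball/=.
  have /andP[h1 h2] := floor_itv (x / g).
  rewrite ler_pdivlMr// in h1; rewrite ltr_pdivrMr// rmorphD mulrDl mul1r in h2.
  by rewrite ger0_norm; lra.
apply: Or33; exists (inf P) => //.
have min x : G x -> 0 < x -> inf P <= x.
  by move=> Gx x0; apply: ge_inf; [case: infP|split].
(* Otherwise two distinct elements would lie strictly between the infimum and its double, and their
   difference would be too small. *)
have Ginf : G (inf P).
  have [g [Gg g0] gi] := inf_adherent inf0 infP.
  have := min g Gg g0; rewrite le_eqVlt => /predU1P[->//|/[dup] ig].
  rewrite -subr_gt0 => gi0.
  have [g' [Gg' g'0]] := inf_adherent gi0 infP.
  rewrite addrC subrK => g'g.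
  have := min _ (GB Gg Gg'); rewrite subr_gt0 => /(_ g'g).
  have := min _ Gg' g'0; lra.
apply/seteqP; split=> [x Gx|x [k _ <-]]; last exact: Gz.
have [k [Gk /andP[k0 ki]]] := remainder x _ inf0 Ginf Gx.
exists k => //; apply/eqP; rewrite eq_sym -subr_eq0 eq_le leNgt k0 andbT.
by apply/negP => k1; have := min _ Gk k1; rewrite leNgt ki.
Qed.

End closed_subgroup.

(** * Periods of harmonic functions *)

(** The support of the law, tested on tents because [E] acts on Lipschitz functions. *)
Definition charged (R : realType) (E : (R -> R) -> R) (a : R) : Prop :=
  forall r, 0 < r -> 0 < E (fun y => Num.max (r - `|y - a|) 0).

Section choquet_deny.
Context (R : realType) (E : (R -> R) -> R).
Hypothesis hE : lipschitz_mean E.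

(** Maximum principle for the harmonic function g s = b (s - a) - b s: where g is nearly equal to
    its supremum M, so it is after a shift by the charged point a. If M > 0, n + 1 successive shifts
    give an increment of b of at least (n + 1) * M / 2, while increments of b are at most 2 * c. *)
Lemma harmonic_charged_le (b : R -> R) (c : R) :
  (forall s, `|b s| <= c) -> lipschitz_fun b ->
  (forall s, E (fun y => b (s - y)) = b s) ->
  forall a, charged E a -> forall s, b (s - a) <= b s.
Proof.
move=> bc lb hb a Ea s0.
pose g s := b (s - a) - b s.
have lg : lipschitz_fun g.
  apply: lipschitz_funB => //; apply: (lipschitz_fun_comp lb).
  apply: lipschitz_funB; lipschitz.
have hg s : E (fun y => g (s - y)) = g s.
  rewrite /g -(hb s) -(hb (s - a)) -(meanB hE); [|lipschitz..].
  by congr E; apply/funext => y; rewrite addrAC.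
have gc s : g s <= 2 * c.
  rewrite /g; have := bc s; have := bc (s - a); rewrite !ler_norml.
  move=> /andP[h1 h2] /andP[h3 h4]; lra.
have sg : has_sup (range g).
  by split; [exists (g 0), 0|exists (2 * c) => _ [s _ <-]].
pose M := sup (range g).
have gM s : g s <= M by apply: ub_le_sup; [case: sg|exists s].
have [l l0 gl] := lipschitz_fun_ge0 lg.
(* On the r-neighbourhood of a, g (s - y) varies by at most e / 2. If g (s - a) <= M - e, it stays
   below M - e / 2 there, which lowers the mean g s by at least d. *)
have step e : 0 < e -> exists2 d, 0 < d & forall s, M - d < g s -> M - e < g (s - a).
  move=> e0; pose r := e / (2 * (l + 1)).
  have r0 : 0 < r by rewrite divr_gt0// mulr_gt0// ltr_wpDl.
  have lr : l * r <= e / 2.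
    have -> : l * r = e / 2 * (l / (l + 1)) by rewrite /r; field; rewrite gt_eqF ?ltr_wpDl.
    rewrite ler_piMr ?divr_ge0 ?ltW//.
    by rewrite ltr_pdivrMr ?ltr_wpDl// mul1r ltrDl.
  pose chi y := Num.max (r - `|y - a|) 0.
  have lchi : lipschitz_fun chi by rewrite /chi; lipschitz.
  exists (e / (2 * r) * E chi) => [|s gs].
    by rewrite mulr_gt0 ?Ea// divr_gt0// mulr_gt0.
  rewrite ltNge; apply/negP => gsa.
  move: gs; rewrite ltNge => /negP; apply.
  rewrite lerBrDr -lerBrDl -(meanZ hE)// -(hg s) -[X in X - _](mean_cst hE).
  rewrite -(meanB hE); [|lipschitz..].
  apply: (mean_mono hE); [lipschitz..|move=> y].
  rewrite /chi; have [ya|ya] := leP (r - `|y - a|) 0; first by rewrite mulr0 subr_ge0.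
  have h1 : g (s - y) - g (s - a) <= l * r.
    apply: le_trans (ler_norm _) _; apply: le_trans (gl _ _) _.
    rewrite ler_wpM2l// distrC; have -> : s - a - (s - y) = y - a by ring.
    by rewrite ltW// -subr_gt0.
  have h2 : e / (2 * r) * (r - `|y - a|) <= e / 2.
    have -> : e / 2 = e / (2 * r) * r by field; rewrite gt_eqF.
    by rewrite ler_wpM2l ?gerBl// divr_ge0 ?ltW// mulr_gt0.
  lra.
have iter e k : 0 < e -> exists2 d, 0 < d & forall s, M - d < g s ->
    forall j, (j <= k)%N -> M - e < g (s - j%:R * a).
  move=> e0; elim: k => [|k [d d0 IH]].
    by exists e => // s gs j; rewrite leqn0 => /eqP ->; rewrite mul0r subr0.
  have m0 : 0 < Num.min d e by rewrite lt_min d0.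
  have [d' d'0 d'P] := step _ m0.
  exists (Num.min d' e) => [|s gs [_|j]]; first by rewrite lt_min d'0.
    rewrite mul0r subr0; apply: le_lt_trans gs.
    by rewrite lerB// ge_min lexx orbT.
  rewrite ltnS => jk.
  have -> : s - j.+1%:R * a = s - a - j%:R * a by rewrite -natr1; ring.
  apply: IH => //; apply: (@le_lt_trans _ _ (M - Num.min d e)).
    by rewrite lerB// ge_min lexx.
  by apply: d'P; apply: le_lt_trans gs; rewrite lerB// ge_min lexx.
suff M0 : M <= 0 by rewrite -subr_le0; exact: le_trans (gM s0) M0.
apply: (@ler_bounded_multiples _ _ (4 * c)) => n.
have [|M0] := leP M 0.
  move=> M0; apply: (@le_trans _ _ 0); first by rewrite mulr_ge0_le0.
  by rewrite mulr_ge0//; apply: le_trans (bc 0).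
have [d d0 dP] := iter (M / 2) n (divr_gt0 M0 (ltr0n _ 2)).
have [_ [s _ <-] /dP gs] := sup_adherent d0 sg.
have tele k : \sum_(j < k) g (s - j%:R * a) = b (s - k%:R * a) - b s.
  elim: k => [|k IH]; first by rewrite big_ord0 mul0r subr0 subrr.
  rewrite big_ord_recr/= IH /g -natr1.
  have -> : s - (k%:R + 1) * a = s - k%:R * a - a by ring.
  by ring.
have : n.+1%:R * (M / 2) <= \sum_(j < n.+1) g (s - j%:R * a).
  rewrite mulr_natl -[X in _ *+ X]card_ord -sumr_const; apply: ler_sum => j _.
  apply: ltW; rewrite (le_lt_trans _ (gs j _))//; last by rewrite -ltnS.
  lra.
rewrite tele; have := bc (s - n.+1%:R * a); have := bc s; rewrite !ler_norml.
move=> /andP[h1 h2] /andP[h3 h4]; lra.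
Qed.

Lemma harmonic_charged_period (b : R -> R) (c : R) :
  (forall s, `|b s| <= c) -> lipschitz_fun b ->
  (forall s, E (fun y => b (s - y)) = b s) ->
  forall a, charged E a -> forall s, b (s - a) = b s.
Proof.
move=> bc lb hb a Ea s; apply/eqP; rewrite eq_le (harmonic_charged_le bc)//=.
rewrite -lerN2; apply: (@harmonic_charged_le (fun s => - b s) c) => //.
- by move=> t; rewrite normrN.
- by lipschitz.
- by move=> t; rewrite (meanN hE) ?hb//; lipschitz.
Qed.

End choquet_deny.

(** * Periodicity of superharmonic functions with known averages *)

Section superharmonic_periodic.
Context (R : realType) (E : (R -> R) -> R).
Hypothesis hE : lipschitz_mean E.
Variables (b : R -> R) (c L w : R).
Hypothesis w_gt0 : 0 < w.
Hypothesis b_bounds : forall s, 0 <= b s <= c.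
Hypothesis b_lip : forall s t, `|b s - b t| <= L * `|s - t|.
Hypothesis b_super : forall s, E (fun y => b (s - y)) <= b s.
(** Treats both parts of the theorem at once: it holds for every w if xi is non-lattice, and for w =
    1 if Z is the minimal lattice. *)
Hypothesis w_generated : forall G : set R, G 0 ->
  (forall x y, G x -> G y -> G (x - y)) -> closed G -> charged E `<=` G -> G w.

Let harmonic_periodic : (forall s, E (fun y => b (s - y)) = b s) ->
  forall s, b (s + w) = b s.
Proof.
move=> hb.
have lb : lipschitz_fun b by exists L.
apply: (w_generated (G := [set a | forall s, b (s + a) = b s])).
- by move=> s; rewrite addr0.
- by move=> x y /= Gx Gy s; rewrite -(Gy (s + (x - y))) -addrA subrK.
- rewrite closure_id; apply/seteqP; split; first exact: subset_closure.
  move=> a Ga s /=; apply/eqP; rewrite -subr_eq0 -normr_le0.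
  apply/ler_addgt0Pr => e e0; rewrite add0r.
  have [l l0 bl] := lipschitz_fun_ge0 lb.
  have r0 : 0 < e / (l + 1) by rewrite divr_gt0// ltr_wpDl.
  have [a' [Ga' aa']] := Ga _ (nbhsx_ballx a _ r0).
  rewrite -[X in _ - X](Ga' s); apply: le_trans (bl _ _) _.
  have -> : s + a - (s + a') = a - a' by ring.
  apply: (@le_trans _ _ ((l + 1) * `|a - a'|)); first by rewrite ler_wpM2r// lerDl.
  by rewrite -ler_pdivlMl ?ltr_wpDl// mulrC ltW.
move=> a /(harmonic_charged_period hE _ lb hb) ab s /=.
rewrite -(ab c) ?addrK// => t; have /andP[bt0 btc] := b_bounds t.
by rewrite ger0_norm.
Qed.

(** Averages of b come as sums at spacing w, because sums of tents at that spacing are comparable to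
    windows. Integrating [S m (s + t)] over t in [0, w] gives the increment of a primitive of b over
    [s, s + m * w]. *)
Let S m t := \sum_(j < m) b (t + j%:R * w).

Let taylor_sum B m s t h : (forall s h, `|B (s + h) - B s - h * b s| <= L * h ^+ 2) ->
  `|\sum_(j < m) B (s + (t + h) + j%:R * w) - \sum_(j < m) B (s + t + j%:R * w)
    - h * S m (s + t)| <= m%:R * L * h ^+ 2.
Proof.
move=> B_prim; rewrite -sumrB mulr_sumr -sumrB.
apply: le_trans (ler_norm_sum _ _ _) _.
rewrite -mulrA mulr_natl -[X in _ *+ X]card_ord -sumr_const; apply: ler_sum => j _.
have -> : s + (t + h) + j%:R * w = s + t + j%:R * w + h by ring.
exact: B_prim.
Qed.

Let tele B m s : \sum_(j < m) B (s + w + j%:R * w) - \sum_(j < m) B (s + 0 + j%:R * w)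
  = B (s + m%:R * w) - B s :> R.
Proof.
elim: m => [|m IH]; first by rewrite !big_ord0 mul0r addr0 !subrr.
rewrite !big_ord_recr/= -natr1.
have -> : s + w + m%:R * w = s + (m%:R + 1) * w by ring.
by move: IH; rewrite addr0; set X := \sum_(_ < _) _; set Y := \sum_(_ < _) _; lra.
Qed.

Section primitive_increment.
Variable B : R -> R.
Hypothesis B_prim : forall s h, `|B (s + h) - B s - h * b s| <= L * h ^+ 2.

Local Lemma increment_le m s K : (forall t, 0 <= t <= w -> S m (s + t) <= K) ->
  B (s + m%:R * w) - B s <= K * w.
Proof.
move=> SK; rewrite -tele.
apply: (@subdivision_le _ (fun t => \sum_(j < m) B (s + t + j%:R * w)) _
  (m%:R * L)) => [|t h t0 h0 th]; first exact: ltW.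
have /(ler_wpM2l h0) h1 : S m (s + t) <= K.
  by apply: SK; rewrite t0 (le_trans _ th)// lerDl.
have := taylor_sum m s t h B_prim; rewrite ler_norml => /andP[_ h2]; lra.
Qed.

Local Lemma increment_ge m s K : (forall t, 0 <= t <= w -> K <= S m (s + t)) ->
  K * w <= B (s + m%:R * w) - B s.
Proof.
move=> SK; rewrite -tele -lerN2 -mulNr opprB addrC -[X in _ + X]opprK.
apply: (@subdivision_le _ (fun t => - \sum_(j < m) B (s + t + j%:R * w)) _
  (m%:R * L)) => [|t h t0 h0 th]; first exact: ltW.
have /(ler_wpM2l h0) h1 : K <= S m (s + t).
  by apply: SK; rewrite t0 (le_trans _ th)// lerDl.
have := taylor_sum m s t h B_prim; rewrite ler_norml => /andP[h2 _]; lra.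
Qed.

End primitive_increment.

Let exists_primitives : exists B D : R -> R,
  (forall s h, `|B (s + h) - B s - h * b s| <= L * h ^+ 2) /\
  (forall s h, `|D (s + h) - D s - h * B s| <= c * h ^+ 2).
Proof.
have lb : lipschitz_fun b by exists L.
have [B dB] := continuous_primitive (lipschitz_fun_continuous lb).
have cB : continuous B.
  move=> x; apply: differentiable_continuous; apply/derivable1_diffP.
  exact: (@ex_derive _ _ _ _ _ _ _ (dB x)).
have [D dD] := continuous_primitive cB.
have B_prim := primitive_taylor dB b_lip.
exists B, D; split=> //; apply: primitive_taylor => //.
apply: (@abs_subdivision_le _ _ _ L) => s h h0.
have := B_prim s h; have /andP[b0 bc] := b_bounds s.
rewrite !ler_norml => /andP[h1 h2].
have p0 : 0 <= h * b s by exact: mulr_ge0.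
have p1 : h * b s <= c * h by rewrite mulrC ler_wpM2r.
by apply/andP; split; lra.
Qed.

(** Equal averages in both directions make the two increments in the flux inequality cancel up to e
    * T, whatever the sign of [E id]. *)
Lemma uniform_average_periodic (alpha : R) :
  (forall e, 0 < e -> exists m0, forall m, (m0 <= m)%N -> forall t,
    `|\sum_(j < m) b (t + j%:R * w) - alpha * m%:R| <= e * m%:R) ->
  forall s, b (s + w) = b s.
Proof.
move=> avg; have [B [D [B_prim D_prim]]] := exists_primitives.
apply: harmonic_periodic.
apply: (superharmonic_harmonic hE b_bounds b_lip B_prim D_prim b_super (s0 := 0)).
move=> s1 s2 e _ e0 T0.
pose K := `|E id| + 1.
have K0 : 0 < K by rewrite ltr_wpDl.
have [m0 m0P] := avg (e / (2 * K)) (divr_gt0 e0 (mulr_gt0 (ltr0n _ 2) K0)).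
have [m m0m T0m] : exists2 m, (m0 <= m)%N & T0 <= m%:R * w.
  exists (maxn m0 (Num.bound (T0 / w))); first exact: leq_maxl.
  rewrite -ler_pdivrMr//; have [T00|T00] := leP 0 (T0 / w).
    apply: le_trans (ltW (archi_boundP T00)) _.
    by rewrite ler_nat leq_maxr.
  by apply: le_trans (ltW T00) _; exact: ler0n.
exists (m%:R * w) => //.
have inc s : `|B (s + m%:R * w) - B s - alpha * m%:R * w| <= e / (2 * K) * m%:R * w.
  have h t := m0P m m0m t.
  have lo : (alpha * m%:R - e / (2 * K) * m%:R) * w <= B (s + m%:R * w) - B s.
    apply: (@increment_ge B B_prim) => t _.
    by have := h (s + t); rewrite ler_norml => /andP[]; rewrite /S; lra.
  have hi : B (s + m%:R * w) - B s <= (alpha * m%:R + e / (2 * K) * m%:R) * w.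
    apply: (@increment_le B B_prim) => t _.
    by have := h (s + t); rewrite ler_norml => /andP[]; rewrite /S; lra.
  by rewrite ler_norml; apply/andP; split; lra.
have := inc s2; have := inc (s1 - m%:R * w); rewrite subrK.
set i1 := _ - B (s1 - _); set i2 := _ - B s2 => h1 h2.
apply: le_trans (ler_norm _) _; rewrite normrM.
have h3 : `|i2 - i1| <= e / K * (m%:R * w).
  have -> : e / K = 2 * (e / (2 * K)) by field; rewrite gt_eqF.
  move: h1 h2; rewrite !ler_norml => /andP[h3 h4] /andP[h5 h6].
  by apply/andP; split; lra.
apply: (@le_trans _ _ (K * (e / K * (m%:R * w)))); first by rewrite ler_pM// lerDl.
by rewrite mulrA [K * _]mulrC divfK// gt_eqF.
Qed.

(** Right increments of the primitive are negligible and left ones are nonnegative, so [0 <= E id]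
    gives the flux inequality the right sign. *)
Lemma right_average_null_periodic : 0 <= E id ->
  (forall s e, w <= s -> 0 < e -> exists m0, forall m, (m0 <= m)%N ->
    forall t, 0 <= t <= w -> \sum_(j < m) b (s + t + j%:R * w) <= e * m%:R) ->
  forall s, b (s + w) = b s.
Proof.
move=> E0 avg; have [B [D [B_prim D_prim]]] := exists_primitives.
apply: harmonic_periodic.
apply: (superharmonic_harmonic hE b_bounds b_lip B_prim D_prim b_super (s0 := w)).
move=> s1 s2 e ws2 e0 T0.
pose K := E id + 1.
have K0 : 0 < K by rewrite ltr_wpDl.
have [m0 m0P] := avg s2 (e / K) ws2 (divr_gt0 e0 K0).
have [m m0m T0m] : exists2 m, (m0 <= m)%N & T0 <= m%:R * w.
  exists (maxn m0 (Num.bound (T0 / w))); first exact: leq_maxl.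
  rewrite -ler_pdivrMr//; have [T00|T00] := leP 0 (T0 / w).
    apply: le_trans (ltW (archi_boundP T00)) _.
    by rewrite ler_nat leq_maxr.
  by apply: le_trans (ltW T00) _; exact: ler0n.
exists (m%:R * w) => //.
have h2 := @increment_le B B_prim m s2 _ (m0P m m0m).
have h1 : 0 <= B (s1 - m%:R * w + m%:R * w) - B (s1 - m%:R * w).
  rewrite -[leLHS](mul0r w); apply: (@increment_ge B B_prim m) => t _.
  by apply: sumr_ge0 => j _; have /andP[] := b_bounds (s1 - m%:R * w + t + j%:R * w).
rewrite subrK in h1.
apply: (@le_trans _ _ (E id * (e / K * m%:R * w))).
  by rewrite ler_wpM2l// lerBlDr (le_trans h2)// lerDl.
have -> : E id * (e / K * m%:R * w) = E id / K * (e * (m%:R * w)).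
  by field; rewrite gt_eqF.
rewrite ler_piMl// ?ler_pdivrMr// ?mul1r ?lerDl//.
by rewrite !mulr_ge0// ltW.
Qed.

End superharmonic_periodic.

(** * Expectations of Lipschitz functions *)

(** The discontinuities are countable, hence Lebesgue-null, and cannot fill an interval of positive
    length. *)
Lemma nondecreasing_continuity_point (R : realType) (F : R -> R) (a b : R) :
  a < b -> {homo F : x y / x <= y} ->
  exists2 t, a < t < b & {for t, continuous F}.
Proof.
move=> ab ndF.
have ndF' : {in `[a, b] &, nondecreasing_fun F} by move=> ? ? _ _; exact: ndF.
have cD := discontinuity_countable ndF'.
have [t tab nD] : exists2 t, t \in `]a, b[ & ~ discontinuity F t.
  apply: contrapT => H.
  have : lebesgue_measure (`]a, b[%classic : set R) = 0%E.
    rewrite -(countable_lebesgue_measure0 cD); congr lebesgue_measure.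
    apply/seteqP; split=> [t tab|t []//]; split; first exact: tab.
    by apply: contrapT => nD; apply: H; exists t.
  by rewrite lebesgue_measure_itv/= lte_fin ab => -[] /eqP; rewrite subr_eq0 gt_eqF.
exists t => //.
have ct : cvg (F x @[x --> t^'-]).
  apply: nondecreasing_at_left_is_cvgr; near=> z.
    by move=> ? ? _ _; exact: ndF.
  exists (F t) => _ [y /= yzt <-]; apply: ndF; move: yzt; rewrite in_itv/=.
  by move=> /andP[_ /ltW].
have ct' : cvg (F x @[x --> t^'+]).
  apply: nondecreasing_at_right_is_cvgr; near=> z.
    by move=> ? ? _ _; exact: ndF.
  exists (F t) => _ [y /= yzt <-]; apply: ndF; move: yzt; rewrite in_itv/=.
  by move=> /andP[/ltW].
(* Not being a jump point means that the one-sided limits agree; monotonicity then squeezes [F t]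
   between them. *)
have Et : lim (F x @[x --> t^'-]) = lim (F x @[x --> t^'+]).
  by apply/eqP; apply: contrapT => /negP ?; apply: nD; split.
have l1 : lim (F x @[x --> t^'-]) <= F t.
  apply: limr_le => //; near=> z; apply: ndF; near: z.
  exact: nbhs_left_le.
have l2 : F t <= lim (F x @[x --> t^'+]).
  apply: limr_ge => //; near=> z; apply: ndF; near: z.
  exact: nbhs_right_ge.
have Ft : F t = lim (F x @[x --> t^'+]).
  by apply/eqP; rewrite eq_le l2 -Et l1.
have Ftl : F t = lim (F x @[x --> t^'-]) by rewrite Ft Et.
apply/cvgrPdist_le => e e0.
have [z1 [tz1 Fz1]] : exists z, t < z /\ `|F t - F z| <= e.
  apply: (@filter_ex _ t^'+); near=> z; split; first by near: z; exact: nbhs_right_gt.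
  by near: z; rewrite Ft; apply: cvgr_dist_le.
have [z2 [tz2 Fz2]] : exists z, z < t /\ `|F t - F z| <= e.
  apply: (@filter_ex _ t^'-); near=> z; split; first by near: z; exact: nbhs_left_lt.
  by near: z; rewrite Ftl; apply: cvgr_dist_le.
near=> y.
have yz1 : F y <= F z1 by apply: ndF; apply: ltW; near: y; exact: lt_nbhsl.
have yz2 : F z2 <= F y by apply: ndF; apply: ltW; near: y; exact: lt_nbhsr.
move: Fz1 Fz2; rewrite !ler_norml => /andP[h1 h2] /andP[h3 h4].
by apply/andP; split; lra.
Unshelve. all: end_near. Qed.

Definition mean (R : realType) (d : measure_display) (T : measurableType d)
    (P : probability T R) (X : T -> R) (f : R -> R) : R :=
  \int[P]_w f (X w).

Section mean_lipschitz.
Context (R : realType) (d : measure_display) (T : measurableType d)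
  (P : probability T R) (X : {RV P >-> R}).

Lemma measurable_lipschitz (f : R -> R) : lipschitz_fun f ->
  measurable_fun setT f.
Proof.
by move=> /lipschitz_fun_continuous cf; exact: continuous_measurable_fun.
Qed.

Lemma measurable_lipschitz_comp (f : R -> R) : lipschitz_fun f ->
  measurable_fun setT (fun w => f (X w)).
Proof.
move=> lf; apply: (@measurableT_comp _ _ _ _ _ _ f) => //.
exact: measurable_lipschitz.
Qed.

Hypothesis iX : P.-integrable setT (EFin \o X).

Lemma integrable_lipschitz (f : R -> R) : lipschitz_fun f ->
  P.-integrable setT (EFin \o (fun w => f (X w))).
Proof.
move=> lf; have [k k0 fk] := lipschitz_fun_ge0 lf.
apply: (@le_integrable _ _ _ _ _ _ _ (EFin \o (fun w => `|f 0| + k * `|X w|))) => //.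
- by apply/measurable_EFinP; exact: measurable_lipschitz_comp.
- move=> w _; rewrite /= lee_fin [leRHS]ger0_norm ?addr_ge0 ?mulr_ge0//.
  have -> : f (X w) = f 0 + (f (X w) - f 0) by rewrite addrC subrK.
  rewrite (le_trans (ler_normD _ _))// lerD2l.
  by rewrite (le_trans (fk _ _))// subr0.
- rewrite (_ : _ \o _ = (fun w => (`|f 0|%:E + k%:E * `|(X w)%:E|))%E)//.
  apply: integrableD => //; first exact: finite_measure_integrable_cst.
  by apply: integrableZl => //; exact: integrable_norm iX.
Qed.

Lemma mean_lipschitz : lipschitz_mean (mean P X).
Proof.
split=> [c|a f g lf lg|f g lf lg fg|e e0].
- rewrite /mean Rintegral_cst//; transitivity (c * fine 1%E); last by rewrite mulr1.
  by congr (_ * fine _); exact: probability_setT.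
- rewrite /mean RintegralD//; last 2 first.
  + by apply: (integrable_lipschitz (lipschitz_funZ a lf)).
  + exact: integrable_lipschitz.
  by rewrite RintegralZl//; exact: integrable_lipschitz.
- by apply: le_Rintegral => //; exact: integrable_lipschitz.
- pose f_ n w := (Num.max (`|X w| - n%:R) 0)%:E.
  have lf n : lipschitz_fun (fun y : R => Num.max (`|y| - n%:R) 0) by lipschitz.
  have mf_ n : measurable_fun setT (f_ n).
    by apply/measurable_EFinP; exact: measurable_lipschitz_comp (lf n).
  have f_0 w : f_ n w @[n --> \oo] --> 0%E.
    apply: cvg_near_cst; near=> n; rewrite /f_; congr EFin.
    apply/max_idPr; rewrite subr_le0; near: n.
    exact: nbhs_infty_ger.
  have f_le n w : (`|f_ n w| <= `|X w|%:E)%E.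
    rewrite /f_ /= lee_fin ger0_norm ?le_max ?lexx ?orbT//.
    by rewrite ge_max normr_ge0 andbT gerBl.
  have [_ _] := @dominated_convergence _ _ _ P setT measurableT f_ (cst 0%E)
    (fun w => `|X w|%:E) mf_ (measurable_cst _) (aeW _ (fun w _ => f_0 w))
    (integrable_norm iX) (aeW _ (fun w n _ => f_le n w)).
  rewrite integral0 => /fine_cvg cvg0.
  have [n [n0 nP]] := filter_ex (filterI (nbhs_infty_gt 0) (cvgr_le _ cvg0 _ e0)).
  by exists n%:R; [rewrite ltr0n|exact: nP].
Unshelve. all: end_near. Qed.

End mean_lipschitz.

(** * Weak convergence on truncated ramps *)

Lemma near_forall_lt (I : Type) (F : set_system I) {FF : Filter F}
    (Q : nat -> I -> Prop) n :
  (forall k, \forall i \near F, Q k i) ->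
  \forall i \near F, forall k, (k < n)%N -> Q k i.
Proof.
move=> FQ; elim: n => [|n IH]; first by near=> i.
near=> i => k; rewrite ltnS leq_eqVlt => /predU1P[->|]; first by near: i.
by move: k; near: i.
Unshelve. all: end_near. Qed.

Lemma cvg_sumr (R : realType) (I J : Type) (F : set_system I) {FF : Filter F}
    (r : seq J) (f : J -> I -> R) (l : J -> R) :
  (forall j, f j i @[i --> F] --> l j) ->
  \sum_(j <- r) f j i @[i --> F] --> \sum_(j <- r) l j.
Proof.
move=> fl; elim: r => [|j r IH].
  by rewrite big_nil; under eq_cvg do rewrite big_nil; exact: cvg_cst.
by rewrite big_cons; under eq_cvg do rewrite big_cons; exact: cvgD.
Qed.

(** The integral over t in [a, a + A] of the indicator of t < y. Its mean is the integral of the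
    tail P(X > t), hence monotone for the stochastic order and continuous under weak convergence. *)
Definition ramp (R : realType) (a A y : R) : R := Num.min (Num.max (y - a) 0) A.

Section ramp.
Context (R : realType).
Implicit Types a A y : R.

Lemma lipschitz_ramp a A : lipschitz_fun (ramp a A).
Proof. by rewrite /ramp; lipschitz. Qed.

Lemma ramp_ge0 a A y : 0 <= A -> 0 <= ramp a A y.
Proof. by move=> A0; rewrite le_min A0 le_max lexx orbT. Qed.

Lemma ramp_le a A y : ramp a A y <= A.
Proof. by rewrite ge_min lexx orbT. Qed.

Lemma rampD a A B y : 0 <= A -> 0 <= B ->
  ramp a (A + B) y = ramp a A y + ramp (a + A) B y.
Proof.
move=> A0 B0; rewrite /ramp.
by case: (leP (y - a) 0) => h1; case: (leP (y - (a + A)) 0) => h2;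
  case: leP => h3; case: leP => h4; case: leP => h5; lra.
Qed.

Lemma ramp_homo a A : {homo ramp a A : y z / y <= z}.
Proof.
move=> y z yz; rewrite /ramp le_min !ge_min lexx orbT andbT ge_max !le_max lexx.
by rewrite lerD2r yz orbT.
Qed.

Lemma ramp_tailE a A y : 0 <= A ->
  Num.max y a = a + (ramp a A y + Num.max (y - (a + A)) 0).
Proof.
move=> A0; rewrite /ramp; have [ya|ay] := leP y a.
  rewrite (max_r (x := y - a)) ?subr_le0// min_l// max_r ?add0r ?addr0//.
  by rewrite subr_le0 ler_wpDr.
rewrite max_l ?subr_ge0 ?(ltW ay)//; have [yA|Ay] := leP (y - a) A.
  by rewrite max_r; [ring|lra].
by rewrite max_l; [ring|lra].
Qed.

Lemma le_ramp_tail a A y : 0 <= a -> 0 <= A ->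
  Num.max (y - a) 0 <= ramp a A y + Num.max (`|y| - A) 0.
Proof.
move=> a0 A0; have t0 : 0 <= Num.max (`|y| - A) 0 by rewrite le_max lexx orbT.
rewrite /ramp; have [yA|Ay] := leP (Num.max (y - a) 0) A; first by rewrite lerDl.
have : `|y| - A <= Num.max (`|y| - A) 0 by rewrite le_max lexx.
have := ler_norm y; rewrite ge_max; move: t0 => _ ny nA.
have := normr_ge0 y; move=> ny0; apply/andP; split; lra.
Qed.

Lemma ramp_le_tail A B y : 0 <= A -> 0 <= B ->
  ramp (- A) (A + B) y <= A + (y + Num.max (`|y| - A) 0).
Proof.
move=> A0 B0; rewrite /ramp ge_min ge_max; apply/orP; left.
have := ler_norm (- y); rewrite normrN => ny.
have m0 : 0 <= Num.max (`|y| - A) 0 by rewrite le_max lexx orbT.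
have mA : `|y| - A <= Num.max (`|y| - A) 0 by rewrite le_max lexx.
apply/andP; split; lra.
Qed.

Lemma ramp_norm A y : 0 <= A -> ramp 0 A `|y| = A + ramp 0 A y - ramp (- A) A y.
Proof.
move=> A0; rewrite /ramp opprK !subr0.
have [y0|y0] := leP 0 y; last rewrite (ltr0_norm y0).
  have -> : Num.min (Num.max (y + A) 0) A = A.
    by rewrite max_l ?min_r// ?addr_ge0// lerDr.
  by rewrite (ger0_norm y0) (max_l y0); ring.
by (do !case: leP => ?); lra.
Qed.

End ramp.

Section mean_ramp.
Context (R : realType) (d : measure_display) (T : measurableType d)
  (P : probability T R) (X : {RV P >-> R}).

Definition rtail (t : R) : R := fine (ccdf X t).

Let tailE t : [set w | t < X w] = X @^-1` `]t, +oo[.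
Proof. by apply/seteqP; split => w /=; rewrite in_itv/= andbT. Qed.

Lemma measurable_tail t : measurable [set w | t < X w].
Proof. by rewrite tailE; exact: measurable_funPTI. Qed.

Lemma rtailE t : (rtail t)%:E = P [set w | t < X w].
Proof. by rewrite /rtail fineK ?tailE// fin_num_measure. Qed.

Lemma rtail_ge0 t : 0 <= rtail t.
Proof. by rewrite fine_ge0. Qed.

Lemma rtail_le1 t : rtail t <= 1.
Proof. by rewrite -lee_fin rtailE; apply: probability_le1; exact: measurable_tail. Qed.

Lemma integrable_bounded_lipschitz (f : R -> R) (c : R) : lipschitz_fun f ->
  (forall y, `|f y| <= c) -> P.-integrable setT (EFin \o (fun w => f (X w))).
Proof.
move=> lf fc; apply: measurable_bounded_integrable => //.
- by rewrite (le_lt_trans (probability_le1 P measurableT))// ltry.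
- exact: measurable_lipschitz_comp.
- exists c; split; first by rewrite num_real.
  by move=> x cx w _ /=; apply: le_trans (fc _) _; exact: ltW.
Qed.

Lemma integrable_ramp a A : 0 <= A ->
  P.-integrable setT (EFin \o (fun w => ramp a A (X w))).
Proof.
move=> A0; apply: (@integrable_bounded_lipschitz (ramp a A) A).
  exact: lipschitz_ramp.
by move=> y; rewrite ger0_norm ?ramp_ge0 ?ramp_le.
Qed.

Lemma integrable_tail (r t : R) :
  P.-integrable setT (EFin \o (fun w => r * \1_[set w | t < X w] w)).
Proof.
apply: measurable_bounded_integrable => //.
- by rewrite (le_lt_trans (probability_le1 P measurableT))// ltry.
- by apply: measurable_funM => //; apply: measurable_indic; exact: measurable_tail.
- exists `|r|; split; first by rewrite num_real.
  move=> x rx w _ /=; apply: le_trans (ltW rx); rewrite normrM ler_piMr//.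
  by rewrite indicE; case: (_ \in _); rewrite ?normr1 ?normr0.
Qed.

Lemma Rintegral_tail (r t : R) : \int[P]_w (r * \1_[set w | t < X w] w) = r * rtail t.
Proof.
rewrite RintegralZl//; last first.
  by have := integrable_tail 1 t; under eq_fun do rewrite mul1r.
congr (_ * _); apply: EFin_inj; rewrite rtailE.
rewrite /Rintegral fineK.
  by rewrite integral_indic ?setIT//; exact: measurable_tail.
by rewrite integral_indic ?setIT ?fin_num_measure//; exact: measurable_tail.
Qed.

Lemma mean_ramp1_le a r t : 0 <= r -> t <= a -> mean P X (ramp a r) <= r * rtail t.
Proof.
move=> r0 ta; rewrite -Rintegral_tail; apply: le_Rintegral => //.
- exact: integrable_ramp.
- exact: integrable_tail.
move=> w _; rewrite indicE; have [tX|tX] := ltP t (X w).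
  by rewrite mem_set// mulr1 ramp_le.
rewrite memNset/= ?mulr0 /ramp; last by rewrite ltNge tX.
by rewrite ge_min ge_max subr_le0 (le_trans tX ta) lexx.
Qed.

Lemma mean_ramp1_ge a r t : 0 <= r -> a + r <= t -> r * rtail t <= mean P X (ramp a r).
Proof.
move=> r0 ta; rewrite -Rintegral_tail; apply: le_Rintegral => //.
- exact: integrable_tail.
- exact: integrable_ramp.
move=> w _; rewrite indicE; have [tX|tX] := ltP t (X w).
  by rewrite mem_set// mulr1 /ramp le_min lexx le_max andbT; apply/orP; left; lra.
by rewrite memNset/= ?mulr0 ?ramp_ge0// ltNge tX.
Qed.

Lemma mean_rampS a r n : 0 <= r ->
  mean P X (ramp a (n.+1%:R * r)) =
  mean P X (ramp a (n%:R * r)) + mean P X (ramp (a + n%:R * r) r).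
Proof.
move=> r0; rewrite /mean -RintegralD//; last 2 first.
- by apply: integrable_ramp; rewrite mulr_ge0.
- exact: integrable_ramp.
apply: eq_Rintegral => w _; rewrite -rampD ?mulr_ge0//.
by rewrite -natr1 mulrDl mul1r.
Qed.

Lemma mean_ramp0 a : mean P X (ramp a 0) = 0.
Proof.
transitivity (\int[P]_(w in setT) (0 : R)); last by rewrite Rintegral_cst// mul0r.
by apply: eq_Rintegral => w _; apply/eqP; rewrite eq_le ramp_le ramp_ge0.
Qed.

(** Upper Riemann sum of the tail: each sample point lies at or to the left of its cell. *)
Lemma mean_ramp_le a r n t : 0 <= r ->
  (forall i, t i <= a + i%:R * r) ->
  mean P X (ramp a (n%:R * r)) <= \sum_(i < n) r * rtail (t i).
Proof.
move=> r0 ta; elim: n => [|n IH]; first by rewrite mul0r mean_ramp0 big_ord0.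
by rewrite big_ord_recr/= mean_rampS// lerD// mean_ramp1_le.
Qed.

Lemma mean_ramp_ge a r n t : 0 <= r ->
  (forall i, a + i.+1%:R * r <= t i) ->
  \sum_(i < n) r * rtail (t i) <= mean P X (ramp a (n%:R * r)).
Proof.
move=> r0 ta; elim: n => [|n IH]; first by rewrite mul0r mean_ramp0 big_ord0.
rewrite big_ord_recr/= mean_rampS// lerD// mean_ramp1_ge//.
by apply: le_trans (ta n); rewrite -addrA lerD2l -natr1 mulrDl mul1r.
Qed.

End mean_ramp.

Section ramp_cvg.
Context (R : realType) (I : Type) (F : set_system I) {FF : Filter F}
  (d d' : measure_display) (T : measurableType d) (T' : measurableType d')
  (P_ : I -> probability T R) (X_ : forall i, {RV (P_ i) >-> R})
  (P : probability T' R) (X : {RV P >-> R}).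
Hypothesis X_cvg : cvg_in_distribution F X_ X.

Let rtail_cvg t : {for t, continuous (cdf X)} ->
  rtail (X_ i) t @[i --> F] --> rtail X t.
Proof.
move=> ct.
have rtail_cdf (dd : measure_display) (TT : measurableType dd)
    (Q : probability TT R) (Y : {RV Q >-> R}) s : rtail Y s = 1 - fine (cdf Y s).
  have := cdf_ccdf_1 Y s; rewrite /rtail.
  have : cdf Y s \is a fin_num by rewrite fin_num_measure.
  have : ccdf Y s \is a fin_num by rewrite fin_num_measure.
  move=> /fineK <- /fineK <- /= [] <-; lra.
under eq_cvg do rewrite rtail_cdf.
rewrite rtail_cdf; apply: cvgB; first exact: cvg_cst.
apply: fine_cvg; rewrite fineK; last by rewrite fin_num_measure.
exact: X_cvg.
Qed.

Let cdf_continuity_point a b : a < b ->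
  exists t, a < t < b /\ {for t, continuous (cdf X)}.
Proof.
move=> ab.
have ndF : {homo (fun t => fine (cdf X t)) : x y / x <= y}.
  move=> x y xy; apply: fine_le; rewrite ?fin_num_measure//.
  exact: cdf_nondecreasing.
have [t tab ct] := nondecreasing_continuity_point ab ndF.
exists t; split => //.
have : (fine (cdf X x))%:E @[x --> t] --> (fine (cdf X t))%:E.
  by apply: cvg_EFin; [near=> x|].
rewrite fineK ?fin_num_measure//; under eq_cvg do rewrite fineK ?fin_num_measure//.
by [].
Unshelve. all: end_near. Qed.

(** Riemann sums of the tails, sampled at continuity points of the limiting distribution function,
    squeeze both means. *)
Lemma ramp_cvg a A : 0 < A ->
  mean (P_ i) (X_ i) (ramp a A) @[i --> F] --> mean P X (ramp a A).
Proof.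
move=> A0; apply/cvgrPdist_le => e e0.
pose n := (Num.bound (A / (e / 4))).+1.
pose r := A / n%:R.
have n0 : 0 < n%:R :> R by [].
have r0 : 0 < r by rewrite divr_gt0.
have rA : n%:R * r = A by rewrite /r mulrC divfK// gt_eqF.
have re : r <= e / 4.
  rewrite /r ler_pdivrMr// mulrC -ler_pdivrMr ?divr_gt0//.
  apply: le_trans (ltW (archi_boundP _)) _; first by rewrite !divr_ge0// ltW.
  by rewrite ler_nat.
have : forall i : nat, exists t, (a + i%:R * r - r < t < a + i%:R * r) /\
    {for t, continuous (cdf X)}.
  by move=> i; apply: cdf_continuity_point; rewrite ltrBlDr ltrDl.
move=> /choice[t t_].
have t1 i : t i <= a + i%:R * r by have [/andP[_ /ltW]] := t_ i.
(* The point [t i] lies in the cell before a + i * r, so an index shift by 2 turns upper samples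
   into lower ones; the two sums then telescope to within 2 * r. *)
have t2 i : a + i.+1%:R * r <= t i.+2.
  have [/andP[h _] _] := t_ i.+2; move: h; rewrite -!natr1; lra.
have sum2 : \sum_(i < n) r * rtail X (t i) <=
    \sum_(i < n) r * rtail X (t i.+2) + e / 2.
  have tele k : \sum_(i < k) r * rtail X (t i)
      - \sum_(i < k) r * rtail X (t i.+2) =
      r * (rtail X (t 0%N) + rtail X (t 1%N) - rtail X (t k) - rtail X (t k.+1)).
    elim: k => [|k IH]; first by rewrite !big_ord0; ring.
    by rewrite !big_ord_recr/= opprD addrACA IH; ring.
  rewrite addrC -lerBlDr tele; apply: (@le_trans _ _ (r * 2)); last lra.
  rewrite ler_wpM2l ?(ltW r0)//.
  have := rtail_le1 X (t 0%N); have := rtail_le1 X (t 1%N).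
  have := rtail_ge0 X (t n); have := rtail_ge0 X (t n.+1); lra.
have up := mean_ramp_le X n (ltW r0) t1.
have lo := mean_ramp_ge X n (ltW r0) t2.
rewrite rA in up lo.
pose s i k := \sum_(j < n) r * rtail (X_ i) (t (k + j)%N).
pose s0 k := \sum_(j < n) r * rtail X (t (k + j)%N).
have s_cvg k : s i k @[i --> F] --> s0 k.
  rewrite /s /s0; apply: cvg_sumr => j; apply: cvgMr.
  by apply: rtail_cvg; have [] := t_ (k + j)%N.
have e4 : 0 < e / 4 by rewrite divr_gt0.
near=> i.
have up_i := mean_ramp_le (X_ i) n (ltW r0) t1.
have lo_i := mean_ramp_ge (X_ i) n (ltW r0) t2.
rewrite rA in up_i lo_i.
have : `|\sum_(j < n) r * rtail X (t j) - \sum_(j < n) r * rtail (X_ i) (t j)| <= e / 4.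
  by near: i; have /cvgrPdist_le := s_cvg 0%N; exact.
have : `|\sum_(j < n) r * rtail X (t j.+2) - \sum_(j < n) r * rtail (X_ i) (t j.+2)|
    <= e / 4.
  by near: i; have /cvgrPdist_le := s_cvg 2; exact.
rewrite !ler_norml => /andP[h1 h2] /andP[h3 h4].
move: re sum2 up lo up_i lo_i h1 h2 h3 h4; clear => *.
by apply/andP; split; lra.
Unshelve. all: end_near. Qed.

End ramp_cvg.

(** * Moments and drift of the jumps *)

Section norm_rv.
Context (R : realType) (d : measure_display) (T : measurableType d)
  (P : probability T R) (X : {RV P >-> R}).

Definition norm_rv (w : T) : R := `|X w|.

Let measurable_norm_rv : measurable_fun setT norm_rv.
Proof. by apply: measurableT_comp. Qed.

HB.instance Definition _ :=
  isMeasurableFun.Build _ _ _ _ norm_rv measurable_norm_rv.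

End norm_rv.

Section stochastic_order.
Context (R : realType) (d d' : measure_display)
  (T : measurableType d) (T' : measurableType d')
  (P : probability T R) (X : {RV P >-> R})
  (P' : probability T' R) (Y : {RV P' >-> R}).
Hypothesis XY : forall t, rtail X t <= rtail Y t.

(** An upper sum for X against a lower sum for Y: with n + 1 cells the loss is at most one cell
    width. *)
Lemma mean_ramp_mono a A : 0 <= A -> mean P X (ramp a A) <= mean P' Y (ramp a A).
Proof.
move=> A0; rewrite -subr_le0; apply: (@ler_bounded_multiples _ _ A) => n.
pose r := A / n.+1%:R.
have n0 : 0 < n.+1%:R :> R by [].
have r0 : 0 <= r by rewrite divr_ge0.
have rA : n.+1%:R * r = A by rewrite /r mulrC divfK// gt_eqF.
pose t i := a + i%:R * r.
have up : mean P X (ramp a A) <= \sum_(i < n.+1) r * rtail X (t i).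
  by rewrite -rA; exact: mean_ramp_le.
have lo : \sum_(i < n.+1) r * rtail Y (t i.+1) <= mean P' Y (ramp a A).
  by rewrite -rA; apply: (@mean_ramp_ge _ _ _ _ _ _ _ _ (fun i => t i.+1)).
have tele k : \sum_(i < k) r * rtail Y (t i) - \sum_(i < k) r * rtail Y (t i.+1)
    = r * (rtail Y (t 0%N) - rtail Y (t k)).
  elim: k => [|k IH]; first by rewrite !big_ord0; ring.
  by rewrite !big_ord_recr/= opprD addrACA IH; ring.
have le_sum : \sum_(i < n.+1) r * rtail X (t i) <= \sum_(i < n.+1) r * rtail Y (t i).
  by apply: ler_sum => i _; rewrite ler_wpM2l.
have le_r : r * (rtail Y (t 0%N) - rtail Y (t n.+1)) <= r.
  rewrite ler_piMr//; have := rtail_le1 Y (t 0%N); have := rtail_ge0 Y (t n.+1); lra.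
rewrite -[leRHS]rA ler_pM2l//; have := tele n.+1; lra.
Qed.

End stochastic_order.

Section integrable.
Context (R : realType) (d : measure_display) (T : measurableType d)
  (P : probability T R) (X : {RV P >-> R}).

Lemma integrable_of_ramp (M : R) :
  (forall n, mean P (norm_rv X) (ramp 0 n%:R) <= M) ->
  P.-integrable setT (EFin \o X).
Proof.
move=> XM; apply/integrableP; split; first exact/measurable_EFinP.
have : (\int[P]_w `|(X w)%:E| <= M%:E)%E.
  pose g n w := (ramp 0 n%:R `|X w|)%:E.
  have mg n : measurable_fun setT (g n).
    apply/measurable_EFinP.
    exact: (measurable_lipschitz_comp (norm_rv X) (lipschitz_ramp 0 n%:R)).
  have g0 n w : setT w -> (0 <= g n w)%E by move=> _; rewrite lee_fin ramp_ge0.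
  have ndg w : setT w -> nondecreasing_seq (g ^~ w).
    move=> _ m n mn; rewrite /g lee_fin /ramp le_min ge_min lexx/=.
    by rewrite ge_min ler_nat mn orbT.
  have := @cvg_monotone_convergence _ _ _ P setT measurableT g mg g0 ndg.
  under eq_integral.
    move=> w _; rewrite (_ : limn _ = `|X w|%:E); last first.
      apply/cvg_lim => //; apply: cvg_near_cst; near=> n; rewrite /g /ramp subr0.
      congr EFin; rewrite max_l//; apply/min_idPl; near: n; exact: nbhs_infty_ger.
    over.
  move=> gcvg; apply: (cvge_to_le gcvg); near=> n.
  have <- : (mean P (norm_rv X) (ramp 0 n%:R))%:E = (\int[P]_w g n w)%E.
    rewrite /mean /Rintegral fineK//; apply: integrable_fin_num => //.
    exact: (integrable_ramp (norm_rv X)).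
  by rewrite lee_fin.
by move=> /le_lt_trans; apply; exact: ltry.
Unshelve. all: end_near. Qed.

Lemma mean_norm f : mean P (norm_rv X) f = mean P X (fun y => f `|y|).
Proof. by []. Qed.

End integrable.

Section moments.
Context (R : realType) (S : set R) (K : R.-pker R ~> R)
  (d1 : measure_display) (T1 : measurableType d1) (P1 : probability T1 R)
  (xi : {RV P1 >-> R})
  (d2 : measure_display) (T2 : measurableType d2) (P2 : probability T2 R)
  (Xi : {RV P2 >-> R}).
Hypothesis S_unbounded : forall M, exists2 z, S z & M < z.
Hypothesis cvg_xi : cvg_in_distribution (within S (pinfty_nbhs R)) (jump K) xi.
Hypothesis Xi_mean : ('E_P2[Xi] < +oo)%E.
Hypothesis xi_le_Xi : forall x, S x ->
  st_le (step_law K x) (fun y => `|jump K x y|) P2 Xi.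

Lemma rtail_jump_le z t : S z -> rtail (P := step_law K z) (norm_rv (jump K z)) t <= rtail Xi t.
Proof. by move=> Sz; rewrite -lee_fin !rtailE; exact: xi_le_Xi. Qed.

(** A finite upper bound on the expectation does not control the negative part of [Xi]; dominating
    some nonnegative |xi(z)| does. *)
Lemma Xi_ge0_ae : {ae P2, forall w, 0 <= Xi w}.
Proof.
have [z Sz _] := S_unbounded 0.
have tail1 n : rtail Xi (- n.+1%:R^-1) = 1.
  apply/eqP; rewrite eq_le rtail_le1/=; apply: le_trans (rtail_jump_le _ Sz).
  rewrite -lee_fin rtailE.
  rewrite (_ : [set w | _] = setT); first by rewrite (probability_setT (step_law K z)).
  apply/seteqP; split=> // w _ /=.
  by apply: (@lt_le_trans _ _ 0); rewrite ?oppr_lt0 ?invr_gt0// normr_ge0.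
apply: (@negligibleS _ _ _ _ (\bigcup_n ~` [set w | - n.+1%:R^-1 < Xi w])).
  move=> w /= /negP; rewrite -ltNge => Xw.
  exists (Num.bound (- Xi w)^-1) => //=; apply/negP; rewrite -leNgt.
  rewrite lerNr -[leRHS]invrK lef_pV2 ?posrE ?invr_gt0 ?oppr_gt0//.
  apply: le_trans (ltW (archi_boundP _)) _; first by rewrite invr_ge0 oppr_ge0 ltW.
  by rewrite ler_nat.
apply: negligible_bigcup => n; exists (~` [set w | - n.+1%:R^-1 < Xi w]); split => //.
  by apply: measurableC; exact: measurable_tail.
apply: etrans (probability_setC P2 (measurable_tail Xi _)) _.
by rewrite -rtailE tail1 subee.
Qed.

Lemma Xi_integrable : P2.-integrable setT (EFin \o Xi).
Proof.
have mXi : measurable_fun setT (EFin \o Xi) by exact/measurable_EFinP.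
apply/integrableP; split=> //.
have -> : (\int[P2]_w `|(EFin \o Xi) w| = 'E_P2[Xi])%E.
  rewrite expectation_def; apply: ae_eq_integral => //.
    exact: measurableT_comp.
  by apply: filterS Xi_ge0_ae => w X0 _ /=; rewrite ger0_norm.
exact: Xi_mean.
Qed.

Let iXi := Xi_integrable.

Let jump_ramp_le z A : S z -> 0 <= A ->
  mean (step_law K z) (norm_rv (jump K z)) (ramp 0 A) <= mean P2 Xi (fun y => `|y|).
Proof.
move=> Sz A0; apply: (@le_trans _ _ (mean P2 Xi (ramp 0 A))).
  by apply: mean_ramp_mono => // t; exact: rtail_jump_le.
apply: (mean_mono (mean_lipschitz iXi)); first exact: lipschitz_ramp.
  by lipschitz.
move=> y; rewrite /ramp subr0 ge_min; apply/orP; left.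
by rewrite ge_max normr_ge0 ler_norm.
Qed.

Lemma jump_integrable z : S z -> (step_law K z).-integrable setT (EFin \o jump K z).
Proof.
move=> Sz; apply: (@integrable_of_ramp _ _ _ _ _ (mean P2 Xi (fun y => `|y|))) => n.
exact: jump_ramp_le.
Qed.

Let S_filter : ProperFilter (within S (pinfty_nbhs R)).
Proof.
apply: Build_ProperFilter_ex => A [M [_ MA]].
have [z Sz Mz] := S_unbounded M; exists z; exact: MA.
Qed.

(** The bound by [Xi] on truncated moments passes to the weak limit. The truncated absolute value is
    a combination of two ramps ([ramp_norm]), for which convergence is known. *)
Lemma xi_integrable : P1.-integrable setT (EFin \o xi).
Proof.
apply: (@integrable_of_ramp _ _ _ _ _ (mean P2 Xi (fun y => `|y|))) => n.
have [->|n0] := eqVneq n 0%N.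
  by rewrite mean_ramp0; apply: (mean_ge_cst (mean_lipschitz iXi)); [lipschitz|].
have n_gt0 : 0 < n%:R :> R by rewrite ltr0n lt0n.
have abs_mean d (T : measurableType d) (Q : probability T R) (X : {RV Q >-> R}) :
    mean Q (norm_rv X) (ramp 0 n%:R) =
    n%:R + mean Q X (ramp 0 n%:R) - mean Q X (ramp (- n%:R) n%:R).
  have i1 := integrable_ramp X 0 (ltW n_gt0).
  have i2 := integrable_ramp X (- n%:R) (ltW n_gt0).
  have i0 : Q.-integrable setT (EFin \o (fun=> n%:R : R)).
    exact: finite_measure_integrable_cst.
  rewrite /mean -[X in X + _ - _]mulr1.
  transitivity (\int[Q]_w (n%:R + ramp 0 n%:R (X w) - ramp (- n%:R) n%:R (X w))).
    by apply: eq_Rintegral => w _; rewrite ramp_norm.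
  rewrite RintegralB//; last first.
    by have := integrableD measurableT i0 i1.
  rewrite RintegralD// Rintegral_cst//; congr (_ * _ + _ - _).
  by transitivity (fine 1%E : R) => //; congr fine; exact: probability_setT.
rewrite abs_mean.
have : (n%:R + mean (step_law K z) (jump K z) (ramp 0 n%:R) -
    mean (step_law K z) (jump K z) (ramp (- n%:R) n%:R))
    @[z --> within S (pinfty_nbhs R)] -->
    n%:R + mean P1 xi (ramp 0 n%:R) - mean P1 xi (ramp (- n%:R) n%:R).
  apply: cvgB; last exact: (ramp_cvg cvg_xi).
  by apply: cvgD; [exact: cvg_cst|exact: (ramp_cvg cvg_xi)].
move=> c; apply: (cvgr_to_le (FF := S_filter) c).
have : \forall z \near within S (pinfty_nbhs R), S z by exact: withinT.
apply: filterS => z Sz; rewrite -abs_mean; exact: jump_ramp_le.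
Qed.

(** The stochastic order is known on ramps, so the jump is cut at a level A depending on z, at cost
    e. *)
Lemma jump_tail_le z a : S z -> 0 <= a ->
  mean (step_law K z) (jump K z) (fun j => Num.max (j - a) 0) <=
  mean P2 Xi (fun y => Num.max (y - a) 0).
Proof.
move=> Sz a0; apply/ler_addgt0Pr => e e0.
have hz := mean_lipschitz (jump_integrable Sz).
have hX := mean_lipschitz iXi.
have [A A0 Ae] := mean_tail hz e0.
have lr := lipschitz_ramp a A.
pose tl (y : R) := Num.max (`|y| - A) 0.
have ltl : lipschitz_fun tl by rewrite /tl; lipschitz.
apply: (@le_trans _ _ (mean (step_law K z) (jump K z) (fun j => ramp a A j + tl j))).
  apply: (mean_mono hz); [by lipschitz..|move=> j].
  by apply: le_ramp_tail => //; exact: ltW.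
rewrite (meanD hz)// lerD//.
apply: (@le_trans _ _ (mean (step_law K z) (norm_rv (jump K z)) (ramp a A))).
  rewrite mean_norm; apply: (mean_mono hz) => //.
    by apply: (lipschitz_fun_comp lr); lipschitz.
  by move=> j; apply: ramp_homo; exact: ler_norm.
apply: (@le_trans _ _ (mean P2 Xi (ramp a A))).
  by apply: mean_ramp_mono => [t|]; [exact: rtail_jump_le|exact: ltW].
apply: (mean_mono hX) => //; first by lipschitz.
by move=> y; rewrite /ramp ge_min lexx.
Qed.

(** Weak convergence controls the jump between -A and B, and the tail of [Xi] controls it above B
    uniformly in z. Cutting below at -A makes the statement usable for a chain that may jump over an
    interval. *)
Lemma negative_drift : mean P1 xi id < 0 ->
  exists A g x0, [/\ 0 < A, 0 < g & forall z, S z -> x0 <= z ->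
    mean (step_law K z) (jump K z) (fun j => Num.max j (- A)) <= - g].
Proof.
set m := mean P1 xi id => m0.
have h1 := mean_lipschitz xi_integrable.
have h2 := mean_lipschitz iXi.
(* Here m = - 8 * e, and three errors of size e (lower tail of xi, weak convergence, upper tail of
   [Xi]) leave a drift of at most - 5 * e. *)
pose e := - m / 8.
have e0 : 0 < e by rewrite divr_gt0// oppr_gt0.
have [A A0 Ae] := mean_tail h1 e0.
have [B B0 Be] := mean_tail h2 e0.
have AB0 : 0 < A + B by exact: addr_gt0.
have lr := lipschitz_ramp (- A) (A + B).
have : \forall z \near within S (pinfty_nbhs R),
    mean (step_law K z) (jump K z) (ramp (- A) (A + B)) <=
    mean P1 xi (ramp (- A) (A + B)) + e.
  by apply: (cvgr_le _ (ramp_cvg cvg_xi (a := - A) AB0)); rewrite ltrDl.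
move=> [x0 [_ x0P]]; exists A, (5 * e), (x0 + 1); split => //; first exact: mulr_gt0.
move=> z Sz zx0.
have hz := mean_lipschitz (jump_integrable Sz).
have near_z := x0P z (lt_le_trans (ltr_pwDr ltr01 (lexx _)) zx0) Sz.
have le1 : mean P1 xi (ramp (- A) (A + B)) <= A + (m + e).
  apply: (@le_trans _ _ (mean P1 xi
      (fun y => A + (y + Num.max (`|y| - A) 0)))).
    apply: (mean_mono h1); [by lipschitz..|move=> y].
    by apply: ramp_le_tail; exact: ltW.
  rewrite !((meanD h1), (mean_cst h1)); [|by lipschitz..].
  by rewrite lerD2l lerD2l.
have le2 : mean P2 Xi (fun y => Num.max (y - B) 0) <= e.
  apply: le_trans Be; apply: (mean_mono h2); [by lipschitz..|move=> y].
  by rewrite ge_max !le_max lexx orbT lerD2r ler_norm.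
have le3 := le_trans (jump_tail_le Sz (ltW B0)) le2.
have -> : (fun j => Num.max j (- A)) =
    (fun j => - A + (ramp (- A) (A + B) j + Num.max (j - B) 0)).
  by apply/funext => j; rewrite (ramp_tailE _ _ (ltW AB0)) addKr.
rewrite !((meanD hz), (mean_cst hz)); [|by lipschitz..].
rewrite /e in le1 le3 near_z *; lra.
Qed.

End moments.

(** * The Markov property for functions *)

Section mixture.
Local Open Scope ereal_scope.
Context (R : realType) (d d' : measure_display) (Y : measurableType d)
  (Z : measurableType d') (l : {measure set Y -> \bar R})
  (k : Y -> {measure set Z -> \bar R}) (m : {measure set Z -> \bar R}).
Variables (D : set Y) (mD : measurable D).
Hypothesis mk : forall U, measurable U -> measurable_fun setT (k ^~ U).
Hypothesis mE : forall U, measurable U -> m U = \int[l]_(y in D) k y U.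

Import HBNNSimple.

Let integral_mixture_nnsfun (f : {nnsfun Z >-> R}) :
  \int[m]_z (f z)%:E = \int[l]_(y in D) \int[k y]_z (f z)%:E.
Proof.
rewrite integralT_nnsfun sintegralE.
under [RHS]eq_integral do rewrite integralT_nnsfun sintegralE.
have pre_neg r : (r < 0)%R -> f @^-1` [set r] = set0 by exact: preimage_nnfun0.
rewrite ge0_integral_fsum//; last 2 first.
- move=> r; apply: measurable_funTS; apply: measurable_funeM; exact: mk.
- move=> r y _; have [r0|/pre_neg ->] := leP 0%R r; last by rewrite measure0 mule0.
  by rewrite mule_ge0// lee_fin.
apply: eq_fsbigr => r _.
have [r0|/pre_neg ->] := leP 0%R r; last first.
  by rewrite measure0 mule0 integral0_eq// => y _; rewrite measure0 mule0.
rewrite ge0_integralZl//; last by apply: measurable_funTS; exact: mk.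
by rewrite mE.
Qed.

(** From sets to functions through simple functions and monotone convergence. *)
Lemma integral_mixture (f : Z -> \bar R) : (forall z, 0 <= f z) ->
  measurable_fun setT f ->
  \int[m]_z f z = \int[l]_(y in D) \int[k y]_z f z.
Proof.
move=> f0 mf; pose f_ := nnsfun_approx measurableT mf.
have mf_ n : measurable_fun setT (fun z => (f_ n z)%:E) by exact/measurable_EFinP.
have f_0 n z : setT z -> 0 <= (f_ n z)%:E by rewrite lee_fin.
have ndf_ z : setT z -> nondecreasing_seq (fun n => (f_ n z)%:E).
  by move=> _ a b ab; rewrite lee_fin; exact/lefP/nd_nnsfun_approx.
have f_lim (mu : {measure set Z -> \bar R}) :
    \int[mu]_z f z = limn (fun n => \int[mu]_z (f_ n z)%:E).
  rewrite -monotone_convergence//; apply: eq_integral => z _.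
  by apply/esym/cvg_lim => //; exact: cvg_nnsfun_approx.
rewrite f_lim; under [RHS]eq_integral do rewrite f_lim.
rewrite monotone_convergence//.
- by congr (limn _); apply/funext => n; exact: integral_mixture_nnsfun.
- move=> n; apply: measurable_funTS.
  by apply: measurable_fun_integral_kernel => // z; rewrite lee_fin.
- by move=> n y _; apply: integral_ge0 => z _; rewrite lee_fin.
- by move=> y _ a b ab; apply: ge0_le_integral => //; [move=> z _; exact: f_0|move=> z _; exact: ndf_].
Qed.

End mixture.

Section chain.
Local Open Scope ereal_scope.
Context (R : realType) (d : measure_display) (Omega : measurableType d)
  (P : probability Omega R) (S : set R) (K : R.-pker R ~> R)
  (X : nat -> {RV P >-> R}).
Hypothesis chainX : markov_chain S K X.

Lemma filtration_measurable n A : natural_filtration X n A -> measurable A.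
Proof.
apply: smallest_sub; first exact: sigma_algebra_measurable.
move=> B [i _ [C mC <-]]; rewrite setTI; exact: measurable_funPTI.
Qed.

Lemma filtration_preimage n i B : (i <= n)%N -> measurable B ->
  natural_filtration X n (X i @^-1` B).
Proof.
move=> i_n mB; apply: sub_gen_smallest; exists i; first by rewrite /= ltnS.
by exists B => //; rewrite setTI.
Qed.

Let filtration_sigma n : sigma_algebra setT (natural_filtration X n).
Proof. exact: smallest_sigma_algebra. Qed.

Lemma filtrationC n A : natural_filtration X n A -> natural_filtration X n (~` A).
Proof. by move=> FA; rewrite -setTD; have [_ FD _] := filtration_sigma n; exact: FD. Qed.

Lemma filtrationI n A B : natural_filtration X n A -> natural_filtration X n B ->
  natural_filtration X n (A `&` B).
Proof.
move=> FA FB; rewrite -[A]setCK -[B]setCK -setCU; apply: filtrationC.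
rewrite -bigcup2E; have [F0 _ FU] := filtration_sigma n; apply: FU.
by case=> [|[|i]] /=; [exact: filtrationC|exact: filtrationC|].
Qed.

Lemma filtrationU n A B : natural_filtration X n A -> natural_filtration X n B ->
  natural_filtration X n (A `|` B).
Proof.
move=> FA FB; rewrite -bigcup2E; have [F0 _ FU] := filtration_sigma n; apply: FU.
by case=> [|[|i]].
Qed.

Lemma filtration_le m n A : (m <= n)%N ->
  natural_filtration X m A -> natural_filtration X n A.
Proof.
move=> mn; apply: sub_sigma_algebra2 => B [i im FB]; exists i => //.
by rewrite /= (leq_trans im).
Qed.

Lemma markov_integral n A (f : R -> \bar R) : natural_filtration X n A ->
  (forall y, 0 <= f y) -> measurable_fun setT f ->
  \int[P]_(w in A) f (X n.+1 w) = \int[P]_(w in A) \int[K (X n w)]_y f y.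
Proof.
move=> FA f0 mf; have mA := filtration_measurable FA.
(* The law of [X n.+1] on A is a mixture over A in two ways: of Dirac masses at [X n.+1 w], and, by
   the Markov property, of the kernels [K (X n w)]. *)
pose m := pushforward (mrestr P mA) (X n.+1).
have mE U : measurable U -> m U = P (A `&` X n.+1 @^-1` U).
  by rewrite /m /= /pushforward /mrestr setIC.
transitivity (\int[m]_y f y); last first.
  apply: integral_mixture => // U mU.
    exact: (measurableT_comp (measurable_kernel K U mU)).
  by apply: etrans (mE U mU) _; case: chainX => _ _; apply.
rewrite (@integral_mixture _ _ _ _ _ P (fun w => \d_(X n.+1 w)) m A)//.
- by apply: eq_integral => w _; rewrite integral_dirac// diracT mul1e.
- move=> U mU; rewrite /dirac; apply/measurable_EFinP.
  exact: (measurableT_comp (measurable_indic mU)).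
- move=> U mU; apply: etrans (mE U mU) _.
  have mXU : measurable (X n.+1 @^-1` U) by exact: measurable_funPTI.
  by have := integral_indic P mA mXU; rewrite setIC => <-; exact: eq_integral.
Qed.

End chain.

(** * Excursions and Lyapunov functions *)

(* [V] bounds the probability of jumping over [I] into [L], and the drift of [h]
   forces every excursion above [I] to end. *)
Section excursion.
Local Open Scope ereal_scope.
Context (R : realType) (d : measure_display) (Omega : measurableType d)
  (P : probability Omega R) (S : set R) (K : R.-pker R ~> R)
  (X : nat -> {RV P >-> R}).
Hypothesis chainX : markov_chain S K X.

Lemma lyapunov_step n A (U : set R) (g : R -> \bar R) (r : R) :
  natural_filtration X n A -> A `<=` X n @^-1` U ->
  (forall y, 0 <= g y) -> measurable_fun setT g -> (0 <= r)%R ->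
  (forall z, S z -> U z -> \int[K z]_y g y + r%:E <= g z) ->
  \int[P]_(w in A) g (X n.+1 w) + r%:E * P A <= \int[P]_(w in A) g (X n w).
Proof.
move=> FA AU g0 mg r0 gU; have mA := filtration_measurable FA.
have mKg : measurable_fun setT (fun w => \int[K (X n w)]_y g y).
  apply: (@measurableT_comp _ _ _ _ _ _ (fun z => \int[K z]_y g y)) => //.
  by apply: measurable_fun_integral_kernel => // V mV; exact: measurable_kernel.
rewrite (markov_integral chainX FA)// -integral_cst// -ge0_integralD//; last 2 first.
- by move=> w _; exact: integral_ge0.
- exact: measurable_funTS.
apply: ge0_le_integral => //.
- by move=> w _; rewrite adde_ge0 ?lee_fin//; exact: integral_ge0.
- by apply: emeasurable_funD => //; exact: measurable_funTS.
- by apply: measurable_funTS; exact: measurableT_comp.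
- by move=> w Aw; apply: gU; [case: chainX|exact: AU].
Qed.

Variables (U I L : set R).
Hypotheses (mU : measurable U) (mI : measurable I) (mL : measurable L).
Hypothesis cover : forall y, [\/ U y, I y | L y].
Hypothesis LU : forall y, L y -> ~ U y.
Variables (V h : R -> \bar R) (g : R).
Hypothesis V0 : forall y, 0 <= V y.
Hypothesis mV : measurable_fun setT V.
Hypothesis VL : forall y, L y -> 1 <= V y.
Hypothesis VU : forall y, U y -> V y <= (2^-1)%:E.
Hypothesis V_super : forall z, S z -> U z -> \int[K z]_y V y <= V z.
Hypothesis h0 : forall y, 0 <= h y.
Hypothesis mh : measurable_fun setT h.
Hypothesis g0 : (0 < g)%R.
Hypothesis h_super : forall z, S z -> U z -> \int[K z]_y h y + g%:E <= h z.

Section from_time.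
Variables (n : nat) (A : set Omega).
Hypotheses (FA : natural_filtration X n A) (AU : A `<=` X n @^-1` U).

Let Fixpoint stay (j : nat) : set Omega :=
  if j is j'.+1 then stay j' `&` X (n + j) @^-1` U else A.

Let stay_filtration j : natural_filtration X (n + j) (stay j).
Proof.
elim: j => [|j IH]; first by rewrite addn0.
apply: filtrationI; last exact: filtration_preimage.
by apply: filtration_le IH; rewrite leq_add2l.
Qed.

Let stay_U j : stay j `<=` X (n + j) @^-1` U.
Proof. by case: j => [|j w []//]; rewrite addn0. Qed.

Let m_stay j : measurable (stay j).
Proof. exact: filtration_measurable (@stay_filtration j). Qed.

Let fall j := stay j `&` X (n + j.+1) @^-1` L.

Let m_fall j : measurable (fall j).
Proof. by apply: measurableI => //; exact: measurable_funPTI. Qed.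

Let step j (f : R -> \bar R) (r : R) : (forall y, 0 <= f y) ->
  measurable_fun setT f -> (0 <= r)%R ->
  (forall z, S z -> U z -> \int[K z]_y f y + r%:E <= f z) ->
  \int[P]_(w in fall j) f (X (n + j.+1) w) +
  \int[P]_(w in stay j.+1) f (X (n + j.+1) w) + r%:E * P (stay j) <=
  \int[P]_(w in stay j) f (X (n + j) w).
Proof.
move=> f0 mf r0 fU.
apply: le_trans (lyapunov_step (@stay_filtration j) (@stay_U j) f0 mf r0 fU).
rewrite leeD2r// -ge0_integral_setU//; last 2 first.
- by apply: measurable_funTS; exact: measurableT_comp.
- apply/disj_setPS => w [[_ Lw] [_ Uw]]; exact: LU Lw Uw.
rewrite addnS; apply: ge0_subset_integral => //.
- by apply: measurableU => //; have := m_stay j.+1; rewrite /= addnS.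
- by apply: measurable_funTS; exact: measurableT_comp.
- by move=> w [[]|[]].
Qed.

(** Supermartingale bound stopped at the exit from [U]: each fall into [L] uses up at least 1 of
    [V]. *)
Let sum_fall J : \sum_(j < J) P (fall j) + \int[P]_(w in stay J) V (X (n + J) w) <=
  \int[P]_(w in A) V (X n w).
Proof.
elim: J => [|J IH]; first by rewrite big_ord0 add0e addn0.
apply: le_trans IH; rewrite big_ord_recr/= -addeA leeD2l//.
have := @step J V 0 V0 mV (lexx _); rewrite mul0e adde0 => H.
apply: le_trans (H _); last by move=> z Sz Uz; rewrite adde0 V_super.
rewrite leeD2r// -[leLHS]mul1e -integral_cst//.
apply: ge0_le_integral => //.
- by apply: measurable_funTS; exact: measurableT_comp.
- by move=> w [_ Lw]; exact: VL.
Qed.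

(** Every step spent in [U] uses up g of [h], so the expected stay is finite. *)
Let sum_stay J : g%:E * \sum_(j < J) P (stay j) <= \int[P]_(w in A) h (X n w).
Proof.
suff : g%:E * \sum_(j < J) P (stay j) + \int[P]_(w in stay J) h (X (n + J) w) <=
    \int[P]_(w in A) h (X n w).
  by apply: le_trans; rewrite leeDl//; exact: integral_ge0.
elim: J => [|J IH]; first by rewrite big_ord0 mule0 add0e addn0.
apply: le_trans IH; rewrite big_ord_recr/= ge0_muleDr//; last exact: sume_ge0.
rewrite -addeA leeD2l//.
apply: le_trans (@step J h g h0 mh (ltW g0) h_super).
by rewrite addeC leeD2r// leeDr//; exact: integral_ge0.
Qed.

Variable D : set Omega.
Hypothesis mD : measurable D.
Hypothesis DI : forall m w, (n <= m)%N -> I (X m w) -> D w.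

Let avoid_sub J : A `\` D `<=` stay J `|` \big[setU/set0]_(j < J) fall j.
Proof.
elim: J => [|J IH] w; first by move=> [Aw _]; left.
move=> ADw; rewrite big_ord_recr/=.
have [stw|?] := IH w ADw; last by right; left.
have [Uw|Iw|Lw] := cover (X (n + J.+1) w).
- by left.
- by case: ADw => _ []; apply: DI Iw; exact: leq_addr.
- by right; right.
Qed.

Let P_stay_fin J : P (stay J) \is a fin_num.
Proof. by rewrite fin_num_measure. Qed.

Let stay_le J : g%:E * (J%:R%:E * P (stay J)) <= \int[P]_(w in A) h (X n w).
Proof.
apply: le_trans (sum_stay J); apply: lee_wpmul2l; first by rewrite lee_fin ltW.
have -> : J%:R%:E * P (stay J) = \sum_(j < J) P (stay J).
  by rewrite -(fineK (P_stay_fin J)) sumEFin sumr_const card_ord -EFinM mulr_natl.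
apply: lee_sum => j _; apply: le_measure; rewrite ?inE//.
have sub k m : stay (k + m) `<=` stay k.
  by elim: m => [|m IH]; [rewrite addn0|rewrite addnS => w [/IH]].
by have := sub j (J - j)%N; rewrite subnKC// ltnW.
Qed.

(** A path missing [I] either is still in [U] after J steps, an event whose probability is O(1 / J),
    or left [U] straight into [L], which costs at most the integral of [V]. *)
Lemma avoid_bound : \int[P]_(w in A) h (X n w) < +oo ->
  P (A `\` D) <= (2^-1)%:E * P A.
Proof.
move=> hfin; have mA := filtration_measurable FA.
have mAD : measurable (A `\` D) by exact: measurableD.
have V_half : \int[P]_(w in A) V (X n w) <= (2^-1)%:E * P A.
  rewrite -integral_cst//; apply: ge0_le_integral => //.
  - by apply: measurable_funTS; exact: measurableT_comp.
  - by move=> w Aw; apply: VU; exact: AU.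
have bound J : P (A `\` D) <= P (stay J) + (2^-1)%:E * P A.
  apply: (@le_trans _ _ (P (stay J `|` \big[setU/set0]_(j < J) fall j))).
    have mU' : measurable (stay J `|` \big[setU/set0]_(j < J) fall j).
      by apply: measurableU => //; exact: bigsetU_measurable.
    by apply: le_measure; rewrite ?inE//; exact: avoid_sub.
  apply: le_trans (measureU2 _ _ _) _ => //; first exact: bigsetU_measurable.
  rewrite leeD2l//; apply: le_trans V_half; apply: le_trans (sum_fall J).
  apply: (@le_trans _ _ (\sum_(j < J) P (fall j))).
    apply: content_subadditive => //; exact: bigsetU_measurable.
  by rewrite leeDl//; exact: integral_ge0.
have finP B : measurable B -> P B = (fine (P B))%:E.
  by move=> mB; rewrite fineK// fin_num_measure.
have hE : \int[P]_(w in A) h (X n w) = (fine (\int[P]_(w in A) h (X n w)))%:E.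
  by rewrite fineK// ge0_fin_numE//; exact: integral_ge0.
rewrite (finP (A `\` D))// (finP A)// -EFinM lee_fin -subr_le0.
apply: (@ler_bounded_multiples _ _ (fine (\int[P]_(w in A) h (X n w)) / g)%R) => J.
rewrite ler_pdivlMr//.
have := stay_le J.+1; have := bound J.+1.
rewrite hE (finP (A `\` D))// (finP A)// (finP (stay J.+1))// -!EFinM -EFinD !lee_fin.
set a := fine _; set b := fine _; set q := fine _; set c := fine _ => h1 h2.
have h3 : (a - 2^-1 * q <= b)%R by lra.
have h4 := ler_wpM2l (ltW g0) (ler_wpM2l (ler0n R J.+1) h3).
by apply: le_trans h2; apply: le_trans h4; rewrite [leRHS]mulrC.
Qed.

End from_time.

Hypothesis h_bounded : forall M : R, exists C : R, forall y, (y <= M)%R -> h y <= C%:E.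

(** Integrability of [h] is gained by cutting A to [X n <= k], and lost again by monotone
    convergence in k. *)
Lemma avoid_half n A D : natural_filtration X n A -> A `<=` X n @^-1` U ->
  measurable D -> (forall m w, (n <= m)%N -> I (X m w) -> D w) ->
  P (A `\` D) <= (2^-1)%:E * P A.
Proof.
move=> FA AU mD DI; have mA := filtration_measurable FA.
pose AM k := A `&` X n @^-1` `]-oo, k%:R%R].
have mAM k : measurable (AM k) by apply: measurableI => //; exact: measurable_funPTI.
have AMP k : P (AM k `\` D) <= (2^-1)%:E * P A.
  apply: (@le_trans _ _ ((2^-1)%:E * P (AM k))).
    apply: (avoid_bound (n := n)) => //.
    - by apply: filtrationI => //; exact: filtration_preimage.
    - by move=> w [/AU].
    - have [C hC] := h_bounded k%:R.
      apply: (@le_lt_trans _ _ (\int[P]_(w in AM k) (Num.max C 0)%:E)).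
        apply: ge0_le_integral => //.
        + by apply: measurable_funTS; exact: measurableT_comp.
        + move=> w [_ /=]; rewrite in_itv/= => /hC /le_trans; apply.
          by rewrite lee_fin le_max lexx.
      rewrite integral_cst//= ltey_eq fin_numM//.
      by rewrite fin_num_measure.
  apply: lee_wpmul2l; first by rewrite lee_fin invr_ge0.
  by apply: le_measure; rewrite ?inE// => w [].
have cvgP : P (AM k `\` D) @[k --> \oo] --> P (\bigcup_k (AM k `\` D)).
  apply: nondecreasing_cvg_mu.
  - by move=> k; exact: measurableD.
  - by apply: bigcupT_measurable => k; exact: measurableD.
  - move=> a b ab; apply/subsetPset => w [[Aw /=]].
    rewrite !in_itv/= => Xa nD; split=> //; split=> //=.
    by rewrite in_itv/= (le_trans Xa)// ler_nat.
have <- : \bigcup_k (AM k `\` D) = A `\` D.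
  apply/seteqP; split=> [w [k _ [[]]]//|w [Aw nD]].
  exists (Num.bound `|X n w|) => //; split=> //; split=> //=; rewrite in_itv/=.
  exact: le_trans (ler_norm _) (ltW (archi_boundP (normr_ge0 _))).
by apply: (cvge_to_le cvgP); near=> k; exact: AMP.
Unshelve. all: end_near. Qed.

(** If the series were finite, its tails would vanish; but after any time N the chain enters [U]
    almost surely and then visits [I] with probability at least 1/2, so each tail is at least
    1/2. *)
Lemma renewal_measure_infinite :
  {ae P, forall w, forall N, exists2 n, (N <= n)%N & U (X n w)} ->
  renewal_measure X I = +oo.
Proof.
move=> io; apply/eqP; rewrite eq_le leey/= leNgt; apply/negP => HI.
have tail := nneseries_tail_cvg HI (fun n _ => measure_ge0 P (X n @^-1` I)).
suff half N : (2^-1)%:E <= \sum_(N <= n <oo) P (X n @^-1` I).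
  have := cvge_to_ge tail (nearW _ half).
  move=> /(_ eventually_filter eventually_filter).
  by rewrite lee_fin leNgt invr_gt0 ltr0n.
pose D := \bigcup_(n in ~` `I_N) (X n @^-1` I).
have mXI n : measurable (X n @^-1` I) by exact: measurable_funPTI.
have mXU n : measurable (X n @^-1` U) by exact: measurable_funPTI.
have mD : measurable D by apply: bigcup_measurable.
apply: (@le_trans _ _ (P D)); last exact: measure_sigma_subadditive_tail.
(* [E k]: the first entry into [U] from time N on happens at time N + k. These events are disjoint,
   known at time N + k, and cover almost every path. *)
pose E := seqDU (fun k => X (N + k) @^-1` U).
have FE k : natural_filtration X (N + k) (E k).
  rewrite /E /seqDU setDE; apply: filtrationI; first exact: filtration_preimage.
  apply: filtrationC; suff H m : (m <= k)%N ->
    natural_filtration X (N + k) (\big[setU/set0]_(i < m) (X (N + i) @^-1` U)).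
    exact: H.
  elim: m => [_|m IH mk]; first by rewrite big_ord0; exact: sigma_algebra0.
  rewrite big_ord_recr/=; apply: filtrationU; first exact: IH (ltnW mk).
  by apply: filtration_preimage => //; rewrite leq_add2l ltnW.
have mE k : measurable (E k) by exact: filtration_measurable (FE k).
have EP k : P (E k `\` D) <= (2^-1)%:E * P (E k).
  apply: (avoid_half (n := N + k)) => //; first by move=> w [].
  move=> m w Nm Im; exists m => //=; apply/negP; rewrite -leqNgt.
  exact: leq_trans (leq_addr _ _) Nm.
have mUE : measurable (\bigcup_k E k) by exact: bigcupT_measurable.
have mED : measurable (\bigcup_k (E k `\` D)).
  by apply: bigcupT_measurable => k; exact: measurableD.
have series_bigcup (F : nat -> set Omega) : (forall k, measurable (F k)) ->
    trivIset setT F -> P (\bigcup_k F k) = \sum_(0 <= k <oo) P (F k).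
  move=> mF tF; rewrite measure_bigcup//.
  by apply: eq_eseriesl => k; rewrite in_setT.
have PE0 : P (~` \bigcup_k E k) = 0.
  apply: measure_negligible; first exact: measurableC.
  apply: negligibleS io => w nE /= /(_ N)[n Nn Un]; apply: nE.
  by rewrite -seqDU_bigcup_eq; exists (n - N)%N => //=; rewrite subnKC.
have PED : P (\bigcup_k (E k `\` D)) <= (2^-1)%:E.
  rewrite series_bigcup//; last 2 first.
  - by move=> k; exact: measurableD.
  - by apply: trivIset_setIr; exact: trivIset_seqDU.
  apply: (@le_trans _ _ (\sum_(0 <= k <oo) (2^-1)%:E * P (E k))).
    exact: lee_nneseries.
  rewrite nneseriesZl// -series_bigcup//; last exact: trivIset_seqDU.
  rewrite -[leRHS]mule1; apply: lee_wpmul2l; first by rewrite lee_fin invr_ge0.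
  exact: probability_le1.
have : P (~` D) <= (2^-1)%:E.
  apply: (@le_trans _ _ (P (\bigcup_k (E k `\` D) `|` ~` \bigcup_k E k))).
    apply: le_measure; rewrite ?inE; [exact: measurableC| |].
      by apply: measurableU => //; exact: measurableC.
    move=> w nD; have [[k _ Ek]|nE] := pselect ((\bigcup_k E k) w); last by right.
    by left; exists k.
  apply: le_trans (measureU2 _ _ _) _ => //; first exact: measurableC.
  by rewrite [X in _ + X]PE0 adde0.
have -> : P (~` D) = 1 - P D by exact: probability_setC.
have : P D = (fine (P D))%:E by rewrite fineK// fin_num_measure.
move=> ->; rewrite -EFinB !lee_fin; lra.
Unshelve. all: end_near. Qed.

End excursion.

(** * Negative drift *)

Section concave_barrier.
Context (R : realType) (d : measure_display) (T : measurableType d)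
  (P : probability T R) (Xi : {RV P >-> R}).
Hypothesis iXi : P.-integrable setT (EFin \o Xi).
Variables (Y : R).
Hypothesis Y0 : 0 <= Y.

Let hX := mean_lipschitz iXi.

(* The function [s |-> E (min (Xi, s); Xi > Y)] of [s >= 0]: a concave function
   with slope [P (Xi > s)] for [s >= Y]. *)
Definition barrier (s : R) : R :=
  rtail Xi Y * Num.min s Y + mean P Xi (ramp Y (Num.max (s - Y) 0)).

Lemma barrier_ge0 s : 0 <= s -> 0 <= barrier s.
Proof.
move=> s0; apply: addr_ge0; first by rewrite mulr_ge0 ?rtail_ge0// le_min s0.
apply: (mean_ge_cst hX); first exact: lipschitz_ramp.
by move=> y; rewrite ramp_ge0// le_max lexx orbT.
Qed.

Lemma rtail_ni s t : s <= t -> rtail Xi t <= rtail Xi s.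
Proof.
move=> st; rewrite -lee_fin !rtailE; apply: le_measure; rewrite ?inE.
- exact: measurable_tail.
- exact: measurable_tail.
- by move=> w /=; exact: le_lt_trans.
Qed.

Let mean_rampD a A B : 0 <= A -> 0 <= B ->
  mean P Xi (ramp a (A + B)) = mean P Xi (ramp a A) + mean P Xi (ramp (a + A) B).
Proof.
move=> A0 B0; rewrite -(meanD hX); [|exact: lipschitz_ramp..].
by congr mean; apply/funext => y; exact: rampD.
Qed.

(** Concavity in the form required: the graph lies below its tangent at z, of slope P(Xi > z). *)
Lemma barrier_tangent s z : 0 <= s -> Y <= z ->
  barrier s <= barrier z + rtail Xi z * (s - z).
Proof.
move=> s0 Yz; rewrite /barrier (min_r Yz) (max_l (x := z - Y)) ?subr_ge0//.
have tz0 := rtail_ge0 Xi z.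
have [sY|Ys] := leP s Y.
  rewrite max_r ?subr_le0// mean_ramp0 addr0.
  have h : (z - Y) * rtail Xi z <= mean P Xi (ramp Y (z - Y)).
    by apply: mean_ramp1_ge; rewrite ?subr_ge0// addrC subrK.
  have : 0 <= (Y - s) * (rtail Xi Y - rtail Xi z).
    by rewrite mulr_ge0 ?subr_ge0// rtail_ni.
  lra.
rewrite max_l ?subr_ge0 ?(ltW Ys)//.
have [zs|sz] := leP z s.
  have -> : s - Y = (z - Y) + (s - z) by ring.
  rewrite mean_rampD ?subr_ge0//.
  have : mean P Xi (ramp (Y + (z - Y)) (s - z)) <= (s - z) * rtail Xi z.
    by apply: mean_ramp1_le; rewrite ?subr_ge0//; lra.
  lra.
have -> : z - Y = (s - Y) + (z - s) by ring.
rewrite mean_rampD ?subr_ge0 ?(ltW Ys) ?(ltW sz)//.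
have : (z - s) * rtail Xi z <= mean P Xi (ramp (Y + (s - Y)) (z - s)).
  by apply: mean_ramp1_ge; rewrite ?subr_ge0 ?(ltW sz)//; lra.
lra.
Qed.

(** Makes the barrier uniformly small for large Y. Of the factor 3, two parts come from Y * P(Xi >
    Y) and one from the ramp. *)
Lemma barrier_le s : barrier s <=
  3 * mean P Xi (fun y => Num.max (`|y| - Y / 2) 0).
Proof.
have lm : lipschitz_fun (fun y : R => Num.max (`|y| - Y / 2) 0) by lipschitz.
have le1 : rtail Xi Y * Y <= 2 * mean P Xi (fun y => Num.max (`|y| - Y / 2) 0).
  have Y2 : 0 <= Y / 2 by rewrite divr_ge0.
  have : Y / 2 * rtail Xi Y <= mean P Xi (ramp (Y / 2) (Y / 2)).
    by apply: mean_ramp1_ge => //; lra.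
  have : mean P Xi (ramp (Y / 2) (Y / 2)) <=
      mean P Xi (fun y => Num.max (`|y| - Y / 2) 0).
    apply: (mean_mono hX) => //; first exact: lipschitz_ramp.
    move=> y; rewrite /ramp ge_min; apply/orP; left.
    by rewrite ge_max !le_max lexx orbT andbT lerD2r ler_norm.
  lra.
have le2 : rtail Xi Y * Num.min s Y <= rtail Xi Y * Y.
  by rewrite ler_wpM2l ?rtail_ge0// ge_min lexx orbT.
have le3 : mean P Xi (ramp Y (Num.max (s - Y) 0)) <=
    mean P Xi (fun y => Num.max (`|y| - Y / 2) 0).
  apply: (mean_mono hX) => //; first exact: lipschitz_ramp.
  move=> y; rewrite /ramp ge_min; apply/orP; left.
  rewrite ge_max !le_max lexx orbT andbT; apply/orP; left.
  have := ler_norm y; move: Y0; lra.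
rewrite /barrier; lra.
Qed.

Lemma lipschitz_barrier : lipschitz_fun barrier.
Proof.
apply: lipschitz_funD; first by lipschitz.
have lr : lipschitz_fun (fun t => mean P Xi (ramp Y t)).
  exists 1 => s t; rewrite mul1r -(meanB hX); [|exact: lipschitz_ramp..].
  have lb : lipschitz_fun (fun y => ramp Y s y - ramp Y t y).
    by apply: lipschitz_funB; exact: lipschitz_ramp.
  have st y : `|ramp Y s y - ramp Y t y| <= `|s - t|.
    rewrite /ramp; move: (Num.max _ _) => q.
    have h1 := ler_norm (s - t); have h2 := ler_norm (t - s); rewrite distrC in h2.
    have [qs|qs] := leP q s; have [qt|qt] := leP q t;
      rewrite ler_norml; apply/andP; split; lra.
  rewrite ler_norml; apply/andP; split.
    apply: (mean_ge_cst hX) => // y; by have := st y; rewrite ler_norml => /andP[].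
  apply: (mean_le_cst hX) => // y; by have := st y; rewrite ler_norml => /andP[].
by apply: (lipschitz_fun_comp lr); lipschitz.
Qed.

End concave_barrier.

Lemma limn_esup_pinfty (R : realType) (u : R^nat) :
  limn_esup (fun n => (u n)%:E) = +oo%E ->
  forall M N, exists2 n, (N <= n)%N & M < u n.
Proof.
move=> uoo M N; apply: contrapT => H.
have : (limn_esup (fun n => (u n)%:E) <= M%:E)%E.
  apply: ge_ereal_inf; exists (ereal_sup ((fun n => (u n)%:E) @` [set n | (N <= n)%N])).
    by exists [set n | (N <= n)%N] => //; exact: nbhs_infty_ge.
  apply: ge_ereal_sup => _ [n Nn <-]; rewrite lee_fin leNgt; apply/negP => Mn.
  by apply: H; exists n.
by rewrite uoo leye_eq.
Qed.

Section negative_drift.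
Context (R : realType) (d : measure_display) (Omega : measurableType d)
  (P : probability Omega R) (S : set R) (K : R.-pker R ~> R)
  (X : nat -> {RV P >-> R})
  (d2 : measure_display) (T2 : measurableType d2) (P2 : probability T2 R)
  (Xi : {RV P2 >-> R}).
Hypothesis chainX : markov_chain S K X.
Hypothesis limsupX :
  {ae P, forall w, limn_esup (fun n => (X n w)%:E) = +oo%E}.
Hypothesis iXi : P2.-integrable setT (EFin \o Xi).
Hypothesis ijump : forall z, S z ->
  (step_law K z).-integrable setT (EFin \o jump K z).
Hypothesis tail_jump : forall z t, S z ->
  rtail (P := step_law K z) (norm_rv (jump K z)) t <= rtail Xi t.
Variables (A g x0 : R).
Hypotheses (A0 : 0 < A) (g0 : 0 < g).
Hypothesis drift : forall z, S z -> x0 <= z ->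
  mean (step_law K z) (jump K z) (fun j => Num.max j (- A)) <= - g.

Let hX := mean_lipschitz iXi.

(** The Lyapunov function below has a jump, so an indicator is split off and only the rest is a
    Lipschitz function of the jump of the chain. *)
Let integral_le_mean z (B : set R) (f G : R -> R) : S z -> measurable B ->
  measurable_fun setT f -> lipschitz_fun G -> (forall y, 0 <= f y) ->
  (forall y, f y <= \1_B y + G (y - z)) ->
  (\int[K z]_y (f y)%:E <=
   (fine (K z B) + mean (step_law K z) (jump K z) G)%:E)%E.
Proof.
move=> Sz mB mf lG f0 fG.
have iB : (step_law K z).-integrable setT (EFin \o (\1_B : R -> R)).
  by apply: integrable_indic => //; rewrite setIT.
have iG := integrable_lipschitz (ijump Sz) lG.
have KB : K z B \is a fin_num by exact: (fin_num_measure (step_law K z)).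
apply: (@le_trans _ _ (\int[step_law K z]_y (EFin (\1_B y) + EFin (G (jump K z y))))%E).
  apply: ge0_le_integral => //.
  - by move=> y _; rewrite lee_fin.
  - exact/measurable_EFinP.
  - apply: emeasurable_funD.
      exact: measurable_int iB.
    exact: measurable_int iG.
  - by move=> y _; rewrite lee_fin fG.
rewrite (integralD measurableT iB iG) EFinD leeD//.
  by rewrite integral_indic// setIT fineK.
by rewrite /mean /Rintegral fineK//; exact: integrable_fin_num.
Qed.

(** Excursions above [y0, y0 + Y]. From z, jumping below y0 has probability at most P(Xi > z - y0);
    the drift -g along the tangent of barrier / g, whose slope is P(Xi > z - y0) / g, compensates
    exactly this. *)
Lemma negative_drift_renewal_infinite : exists2 Y, 0 < Y &
  forall y0, x0 <= y0 -> renewal_measure X `[y0, y0 + Y] = +oo%E.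
Proof.
(* With the factor 3 of [barrier_le], g / 6 gives barrier / g <= 1/2. Taking Y >= A makes z - y0 >=
   A, so the cut of jumps at -A is harmless. *)
have [B B0 Be] := mean_tail hX (divr_gt0 g0 (ltr0n R 6)).
pose Y := Num.max (2 * B) A.
have YB : 2 * B <= Y by rewrite le_max lexx.
have YA : A <= Y by rewrite le_max lexx orbT.
have Y0 : 0 < Y by exact: lt_le_trans YA.
exists Y => // y0 xy0.
pose W s := g^-1 * barrier Xi Y s.
have W_ge0 s : 0 <= s -> 0 <= W s.
  by move=> s0; rewrite mulr_ge0 ?invr_ge0 ?barrier_ge0// ltW.
have W_le s : W s <= 2^-1.
  rewrite /W mulrC ler_pdivrMr//; apply: le_trans (barrier_le iXi (ltW Y0) s) _.
  have : mean P2 Xi (fun y => Num.max (`|y| - Y / 2) 0) <= g / 6.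
    apply: le_trans Be; apply: (mean_mono hX); [by lipschitz..|move=> y].
    by rewrite ge_max !le_max lexx orbT andbT; apply/orP; left; lra.
  lra.
have W_tangent s z : 0 <= s -> Y <= z ->
    W s <= W z + rtail Xi z / g * (s - z).
  move=> s0 Yz; have := barrier_tangent iXi s0 Yz.
  rewrite /W => /(ler_wpM2l (x := g^-1)); rewrite invr_ge0 => /(_ (ltW g0)).
  by move=> /le_trans; apply; rewrite mulrDr mulrA [rtail _ _ / _]mulrC.
have mW : measurable_fun setT (fun y : R => W (y - y0)).
  apply: measurable_lipschitz; apply: lipschitz_funZ.
  by apply: (lipschitz_fun_comp (lipschitz_barrier iXi Y)); lipschitz.
pose v (y : R) := if y < y0 then 1 else W (y - y0).
have v_ge0 (y : R) : 0 <= v y.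
  by rewrite /v; case: ltP => // y0y; apply: W_ge0; rewrite subr_ge0.
have mv : measurable_fun setT (fun y : R => (v y)%:E).
  by apply/measurable_EFinP; apply: measurable_fun_ifT => //; exact: measurable_fun_ltr.
have lh : lipschitz_fun (fun y : R => Num.max (y - y0) 0) by lipschitz.
have lm : lipschitz_fun (fun j => Num.max j (- A)) by lipschitz.
apply: (@renewal_measure_infinite _ _ _ _ _ _ _ chainX
  `]y0 + Y, +oo[%classic _ `]-oo, y0[%classic _ _ _ _ _
  (fun y => (v y)%:E) (fun y => (Num.max (y - y0) 0)%:E) g) => //.
- move=> y; rewrite /= !in_itv/= !andbT.
  have [h1|h1] := ltP (y0 + Y) y; first by apply: Or31.
  by have [h2|h2] := ltP y y0; [apply: Or33|apply: Or32].
- move=> y; rewrite /= !in_itv/= !andbT => h1 h2.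
  have := lt_trans h2 h1; rewrite ltNge => /negP; apply; rewrite lerDl; exact: ltW.
- by move=> y; rewrite /= in_itv/= /v => ->.
- move=> y; rewrite /= in_itv/= andbT => h1; rewrite lee_fin /v ltNge.
  by rewrite (le_trans _ (ltW h1)) ?lerDl ?(ltW Y0)//=.
- move=> z Sz; rewrite /= in_itv/= andbT => zY.
  have Yz : Y <= z - y0 by lra.
  have xz : x0 <= z by lra.
  have c0 : 0 <= rtail Xi (z - y0) / g by rewrite divr_ge0 ?rtail_ge0 ?ltW.
  have lG : lipschitz_fun
      (fun j => W (z - y0) + rtail Xi (z - y0) / g * Num.max j (- A)) by lipschitz.
  have Wb y : (v y <= \1_(`]-oo, y0[%classic) y +
      (W (z - y0) + rtail Xi (z - y0) / g * Num.max (y - z) (- A))).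
    have h (s : R) : 0 <= s -> s - (z - y0) <= Num.max (y - z) (- A) ->
        W s <= W (z - y0) + rtail Xi (z - y0) / g * Num.max (y - z) (- A).
      move=> s0 sz; apply: le_trans (W_tangent _ _ s0 Yz) _.
      by rewrite lerD2l ler_wpM2l.
    (* Below y0 the indicator pays for v = 1, and the remaining term is nonnegative because it
       dominates [W 0]. *)
    rewrite /v indicE; have [y0y|y0y] := ltP y y0.
      rewrite mem_set/= ?in_itv//= lerDl; apply: le_trans (h 0 _ _) => //.
        exact: W_ge0.
      by rewrite le_max; apply/orP; right; lra.
    rewrite memNset/= ?in_itv/=; last by rewrite ltNge y0y.
    by rewrite add0r; apply: h; rewrite ?subr_ge0// le_max; apply/orP; left; lra.
  apply: le_trans (integral_le_mean Sz _ _ lG v_ge0 Wb) _ => //.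
    exact/measurable_EFinP.
  rewrite lee_fin /v ltNge (_ : y0 <= z) /=; last lra.
  have hz := mean_lipschitz (ijump Sz).
  rewrite (meanD hz); [|by lipschitz..]; rewrite (mean_cst hz) (meanZ hz)//.
  have : fine (K z `]-oo, y0[%classic) <= rtail Xi (z - y0).
    apply: le_trans (tail_jump (z - y0) Sz).
    rewrite -lee_fin rtailE fineK; last exact: (fin_num_measure (step_law K z)).
    apply: le_measure; rewrite ?inE; [by []|exact: (measurable_tail (P := step_law K z) (norm_rv (jump K z)))|].
    move=> y; rewrite /= in_itv/= => yy0; change (z - y0 < `|y - z|).
    by rewrite ltr0_norm; lra.
  have : rtail Xi (z - y0) / g * mean (step_law K z) (jump K z) (fun j => Num.max j (- A)) <=
      rtail Xi (z - y0) / g * - g by rewrite ler_wpM2l// drift.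
  by rewrite mulrN divfK ?gt_eqF//; lra.
- by move=> y; rewrite lee_fin le_max lexx orbT.
- by apply/measurable_EFinP; exact: measurable_lipschitz.
- move=> z Sz; rewrite /= in_itv/= andbT => zY.
  have xz : x0 <= z by lra.
  have lG : lipschitz_fun (fun j => (z - y0) + Num.max j (- A)) by lipschitz.
  have h0 y : 0 <= Num.max (y - y0) 0 by rewrite le_max lexx orbT.
  have hb y : (Num.max (y - y0) 0 <= \1_(set0 : set R) y +
      (z - y0 + Num.max (y - z) (- A))).
    rewrite indicE memNset// add0r ge_max; apply/andP; split.
      have : y - z <= Num.max (y - z) (- A) by rewrite le_max lexx.
      lra.
    have : - A <= Num.max (y - z) (- A) by rewrite le_max lexx orbT.
    lra.
  have hz := mean_lipschitz (ijump Sz).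
  have := integral_le_mean Sz measurable0 (measurable_lipschitz lh) lG h0 hb.
  rewrite (meanD hz); [|by lipschitz..]; rewrite (mean_cst hz) measure0 add0r => le1.
  apply: le_trans (leeD2r _ le1) _; rewrite -EFinD lee_fin.
  have := drift Sz xz; rewrite max_l; lra.
- move=> M; exists (Num.max (M - y0) 0) => y yM; rewrite lee_fin ge_max !le_max.
  by rewrite lexx orbT andbT lerD2r yM.
- apply: filterS limsupX => w Xoo N.
  have [n Nn Xn] := limn_esup_pinfty Xoo (y0 + Y) N.
  by exists n => //=; rewrite in_itv/= andbT.
Qed.

End negative_drift.

(** * Mass of long windows *)

Section windows.
Context (R : realType) (H : {measure set R -> \bar R}) (v t_ : R -> R) (C_H : R).
Hypothesis v_gt0 : forall x, 0 < v x.
Hypothesis t_oo : increases_to_infinity t_.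
Hypothesis local_H : forall t : R -> R, increases_to_infinity t ->
  (forall x, t x <= t_ x) ->
  ((v x)%:E * H `]x, (x + t x)%R]%classic / (t x)%:E)%E @[x --> +oo] --> C_H%:E.

(* Were the estimate to fail at points [x_k --> +oo] with windows [T_k --> +oo],
   a step function [t] with [t x_k = T_k] would contradict [local_H]. *)
Lemma window_mass e : 0 < e -> exists2 T0, 0 < T0 & forall T, T0 <= T ->
  \forall x \near +oo,
    (((C_H - e) * T)%:E <= (v x)%:E * H `]x, (x + T)%R]%classic <= ((C_H + e) * T)%:E)%E.
Proof.
move=> e0; apply: contrapT => noT.
pose good x T := (((C_H - e) * T)%:E <= (v x)%:E * H `]x, (x + T)%R]%classic <=
  ((C_H + e) * T)%:E)%E.
have [t_mono t_lim] := t_oo.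
have t_large M : \forall x \near +oo, M <= t_ x by move: M; apply/cvgryPge.
have : forall p : R * R, exists q : R * R,
    [/\ p.1 + 1 <= q.1, p.2 + 1 <= q.2, q.1 <= t_ q.2 & ~~ good q.2 q.1].
  move=> p; apply: contrapT => noq; apply: noT.
  exists (Num.max (p.1 + 1) 1); first by rewrite lt_max ltr01 orbT.
  move=> T; rewrite ge_max => /andP[pT _]; near=> x.
  apply/negP => /negP bad; apply: noq; exists (T, x); split => //=.
  by near: x; exact: t_large.
(* [u k] is a pair (T_k, x_k) at which the estimate fails; both coordinates grow by at least 1 at
   each step. *)
move=> /choice[f f_]; pose u k := iter k.+1 f (0, 0).
have u_ge k : k%:R <= (u k).1 /\ k%:R <= (u k).2.
  elim: k => [|k [IH1 IH2]].
    have [h1 h2 _ _] := f_ (0, 0); rewrite !add0r in h1 h2.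
    by split; apply: le_trans ler01 _.
  have [h1 h2 _ _] := f_ (u k); rewrite -natr1.
  by split; [apply: le_trans h1|apply: le_trans h2]; rewrite lerD2r.
have u_S k : [/\ (u k).1 + 1 <= (u k.+1).1 & (u k).2 + 1 <= (u k.+1).2].
  by have [h1 h2 _ _] := f_ (u k).
have u_mono1 : {homo (fun k => (u k).1) : i j / (i <= j)%N >-> i <= j}.
  by apply: homo_leq => // [? ? ?|k]; [exact: le_trans|have [h _] := u_S k; lra].
have u_mono2 : {homo (fun k => (u k).2) : i j / (i <= j)%N >-> i <= j}.
  by apply: homo_leq => // [? ? ?|k]; [exact: le_trans|have [_ h] := u_S k; lra].
have u_good k : (u k).1 <= t_ (u k).2 /\ ~~ good (u k).2 (u k).1.
  by case: k => [|k]; [have [_ _ ? ?] := f_ (0, 0)|have [_ _ ? ?] := f_ (u k)].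
have ex x : exists k, x <= (u k).2.
  have [k xk] : exists k : nat, x <= k%:R.
    exists (Num.bound `|x|); apply: le_trans (ler_norm x) _; apply: ltW.
    exact: archi_boundP (normr_ge0 _).
  by exists k; apply: le_trans xk _; have [_] := u_ge k.
pose n x := ex_minn (ex x).
have n_le x k : x <= (u k).2 -> (n x <= k)%N.
  by rewrite /n; case: ex_minnP => m _; apply.
have xn x : x <= (u (n x)).2 by rewrite /n; case: ex_minnP.
have n_mono x y : x <= y -> (n x <= n y)%N.
  by move=> xy; apply: n_le; exact: le_trans xy (xn y).
have nu k : n (u k).2 = k.
  apply/eqP; rewrite eqn_leq n_le//= leqNgt; apply/negP => nk.
  have := xn (u k).2; have [_] := u_S (n (u k).2).
  by have := u_mono2 _ _ nk; lra.
(* [n x] is the first index with x <= x_k. The minimum keeps t below [t_], and does not change the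
   value T_k at x_k since T_k <= t_ x_k. *)
pose t x := Num.min (u (n x)).1 (t_ x).
have t_up : increases_to_infinity t.
  split=> [x y xy|].
    by rewrite /t le_min !ge_min u_mono1 ?n_mono// t_mono// orbT.
  apply/cvgryPge => M; near=> x; rewrite le_min; apply/andP; split; last first.
    by near: x; exact: t_large.
  pose k := Num.bound `|M|.
  have kx : (k <= n x)%N.
    rewrite leqNgt; apply/negP => nk.
    have := u_mono2 _ _ (ltnW nk); apply/negP; rewrite -ltNge.
    apply: lt_le_trans (xn x).
    by near: x; apply: nbhs_pinfty_gt; rewrite num_real.
  apply: le_trans (u_mono1 _ _ kx); apply: le_trans (proj1 (u_ge k)).
  by apply: le_trans (ler_norm M) _; apply: ltW; exact: archi_boundP (normr_ge0 _).
have t_le x : t x <= t_ x by rewrite ge_min lexx orbT.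
have /fine_cvgP[] := local_H t_up t_le => fin /cvgrPdist_le/(_ _ e0) close.
have [M [_ MP]] : \forall x \near +oo, good x (t x).
  have t0 : \forall x \near +oo, 1 <= t x by move/cvgryPge: (proj2 t_up); apply.
  near=> x.
  have tx1 : 1 <= t x by near: x.
  have tx : 0 < t x by exact: lt_le_trans tx1.
  have : `|C_H - fine ((v x)%:E * H `]x, (x + t x)%R]%classic / (t x)%:E)%E| <= e by near: x.
  have : ((v x)%:E * H `]x, (x + t x)%R]%classic / (t x)%:E)%E \is a fin_num by near: x.
  rewrite /good inver (gt_eqF tx).
  have : (0 <= (v x)%:E * H `]x, (x + t x)%R]%classic)%E.
    by rewrite mule_ge0// lee_fin ltW.
  case: (_ * _)%E => [r| |] //= _; last first.
    by rewrite gt0_mulye// lte_fin invr_gt0.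
  move=> _; rewrite !lee_fin ler_distlC => /andP[h1 h2].
  apply/andP; split; first by rewrite -ler_pdivlMr.
  by rewrite -ler_pdivrMr.
pose k := (Num.bound `|M|).+1.
have [uk /negP] := u_good k; apply.
have := MP (u k).2; rewrite /t nu min_l//; apply.
apply: lt_le_trans (proj2 (u_ge k)).
apply: le_lt_trans (ler_norm M) _; apply: lt_trans (archi_boundP (normr_ge0 M)) _.
by rewrite ltr_nat.
Unshelve. all: end_near. Qed.


Let m a b := fine (H `]a, b]%classic).

Lemma window_fine e : 0 < e -> exists2 T0, 0 < T0 & forall T, T0 <= T ->
  \forall x \near +oo, H `]x, (x + T)%R]%classic \is a fin_num /\
    (C_H - e) * T <= v x * m x (x + T) <= (C_H + e) * T.
Proof.
move=> /window_mass[T0 T00 T0P]; exists T0 => // T /T0P; apply: filterS => x.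
rewrite /m; have : (0 <= H `]x, (x + T)%R]%classic)%E by [].
case: (H _) => [r| |]//= _; last by rewrite gt0_muley ?lte_fin// leye_eq andbF.
Qed.

Lemma window_lty T : \forall x \near +oo, (H `]x, (x + T)%R]%classic < +oo)%E.
Proof.
have [T0 _ /(_ (Num.max T0 T))] := window_fine ltr01.
rewrite le_max lexx => /(_ isT); apply: filterS => x [fin _].
apply: (@le_lt_trans _ _ (H `]x, (x + Num.max T0 T)%R]%classic)).
  apply: le_measure; rewrite ?inE// => y; rewrite /= !in_itv/= => /andP[-> h].
  by rewrite (le_trans h)// lerD2l le_max lexx orbT.
by rewrite ltey_eq fin.
Qed.

Lemma local_H_ge0 : 0 <= C_H.
Proof.
rewrite leNgt; apply/negP => C0.
have [|T0 T00 /(_ _ (lexx _))] := @window_fine (- C_H / 2).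
  by rewrite divr_gt0// oppr_gt0.
move=> /filter_ex[x [_ /andP[_]]]; apply/negP; rewrite -ltNge.
apply: (@lt_le_trans _ _ 0); last by rewrite mulr_ge0 ?fine_ge0// ltW.
by rewrite pmulr_llt0//; lra.
Qed.

Let m_sub a b c d : c <= a -> b <= d -> H `]c, d]%classic \is a fin_num ->
  H `]a, b]%classic \is a fin_num /\ m a b <= m c d.
Proof.
move=> ca bd cd.
have le : (H `]a, b]%classic <= H `]c, d]%classic)%E.
  apply: le_measure; rewrite ?inE// => y; rewrite /= !in_itv/= => /andP[h1 h2].
  by rewrite (le_lt_trans ca h1) (le_trans h2 bd).
have ab : H `]a, b]%classic \is a fin_num.
  by rewrite ge0_fin_numE// (le_lt_trans le)// ltey_eq cd.
by split=> //; rewrite /m fine_le.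
Qed.

Let mD a b c : a <= b -> b <= c -> H `]a, c]%classic \is a fin_num ->
  m a c = m a b + m b c.
Proof.
move=> ab bc ac.
have [ab_fin _] := m_sub (lexx a) bc ac.
have [bc_fin _] := m_sub ab (lexx c) ac.
rewrite /m -fineD// -measureU//; last first.
  apply/seteqP; split=> // y [] /=; rewrite !in_itv/= => /andP[_ yb] /andP[+ _].
  by rewrite ltNge yb.
congr (fine (H _)); apply/seteqP; split=> y; rewrite /= !in_itv/=.
  by move=> /andP[-> ->]; rewrite andbT /=; case: (leP y b); [left|right].
by move=> [] /andP[h1 h2]; rewrite ?h1 ?h2 ?andbT ?(le_trans h2 bc) ?(le_lt_trans ab h1).
Qed.

Section positive_limit.
Hypothesis C0 : 0 < C_H.

Let translation_near (F : R -> Prop) s : (\forall x \near +oo, F x) ->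
  \forall x \near +oo, F (x + s).
Proof.
move=> [M [_ MP]]; exists (M - s); split; first exact: num_real.
by move=> x xM; apply: MP; rewrite -ltrBlDr.
Qed.

(** The window (x + s, x + s + T] has mass about C_H * T / v (x + s), and also about C_H * T / v x
    as most of (x, x + s + T]. The missing piece (x, x + s] is negligible when T is large compared
    with s. *)
Let ratio_ge0 s e : 0 <= s -> 0 < e <= 1 ->
  \forall x \near +oo, `|v x - v (x + s)| <= e * v (x + s).
Proof.
move=> s0 /andP[e0 e1].
have [|T0 T00 T0P] := @window_fine (C_H * (e / 8)).
  by rewrite mulr_gt0// divr_gt0.
(* T' bounds the mass of the missing piece, and T' = (e / 8) * T. *)
pose T' := Num.max T0 s; pose T := 8 / e * T'.
have T'T0 : T0 <= T' by rewrite le_max lexx.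
have T's : s <= T' by rewrite le_max lexx orbT.
have T'0 : 0 < T' by exact: lt_le_trans T'T0.
have eT : e / 8 * T = T'.
  by rewrite /T mulrA -[e / 8]invf_div mulVf ?mul1r// gt_eqF// divr_gt0.
have T'T : T' <= T.
  by rewrite -[leLHS]mul1r /T ler_pM2r// ler_pdivlMr// mul1r; lra.
have T_gt0 : 0 < T by exact: lt_le_trans T'T.
have n1 : \forall x \near +oo, H `]x, (x + (s + T))%R]%classic \is a fin_num /\
    (C_H - C_H * (e / 8)) * (s + T) <= v x * m x (x + (s + T)) <=
    (C_H + C_H * (e / 8)) * (s + T).
  by apply: T0P; lra.
have n2 := T0P _ T'T0.
have n3 := translation_near s (T0P T (le_trans T'T0 T'T)).
apply: filterS3 n1 n2 n3 => x [f1 /andP[l1 u1]] [f2 /andP[l2 u2]] [f3 /andP[l3 u3]].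
have vx := v_gt0 x; have vxs := v_gt0 (x + s).
rewrite -[x + s + T]addrA in f3 l3 u3.
have hD : m x (x + (s + T)) = m x (x + s) + m (x + s) (x + (s + T)) by apply: mD => //; lra.
have [_ le2] : H `]x, (x + s)%R]%classic \is a fin_num /\ m x (x + s) <= m x (x + T').
  by apply: m_sub => //; lra.
have m_ge0 a b : 0 <= m a b by exact: fine_ge0.
set A := m (x + s) _ in hD l3 u3.
set k := e / 8 in l1 u1 l2 u2 l3 u3 eT.
have k0 : 0 < k by rewrite divr_gt0.
have k1 : k <= 8^-1 by rewrite /k ler_pdivrMr// mulVf.
have kC : 0 < C_H * T by rewrite mulr_gt0.
have kQ : 0 < k * (C_H * T) by rewrite mulr_gt0.
have kkQ : k * (k * (C_H * T)) <= 8^-1 * (k * (C_H * T)) by rewrite ler_pM2r.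
have kkQ0 : 0 <= k * (k * (C_H * T)) by rewrite mulr_ge0 ?ltW.
have Cs : 0 <= (C_H - C_H * k) * s.
  by rewrite mulr_ge0// subr_ge0 -[leRHS]mulr1 ler_pM2l//; lra.
have Cs' : (C_H + C_H * k) * s <= (C_H + C_H * k) * T'.
  by rewrite ler_wpM2l// addr_ge0 ?mulr_ge0 ?ltW.
have D_le : v x * A <= v x * m x (x + (s + T)).
  by rewrite ler_pM2l// hD lerDr.
have D_ge : v x * m x (x + (s + T)) - v x * m x (x + T') <= v x * A.
  by rewrite -mulrBr ler_pM2l// hD; lra.
have A0 : 0 < A.
  rewrite -(pmulr_rgt0 _ vxs); apply: lt_le_trans l3.
  by rewrite mulr_gt0// subr_gt0 -[ltRHS]mulr1 ltr_pM2l//; lra.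
rewrite -(ler_pM2r A0) -{1}(gtr0_norm A0) -normrM mulrBl.
have e8 : e = 8 * k by rewrite /k mulrC divfK.
rewrite e8 ler_norml.
have q1 : (C_H - C_H * k) * (s + T) =
  (C_H - C_H * k) * s + C_H * T - k * (C_H * T) by ring.
have q2 : (C_H + C_H * k) * (s + T) =
  (C_H + C_H * k) * s + C_H * T + k * (C_H * T) by ring.
have q3 : (C_H + C_H * k) * T' = k * (C_H * T) + k * (k * (C_H * T)).
  by rewrite -eT; ring.
have q4 : (C_H - C_H * k) * T = C_H * T - k * (C_H * T) by ring.
have q5 : (C_H + C_H * k) * T = C_H * T + k * (C_H * T) by ring.
rewrite q1 in l1; rewrite q2 in u1; rewrite q3 in Cs' u2; rewrite q4 in l3; rewrite q5 in u3.
have D'8 : k * (C_H * T - k * (C_H * T)) <= k * (v (x + s) * A) by rewrite ler_pM2l.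
rewrite mulrBr in D'8.
have -> : 8 * k * v (x + s) * A = 8 * (k * (v (x + s) * A)) by ring.
move: kkQ kkQ0 kQ l1 u1 u2 l3 u3 Cs Cs' D_le D_ge D'8; clear.
move=> *; apply/andP; split; lra.
Qed.

Let ratio s e : 0 < e <= 1 ->
  \forall x \near +oo, `|v x - v (x + s)| <= e * v (x + s).
Proof.
move=> /andP[e0 e1]; have [s0|s0] := leP 0 s; first by apply: ratio_ge0 => //; rewrite e0.
have : \forall x \near +oo, `|v x - v (x - s)| <= e / 2 * v (x - s).
  by apply: ratio_ge0; [lra|apply/andP; split; lra].
move=> /(translation_near s); apply: filterS => x; rewrite addrK !ler_norml => h.
have vx := v_gt0 x; have := mulr_gt0 e0 vx.
have : e * v x <= 1 * v x by rewrite ler_pM2r.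
have e2 : e / 2 * v x = e * v x / 2 by ring.
rewrite e2 in h; move=> ev1 ev0.
have le2 : e * (v x / 2) <= e * v (x + s) by rewrite ler_pM2l//; lra.
lra.
Qed.

(** The weight remains v x while the window is moved, to the left as well; this is what gives limit
    points the same averages in both directions. *)
Lemma window_shift e : 0 < e -> exists2 T0, 0 < T0 & forall T s, T0 <= T ->
  \forall x \near +oo,
    H `](x + s)%R, (x + s + T)%R]%classic \is a fin_num /\
    (C_H - e) * T <= v x * fine (H `](x + s)%R, (x + s + T)%R]%classic) <= (C_H + e) * T.
Proof.
move=> e0; have e2 : 0 < e / 2 by rewrite divr_gt0.
have [T0 T00 T0P] := window_fine e2; exists T0 => // T s TT0.
have T_gt0 : 0 < T by exact: lt_le_trans TT0.
pose k := Num.min 1 (e / 2 / (C_H + e / 2)).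
have Ce : 0 < C_H + e / 2 by exact: addr_gt0.
have k0 : 0 < k by rewrite lt_min ltr01/= !divr_gt0.
have k1 : 0 < k <= 1 by rewrite k0 ge_min lexx.
have kC : k * (C_H + e / 2) <= e / 2 by rewrite -ler_pdivlMr// ge_min lexx orbT.
apply: filterS2 (ratio s k1) (translation_near s (T0P T TT0)) => x r [f /andP[l u]].
split=> //; rewrite -/(m _ _) in l u *.
have A0 : 0 <= m (x + s) (x + s + T) by exact: fine_ge0.
move: r => /(ler_wpM2r A0); rewrite -{1}(ger0_norm A0) -normrM mulrBl ler_norml => r.
have ku : k * (v (x + s) * m (x + s) (x + s + T)) <= k * ((C_H + e / 2) * T).
  by rewrite ler_pM2l.
have ku' : k * ((C_H + e / 2) * T) <= e / 2 * T by rewrite mulrA ler_pM2r.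
rewrite -mulrA in r; lra.
Qed.

End positive_limit.

End windows.

(** * The renewal measure *)

Section renewal.
Local Open Scope ereal_scope.
Context (R : realType) (d : measure_display) (Omega : measurableType d)
  (P : probability Omega R) (S : set R) (K : R.-pker R ~> R)
  (X : nat -> {RV P >-> R}).
Hypothesis chainX : markov_chain S K X.

Definition renewal : {measure set R -> \bar R} :=
  mseries (fun n => distribution P (X n)) 0.

Lemma renewalE B : renewal B = renewal_measure X B.
Proof. by []. Qed.

Lemma integral_renewal (f : R -> \bar R) : (forall y, 0 <= f y) ->
  measurable_fun setT f ->
  \int[renewal]_z f z = \sum_(n <oo) \int[P]_w f (X n w).
Proof.
move=> f0 mf; rewrite ge0_integral_measure_series//.
by apply: eq_eseriesr => n _; rewrite ge0_integral_pushforward// preimage_setT.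
Qed.

(** Dropping the term n = 0 from the integral of f against [H] leaves the integral of K f. *)
Lemma renewal_le (f g : R -> \bar R) : (forall y, 0 <= f y) ->
  (forall y, 0 <= g y) -> measurable_fun setT f -> measurable_fun setT g ->
  (forall z, S z -> g z <= \int[K z]_y f y) ->
  \int[renewal]_z g z <= \int[renewal]_z f z.
Proof.
move=> f0 g0 mf mg gf; rewrite !integral_renewal//.
have fX0 n : 0 <= \int[P]_w f (X n w) by exact: integral_ge0.
rewrite [leRHS]nneseries_recl// -[leLHS]add0e leeD//.
rewrite -(nneseries_addn 1 fX0); apply: lee_nneseries => n _; first by move=> _; exact: integral_ge0.
rewrite addn1; have FT : natural_filtration X n setT.
  rewrite -[setT](@preimage_setT _ _ (X n)).
  exact: filtration_preimage.
rewrite (markov_integral chainX FT f0 mf); apply: ge0_le_integral => //.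
- exact: measurableT_comp.
- apply: (@measurableT_comp _ _ _ _ _ _ (fun z => \int[K z]_y f y)) => //.
  by apply: measurable_fun_integral_kernel => //; exact: measurable_kernel.
- by move=> w _; apply: gf; case: chainX.
Qed.

Lemma state_unbounded :
  {ae P, forall w, limn_esup (fun n => (X n w)%:E) = +oo} ->
  forall M, exists2 z, S z & (M < z)%R.
Proof.
move=> limsupX M.
have : ProperFilter (almost_everywhere P).
  apply: ae_properfilter_algebraOfSetsType.
  by rewrite [ltRHS](probability_setT P) lte01.
move=> PF; have [w Xoo] := filter_ex limsupX.
have [n _ MX] := limn_esup_pinfty Xoo M 0.
by exists (X n w) => //; case: chainX.
Qed.

End renewal.

(** * Tent functions *)

Section bump.
Context (R : realType).
Implicit Types a r s t u y : R.

(** A difference of ramps, so that [ramp_cvg] applies to it and sums at spacing r telescope; [bumpE]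
    gives the tent form. *)
Definition bump s r y : R := (ramp (s - r) r y - ramp s r y) / r.

Lemma lipschitz_bump s r : lipschitz_fun (bump s r).
Proof.
have -> : bump s r = (fun y => r^-1 * (ramp (s - r) r y - ramp s r y)).
  by apply/funext => y; rewrite /bump mulrC.
by apply: lipschitz_funZ; apply: lipschitz_funB; exact: lipschitz_ramp.
Qed.

Variable r : R.
Hypothesis r0 : 0 < r.

Lemma bumpE s y : bump s r y = Num.max (1 - `|y - s| / r) 0.
Proof.
have r1 : r != 0 by rewrite gt_eqF.
apply: (mulIf r1); rewrite /bump divfK// maxr_pMl ?ltW// mul0r mulrBl mul1r divfK//.
rewrite /ramp; have r0' := r0.
case: (leP (y - (s - r)) 0) => h1; case: (leP (y - s) 0) => h2.
- rewrite (min_l (ltW r0)) subrr max_r// ler0_norm//; lra.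
- lra.
- rewrite (min_l (ltW r0)) subr0 ler0_norm//.
  by rewrite min_l ?max_l; lra.
- rewrite gtr0_norm// min_r; last lra.
  by case: (leP (y - s) r) => h3; [rewrite max_l|rewrite max_r]; lra.
Qed.

Lemma bump_ge0 s y : 0 <= bump s r y.
Proof. by rewrite bumpE le_max lexx orbT. Qed.

Lemma bump_le1 s y : bump s r y <= 1.
Proof.
rewrite bumpE ge_max ler01 andbT gerBl; apply: mulr_ge0 => //.
by rewrite invr_ge0 ltW.
Qed.

Lemma bump_gt0 s y : 0 < bump s r y -> `|y - s| < r.
Proof. by rewrite bumpE lt_max ltxx orbF subr_gt0 ltr_pdivrMr// mul1r. Qed.

Lemma bump_near s t y z : bump s r y <= bump t r z + `|(y - s) - (z - t)| / r.
Proof.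
rewrite !bumpE ge_max; apply/andP; split; last first.
  apply: addr_ge0; first by rewrite le_max lexx orbT.
  by apply: mulr_ge0 => //; rewrite invr_ge0 ltW.
have : `|z - t| / r <= (`|y - s| + `|(y - s) - (z - t)|) / r.
  have {1}-> : z - t = (y - s) - ((y - s) - (z - t)) by ring.
  by rewrite ler_pM2r ?invr_gt0// ler_normB.
have : 1 - `|z - t| / r <= Num.max (1 - `|z - t| / r) 0 by rewrite le_max lexx.
rewrite mulrDl; lra.
Qed.

Lemma sum_bump s n y :
  \sum_(i < n) bump (s + i%:R * r) r y =
  (ramp (s - r) r y - ramp (s + n%:R * r - r) r y) / r.
Proof.
elim: n => [|n IH]; first by rewrite big_ord0 mul0r addr0 subrr mul0r.
have e : s + n.+1%:R * r - r = s + n%:R * r by rewrite -natr1; ring.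
by rewrite big_ord_recr/= IH /bump e -mulrDl; congr (_ / _); ring.
Qed.

Lemma sum_bump_le1 s n y : \sum_(i < n) bump (s + i%:R * r) r y <= 1.
Proof.
rewrite sum_bump ler_pdivrMr// mul1r lerBlDr.
apply: le_trans (ramp_le _ _ _) _; rewrite lerDl; exact: ramp_ge0 (ltW r0).
Qed.

Lemma sum_bump_eq1 s n y : s <= y -> y <= s + n%:R * r - r ->
  \sum_(i < n) bump (s + i%:R * r) r y = 1.
Proof.
move=> sy yn; rewrite sum_bump /ramp (max_l (x := y - (s - r))); last first.
  by move: r0; lra.
rewrite min_r; last by move: r0; lra.
by rewrite (max_r (y := 0)) ?subr_le0// min_l ?ltW// subr0 divff// gt_eqF.
Qed.

Lemma sum_bump_eq0 s n y : (y <= s - r) || (s + n%:R * r <= y) ->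
  \sum_(i < n) bump (s + i%:R * r) r y = 0.
Proof.
move=> h; apply: big1 => i _; apply/eqP; rewrite bumpE eq_maxr//.
rewrite subr_le0 ler_pdivlMr// mul1r ler_normr; apply/orP.
have i0 : 0 <= i%:R * r by rewrite mulr_ge0 ?(ltW r0).
have iS : i.+1%:R * r <= n%:R * r by rewrite ler_pM2r// ler_nat.
move: iS; rewrite -natr1 mulrDl mul1r => iS.
by move: h => /orP[h|h]; [right|left]; lra.
Qed.

End bump.

(** * Regularised local mass *)

Section scaled_mass.
Context (R : realType) (H : {measure set R -> \bar R}) (v : R -> R).
Hypothesis v_gt0 : forall x, 0 < v x.

Definition scaled_mass x (f : R -> R) : \bar R :=
  ((v x)%:E * \int[H]_z (f (z - x))%:E)%E.

Implicit Types (x : R) (f g : R -> R).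

Let v_ge0 x : (0 <= (v x)%:E)%E. Proof. by rewrite lee_fin ltW. Qed.

Let measurable_shift x f : measurable_fun setT f ->
  measurable_fun setT (fun z : R => (f (z - x))%:E).
Proof.
move=> mf; apply/measurable_EFinP; apply: (measurableT_comp mf).
by apply: measurable_lipschitz; lipschitz.
Qed.

Lemma scaled_mass_ge0 x f : (forall u, 0 <= f u) -> (0 <= scaled_mass x f)%E.
Proof.
by move=> f0; rewrite mule_ge0// integral_ge0// => z _; rewrite lee_fin.
Qed.

Lemma le_scaled_mass x f g : (forall u, 0 <= f u) -> (forall u, f u <= g u) ->
  measurable_fun setT f -> measurable_fun setT g ->
  (scaled_mass x f <= scaled_mass x g)%E.
Proof.
move=> f0 fg mf mg; rewrite /scaled_mass lee_pmul2l ?lte_fin//.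
apply: ge0_le_integral => //; [|exact: measurable_shift..|].
  by move=> z _; rewrite lee_fin.
by move=> z _; rewrite lee_fin.
Qed.

Lemma scaled_massD x f g : (forall u, 0 <= f u) -> (forall u, 0 <= g u) ->
  measurable_fun setT f -> measurable_fun setT g ->
  scaled_mass x (fun u => f u + g u) = (scaled_mass x f + scaled_mass x g)%E.
Proof.
move=> f0 g0 mf mg; rewrite /scaled_mass -ge0_muleDr ?integral_ge0//; last 2 first.
  by move=> z _; rewrite lee_fin.
  by move=> z _; rewrite lee_fin.
rewrite -ge0_integralD//; [|exact: measurable_shift| |exact: measurable_shift].
  by move=> z _; rewrite lee_fin.
by move=> z _; rewrite lee_fin.
Qed.

Lemma scaled_massZ x a f : 0 <= a -> (forall u, 0 <= f u) ->
  measurable_fun setT f -> scaled_mass x (fun u => a * f u) = (a%:E * scaled_mass x f)%E.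
Proof.
move=> a0 f0 mf; rewrite /scaled_mass muleCA; congr (_ * _)%E.
under eq_integral do rewrite EFinM.
rewrite ge0_integralZl//; first exact: measurable_shift.
by move=> z _; rewrite lee_fin.
Qed.

Lemma scaled_mass_sum x n (f : 'I_n -> R -> R) : (forall i u, 0 <= f i u) ->
  (forall i, measurable_fun setT (f i)) ->
  scaled_mass x (fun u => \sum_(i < n) f i u) = (\sum_(i < n) scaled_mass x (f i))%E.
Proof.
move=> f0 mf; transitivity ((v x)%:E * \sum_(i < n) \int[H]_z (f i (z - x))%:E)%E.
  congr (_ * _)%E; under eq_integral do rewrite -sumEFin.
  rewrite ge0_integral_sum// => [i|i z _]; first exact: measurable_shift.
  by rewrite lee_fin.
rewrite ge0_sume_distrr// => i _; apply: integral_ge0 => z _.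
by rewrite lee_fin.
Qed.

Lemma scaled_mass_indic x a b :
  scaled_mass x \1_(`]a, b]%classic) =
  ((v x)%:E * H `](x + a)%R, (x + b)%R]%classic)%E.
Proof.
rewrite /scaled_mass; congr (_ * _)%E.
rewrite -[X in H X]setIT -integral_indic//; apply: eq_integral => z _.
congr (_%:E); rewrite !indicE; congr (nat_of_bool _)%:R.
by apply/idP/idP; rewrite !inE/= !in_itv/=; lra.
Qed.

End scaled_mass.

Section regularised_mass.
Context (R : realType) (H : {measure set R -> \bar R}) (v : R -> R) (w k : R).
Hypothesis v_gt0 : forall x, 0 < v x.
Hypotheses (w0 : 0 < w) (k0 : 0 < k).

Let excess s h (u : R) : R := Num.max (bump s w u - h) 0.

Let excess_ge0 s h u : 0 <= excess s h u.
Proof. by rewrite le_max lexx orbT. Qed.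

Let lipschitz_excess s h : lipschitz_fun (excess s h).
Proof.
apply: lipschitz_fun_max; last exact: lipschitz_fun_cst.
by apply: lipschitz_funB; [exact: lipschitz_bump|exact: lipschitz_fun_cst].
Qed.

Let mexcess s h : measurable_fun setT (excess s h).
Proof. exact: measurable_lipschitz. Qed.

Let cost x s h := (scaled_mass H v x (excess s h) + (k * h)%:E)%E.

Let cost_ge0 x s h : 0 <= h -> (0 <= cost x s h)%E.
Proof.
move=> h0; apply: adde_ge0; first exact: scaled_mass_ge0.
by rewrite lee_fin mulr_ge0// ltW.
Qed.

(* Truncating the bump at height [h] costs [k * h], so the values stay in
   [[0, k]] whatever the local mass of [H] is. *)
Definition reg_mass x s : R :=
  fine (ereal_inf [set cost x s h | h in [set h | 0 <= h]]).

Let cost1 x s : cost x s 1 = k%:E.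
Proof.
rewrite /cost (_ : excess s 1 = cst 0).
  by rewrite /scaled_mass integral0 mule0 add0e mulr1.
by apply/funext => u; rewrite /excess/= max_r// subr_le0 bump_le1.
Qed.

Let reg_massE x s : (reg_mass x s)%:E = ereal_inf [set cost x s h | h in [set h | 0 <= h]].
Proof.
rewrite /reg_mass fineK// ge0_fin_numE.
  apply: le_lt_trans (ltry k); rewrite -(cost1 x s).
  by apply: ereal_inf_lbound; exists 1 => //=.
by apply: le_ereal_inf_tmp => _ [h /= h0 <-]; exact: cost_ge0.
Qed.

Lemma reg_mass_le x s (h : R) : 0 <= h ->
  ((reg_mass x s)%:E <=
   scaled_mass H v x (fun u : R => Num.max (bump s w u - h) 0)%R + (k * h)%:E)%E.
Proof. by move=> h0; rewrite reg_massE; apply: ereal_inf_lbound; exists h. Qed.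

Lemma reg_mass_ge x s (m : R) : (forall h : R, 0 <= h ->
    (m%:E <= scaled_mass H v x (fun u : R => Num.max (bump s w u - h) 0)%R + (k * h)%:E)%E) ->
  m <= reg_mass x s.
Proof.
move=> mh; rewrite -lee_fin reg_massE; apply: le_ereal_inf_tmp => _ [h /= h0 <-].
exact: mh.
Qed.

Lemma reg_mass_near x s (h : R) : reg_mass x s < h -> exists2 h' : R,
  0 <= h' & (scaled_mass H v x (fun u : R => Num.max (bump s w u - h') 0)%R +
    (k * h')%:E < h%:E)%E.
Proof.
rewrite -lte_fin reg_massE => /ereal_inf_lt[_ [h' /= h'0 <-] h'h].
by exists h'.
Qed.

Lemma reg_mass_ge0 x s : 0 <= reg_mass x s.
Proof. by apply: reg_mass_ge => h h0; exact: cost_ge0. Qed.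

Lemma reg_mass_le_cst x s : reg_mass x s <= k.
Proof. by rewrite -lee_fin -(cost1 x s); exact: reg_mass_le. Qed.

Lemma reg_mass_le_scaled_mass x s :
  ((reg_mass x s)%:E <= scaled_mass H v x (bump s w))%E.
Proof.
apply: le_trans (reg_mass_le x s (lexx 0)) _; rewrite mulr0 adde0.
rewrite (_ : (fun u => _) = bump s w)//; apply/funext => u.
by rewrite subr0 max_l// bump_ge0.
Qed.

(** Moving the tent changes it by at most |s - t| / w, which is absorbed by raising the truncation
    height at the price k per unit. *)
Lemma lipschitz_reg_mass x s t : `|reg_mass x s - reg_mass x t| <= k / w * `|s - t|.
Proof.
suff le s' t' : reg_mass x s' <= reg_mass x t' + k / w * `|s' - t'|.
  by rewrite ler_norml lerBlDl le (distrC s t) lerNl opprB lerBlDl le.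
rewrite -lerBlDr; apply: reg_mass_ge => h h0.
have h'0 : 0 <= h + `|s' - t'| / w by rewrite addr_ge0// divr_ge0// ltW.
rewrite EFinB leeBlDr//; apply: le_trans (reg_mass_le x s' h'0) _.
rewrite -addeA -EFinD; apply: leeD; last by rewrite lee_fin; lra.
apply: le_scaled_mass; [by []|exact: excess_ge0| |exact: mexcess..] => u.
rewrite /excess ge_max !le_max lexx orbT andbT.
apply/orP; left; have := bump_near w0 s' t' u u.
have -> : (u - s') - (u - t') = - (s' - t') by ring.
by rewrite normrN; lra.
Qed.

(** Truncation does not pay here: cutting off height h saves at most h times the mass of the
    support, which is at most k * h. *)
Lemma reg_massE_le x s : (scaled_mass H v x \1_(`](s - w)%R, (s + w)%R]%classic) <= k%:E)%E ->
  scaled_mass H v x (bump s w) = (reg_mass x s)%:E.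
Proof.
move=> window; apply/eqP; rewrite eq_le reg_mass_le_scaled_mass andbT.
have mi : measurable_fun setT (\1_(`](s - w)%R, (s + w)%R]%classic) : R -> R).
  exact: measurable_indic.
have mb : measurable_fun setT (bump s w).
  by apply: measurable_lipschitz; exact: lipschitz_bump.
have fin : scaled_mass H v x (bump s w) \is a fin_num.
  rewrite ge0_fin_numE; last by apply: scaled_mass_ge0 => // u; exact: bump_ge0.
  apply: (le_lt_trans _ (ltry k)); apply: le_trans window.
  apply: le_scaled_mass => // u; first exact: bump_ge0.
  have [b0|] := ltP 0 (bump s w u).
    rewrite indicE mem_set ?bump_le1//= in_itv/=.
    by have := bump_gt0 w0 b0; rewrite ltr_norml => ?; lra.
  by move=> /le_trans; apply; rewrite indicE.
rewrite -(fineK fin) lee_fin; apply: reg_mass_ge => h h0; rewrite fineK//.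
have -> : (k * h)%:E = (h%:E * k%:E)%E by rewrite mulrC.
apply: (@le_trans _ _ (scaled_mass H v x (excess s h) +
    scaled_mass H v x (fun u => h * \1_(`]s - w, s + w]%classic) u)%R)%E).
  rewrite -scaled_massD//; last 2 first.
  - by move=> u; rewrite mulr_ge0.
  - exact: measurable_funM.
  apply: le_scaled_mass => // [u|u|]; first exact: bump_ge0.
    have e1 : bump s w u - h <= excess s h u by rewrite le_max lexx.
    have [b0|b0] := ltP 0 (bump s w u); last first.
      by rewrite (le_trans b0)// addr_ge0// mulr_ge0.
    rewrite indicE mem_set/= ?mulr1; first lra.
    by rewrite in_itv/=; have := bump_gt0 w0 b0; rewrite ltr_norml => ?; lra.
  by apply: measurable_funD => //; exact: measurable_funM.
by rewrite leeD2l// scaled_massZ// lee_wpmul2l ?lee_fin.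
Qed.

End regularised_mass.

(** * Limits of the regularised mass *)

Section superharmonic_mass.
Context (R : realType) (d : measure_display) (Omega : measurableType d)
  (P : probability Omega R) (S : set R) (K : R.-pker R ~> R)
  (X : nat -> {RV P >-> R}) (v : R -> R) (w k : R).
Hypothesis chainX : markov_chain S K X.
Hypothesis ijump : forall z, S z ->
  (step_law K z).-integrable setT (EFin \o jump K z).
Hypothesis v_gt0 : forall x, 0 < v x.
Hypotheses (w0 : 0 < w) (k0 : 0 < k).

Let b := reg_mass (renewal X) v w k.

Lemma integral_step_law z f : S z -> lipschitz_fun f ->
  (\int[K z]_y (f y)%:E)%E = (mean (step_law K z) (jump K z) (fun j => f (z + j)))%:E.
Proof.
move=> Sz lf; have lf' : lipschitz_fun (fun j => f (z + j)).
  by apply: (lipschitz_fun_comp lf); lipschitz.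
have i := integrable_lipschitz (ijump Sz) lf'.
rewrite /mean /Rintegral fineK; last exact: integrable_fin_num.
apply: eq_integral => y _; congr (f _)%:E.
by rewrite /jump/= /jump_fun addrC subrK.
Qed.

(** Superharmonicity before the limit, for jumps discretised to points [y i] with weights [q i]. The
    condition on z0 places the relevant states where the [q i] bound the jump law from below. *)
Lemma reg_mass_superharmonic x s n (y q : 'I_n -> R) r z0 : 0 < r ->
  (forall i, 0 <= q i) -> \sum_i q i <= 1 ->
  (forall u, \sum_i bump (y i) r u <= 1) ->
  (forall z i, S z -> z0 <= z -> q i <= mean (step_law K z) (jump K z) (bump (y i) r)) ->
  (forall i, z0 <= x + s - y i - w) ->
  \sum_i q i * b x (s - y i) - k * r / w <= b x s.
Proof.
move=> r0 q0 q1 bump1 q_le xz0; apply: reg_mass_ge => // h h0.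
(* A jump within r of [y i] moves the tent by at most r / w; truncating that much higher yields
   [G i (z - x) <= F (z + j - x)] and costs k * r / w in total. *)
pose h' := h + r / w.
have h'0 : 0 <= h' by rewrite addr_ge0// divr_ge0// ltW.
pose F (u : R) : R := Num.max (bump s w u - h) 0.
pose G i (u : R) : R := Num.max (bump (s - y i) w u - h') 0.
have lF : lipschitz_fun F.
  apply: lipschitz_fun_max; last exact: lipschitz_fun_cst.
  by apply: lipschitz_funB; [exact: lipschitz_bump|exact: lipschitz_fun_cst].
have lG i : lipschitz_fun (G i).
  apply: lipschitz_fun_max; last exact: lipschitz_fun_cst.
  by apply: lipschitz_funB; [exact: lipschitz_bump|exact: lipschitz_fun_cst].
have F0 u : 0 <= F u by rewrite le_max lexx orbT.
have G0 i u : 0 <= G i u by rewrite le_max lexx orbT.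
have lshift (f : R -> R) : lipschitz_fun f -> lipschitz_fun (fun z => f (z - x)).
  by move=> lf; apply: (lipschitz_fun_comp lf); lipschitz.
have lsum : lipschitz_fun (fun u => \sum_i q i * G i u).
  by apply: lipschitz_fun_sum => i; exact: lipschitz_funZ.
have sum0 u : 0 <= \sum_i q i * G i u.
  by apply: sumr_ge0 => i _; exact: mulr_ge0.
have step : (scaled_mass (renewal X) v x (fun u => \sum_i q i * G i u)%R <=
    scaled_mass (renewal X) v x F)%E.
  rewrite /scaled_mass lee_pmul2l ?lte_fin//; apply: (renewal_le chainX).
  - by move=> z; rewrite lee_fin.
  - by move=> z; rewrite lee_fin.
  - by apply/measurable_EFinP; apply: measurable_lipschitz; exact: lshift.
  - by apply/measurable_EFinP; apply: measurable_lipschitz; exact: (lshift _ lsum).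
  move=> z Sz; rewrite (integral_step_law Sz (lshift _ lF)) lee_fin.
  have hz := mean_lipschitz (ijump Sz).
  have lb i : lipschitz_fun (bump (y i) r) by exact: lipschitz_bump.
  apply: (@le_trans _ _ (mean (step_law K z) (jump K z)
      (fun j => \sum_i G i (z - x) * bump (y i) r j))).
    rewrite (mean_sum hz) => [|i]; last exact: lipschitz_funZ.
    apply: ler_sum => i _; rewrite (meanZ hz)// mulrC.
    have [G_gt0|] := ltP 0 (G i (z - x)); last first.
      move=> G_le0; have -> : G i (z - x) = 0 by apply/eqP; rewrite eq_le G_le0 G0.
      by rewrite !mul0r.
    rewrite ler_pM2l//; apply: q_le => //.
    have : 0 < bump (s - y i) w (z - x).
      move: G_gt0; rewrite lt_max ltxx orbF subr_gt0; exact: le_lt_trans.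
    move=> /(bump_gt0 w0); rewrite ltr_norml => /andP[h1 _].
    by have := xz0 i; lra.
  apply: (mean_mono hz).
  - by apply: lipschitz_fun_sum => i; exact: lipschitz_funZ.
  - by apply: (lipschitz_fun_comp lF); lipschitz.
  move=> j; apply: (@le_trans _ _ (\sum_i F (z + j - x) * bump (y i) r j)).
    apply: ler_sum => i _.
    have [b_gt0|b_le0] := ltP 0 (bump (y i) r j); last first.
      have -> : bump (y i) r j = 0 by apply/eqP; rewrite eq_le b_le0 bump_ge0.
      by rewrite !mulr0.
    rewrite ler_pM2r// /G /F ge_max !le_max lexx orbT andbT; apply/orP; left.
    have := bump_near w0 (s - y i) s (z - x) (z + j - x).
    have -> : z - x - (s - y i) - (z + j - x - s) = - (j - y i) by ring.
    rewrite normrN /h'.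
    have : `|j - y i| / w <= r / w by rewrite ler_pM2r ?invr_gt0// ltW// bump_gt0.
    lra.
  rewrite -mulr_sumr -[leRHS]mulr1 ler_wpM2l//.
apply: (@le_trans _ _ (\sum_i (q i * (b x (s - y i) - k * h'))%R%:E + (k * h)%:E)%E).
  rewrite sumEFin -EFinD lee_fin.
  under [in leRHS]eq_bigr do rewrite mulrBr.
  rewrite sumrB -mulr_suml.
  have : (\sum_i q i) * (k * h') <= 1 * (k * h').
    by rewrite ler_wpM2r// mulr_ge0// ltW.
  rewrite /h' mulrDr mulrA; lra.
apply: leeD2r; apply: le_trans step.
rewrite scaled_mass_sum//; last 2 first.
- by move=> i u; rewrite mulr_ge0.
- by move=> i; apply: measurable_lipschitz; exact: lipschitz_funZ.
apply: lee_sum => i _; rewrite scaled_massZ//; last exact: measurable_lipschitz.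
rewrite EFinM lee_wpmul2l ?lee_fin//.
by rewrite EFinB leeBlDr//; exact: reg_mass_le.
Qed.

End superharmonic_mass.

(** * Limits along ultrafilters *)

Section ultrafilter.
Context (R : realType).

Lemma ultra_cvg (I : Type) (U : set_system I) (f : I -> R) (a b : R) :
  UltraFilter U -> (forall x, a <= f x <= b) -> cvg (f x @[x --> U]).
Proof.
move=> UU fab.
have [] := @segment_compact _ a b (f x @[x --> U]) _.
  by apply: nearW => x /=; rewrite in_itv/=.
move=> p [_ clp]; apply/cvg_ex; exists p => V Vp.
have [//|UV] := in_ultra_setVsetC (f @^-1` V) UU.
by have [y [nVy Vy]] := clp (~` V) V UV Vp; exfalso; exact: nVy.
Qed.

Lemma cvg_ultra (I : Type) (F : set_system I) (f : I -> R) (l : R) :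
  ProperFilter F ->
  (forall U : set_system I, UltraFilter U -> F `<=` U -> f x @[x --> U] --> l) ->
  f x @[x --> F] --> l.
Proof.
move=> PF fU V Vl; apply: contrapT => nFV.
pose D := ~` (f @^-1` V).
have PD : ProperFilter (within D F).
  (* If F does not contain the preimage of V, it can be restricted to the complement; an ultrafilter
     finer than this restriction contradicts the hypothesis. *)
  split; last exact: within_filter.
  rewrite /within/= => F0; apply: nFV; apply: filterS F0 => x xD.
  by apply: contrapT => nV; exact: (xD nV).
have [U [UU DU]] := ultraFilterLemma PD.
have FU : F `<=` U by move=> A FA; apply: DU; apply: filterS FA => x Ax _.
have UV : U (f @^-1` V) by exact: (fU U UU FU V Vl).
have UD : U D by apply: DU; exact: withinT.
by have [x [Vx]] := filter_ex (filterI UV UD); apply.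
Qed.

End ultrafilter.

Section limit_superharmonic.
Context (R : realType) (d : measure_display) (Omega : measurableType d)
  (P : probability Omega R) (S : set R) (K : R.-pker R ~> R)
  (X : nat -> {RV P >-> R}) (v : R -> R) (w k : R)
  (d1 : measure_display) (T1 : measurableType d1) (P1 : probability T1 R)
  (xi : {RV P1 >-> R}).
Hypothesis chainX : markov_chain S K X.
Hypothesis ijump : forall z, S z ->
  (step_law K z).-integrable setT (EFin \o jump K z).
Hypothesis ixi : P1.-integrable setT (EFin \o xi).
Hypothesis cvg_xi : cvg_in_distribution (within S (pinfty_nbhs R)) (jump K) xi.
Hypothesis v_gt0 : forall x, 0 < v x.
Hypotheses (w0 : 0 < w) (k0 : 0 < k).
Variable U : set_system R.
Context {UU : UltraFilter U}.
Hypothesis oo_U : pinfty_nbhs R `<=` U.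

Definition limit_mass s : R := lim (reg_mass (renewal X) v w k x s @[x --> U]).

Let b_ := reg_mass (renewal X) v w k.

Lemma cvg_limit_mass s : b_ x s @[x --> U] --> limit_mass s.
Proof.
apply: (@ultra_cvg _ _ _ _ 0 k) => x.
by rewrite reg_mass_ge0// reg_mass_le_cst.
Qed.

Lemma limit_mass_bounds s : 0 <= limit_mass s <= k.
Proof.
apply/andP; split.
  apply: (limr_ge (cvg_limit_mass (s := s))); apply: nearW => x.
  exact: reg_mass_ge0.
apply: (limr_le (cvg_limit_mass (s := s))); apply: nearW => x.
exact: reg_mass_le_cst.
Qed.

Lemma lipschitz_limit_mass s t : `|limit_mass s - limit_mass t| <= k / w * `|s - t|.
Proof.
have c : `|b_ x s - b_ x t| @[x --> U] --> `|limit_mass s - limit_mass t|.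
  by apply: cvg_norm; apply: cvgB; exact: cvg_limit_mass.
rewrite -(cvg_lim _ c)//; apply: limr_le; first exact: cvgP c.
by apply: nearW => x; exact: lipschitz_reg_mass.
Qed.

(** The law of xi is discretised by tents on a grid; weak convergence transfers their means to xi(z)
    for large z, and the finite inequality passes to the limit along U. *)
Lemma limit_mass_superharmonic s :
  mean P1 xi (fun y => limit_mass (s - y)) <= limit_mass s.
Proof.
have := lipschitz_limit_mass; have := limit_mass_bounds; have := cvg_limit_mass.
move: limit_mass => b cvg_b b_bounds b_lip.
have hE := mean_lipschitz ixi.
pose L := k / w.
have L0 : 0 < L by rewrite divr_gt0.
have lb : lipschitz_fun b by exists L => x y; exact: b_lip.
apply/ler_addgt0Pr => e e0.
(* Four errors of e / 4: the tail beyond A, the weights lowered by dl, and L * r twice, once for the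
   discretisation of b and once from [reg_mass_superharmonic]. *)
have [A A0 Ae] := mean_tail hE (divr_gt0 e0 (mulr_gt0 (ltr0n R 4) k0)).
pose r := e / (4 * L).
have r0 : 0 < r by rewrite divr_gt0// mulr_gt0.
have Lr : L * r = e / 4 by rewrite /r; field; rewrite gt_eqF.
pose n := (Num.bound (2 * (A + 1) / r)).+1.
have nr : A + 1 <= - (A + 1) + n%:R * r - r.
  have : 2 * (A + 1) <= (Num.bound (2 * (A + 1) / r))%:R * r.
    rewrite -ler_pdivrMr// ltW// archi_boundP// divr_ge0 ?ltW//.
    by rewrite mulr_gt0// addr_gt0.
  rewrite /n -natr1 mulrDl; lra.
have n0 : 0 < n%:R :> R by [].
pose y (i : nat) := - (A + 1) + i%:R * r.
pose p i := mean P1 xi (bump (y i) r).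
pose dl := e / (4 * k * n%:R).
have dl0 : 0 < dl by rewrite divr_gt0// !mulr_gt0.
have ndl : n%:R * dl * k = e / 4.
  by rewrite /dl; field; rewrite (gt_eqF k0) (gt_eqF n0).
(* Lowered weights stay below the tent means of xi(z) for all large z, so the same weights serve
   every x. *)
pose q i := Num.max (p i - dl) 0.
have lbump i : lipschitz_fun (bump (y i) r) by exact: lipschitz_bump.
have bump0 i u : 0 <= bump (y i) r u by exact: bump_ge0.
have bump1 u : \sum_(i < n) bump (y i) r u <= 1 by exact: sum_bump_le1.
have p0 i : 0 <= p i by apply: (mean_ge_cst hE).
have p1 : \sum_(i < n) p i <= 1.
  rewrite /p -(mean_sum hE)//; apply: (mean_le_cst hE) => //.
  by apply: lipschitz_fun_sum => i.
have pdl i : p i - dl <= q i by rewrite le_max lexx.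
have q0 i : 0 <= q i by rewrite le_max lexx orbT.
have qp i : q i <= p i by rewrite ge_max p0 andbT; move: dl0; lra.
have q1 : \sum_(i < n) q i <= 1 by apply: le_trans p1; exact: ler_sum.
have cvg_p i : mean (step_law K z) (jump K z) (bump (y i) r)
    @[z --> within S (pinfty_nbhs R)] --> p i.
  have meanbump E : lipschitz_mean E ->
      E (bump (y i) r) = (E (ramp (y i - r) r) - E (ramp (y i) r)) / r.
    move=> hE'; have lr a := @lipschitz_ramp R a r.
    rewrite -(meanB hE')// mulrC -(meanZ hE'); last exact: lipschitz_funB.
    by congr E; apply/funext => u; rewrite mulrC.
  have FS : Filter (within S (pinfty_nbhs R)) by exact: within_filter.
  have c a : mean (step_law K z) (jump K z) (ramp a r) @[z --> within S (pinfty_nbhs R)]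
      --> mean P1 xi (ramp a r) by apply: ramp_cvg.
  rewrite /p (meanbump _ hE).
  have h : (mean (step_law K z) (jump K z) (ramp (y i - r) r) -
      mean (step_law K z) (jump K z) (ramp (y i) r)) / r @[z --> within S (pinfty_nbhs R)]
      --> (mean P1 xi (ramp (y i - r) r) - mean P1 xi (ramp (y i) r)) / r.
    by apply: cvgM; [exact: cvgB (c _) (c _)|exact: cvg_cst].
  apply: cvg_trans h.
  apply: near_eq_cvg.
  have : \forall z \near within S (pinfty_nbhs R), S z by exact: withinT.
  apply: filterS => z Sz /=.
  by rewrite (meanbump _ (mean_lipschitz (ijump Sz))).
have [z0 zP] : exists z0, forall z i, S z -> z0 <= z -> (i < n)%N ->
    q i <= mean (step_law K z) (jump K z) (bump (y i) r).
  have : \forall z \near within S (pinfty_nbhs R), forall i, (i < n)%N ->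
      p i - dl <= mean (step_law K z) (jump K z) (bump (y i) r).
    apply: near_forall_lt => i; apply: (cvgr_ge _ (cvg_p i)).
    by rewrite ltrBlDr ltrDl.
  move=> [M [_ MP]]; exists (M + 1) => z i Sz Mz i_n.
  rewrite /q ge_max (MP z _ Sz)//=; last by rewrite (lt_le_trans _ Mz)// ltrDl.
  by apply: (mean_ge_cst (mean_lipschitz (ijump Sz))).
have sup x : (forall i : 'I_n, z0 <= x + s - y i - w) ->
    \sum_(i < n) q i * b_ x (s - y i) - L * r <= b_ x s.
  move=> xz0; rewrite /L mulrAC.
  apply: (reg_mass_superharmonic chainX ijump v_gt0 w0 k0 r0 _ q1 bump1 _ xz0) => //.
  by move=> z i Sz z0z; exact: zP.
have lim_sup : \sum_(i < n) q i * b (s - y i) - L * r <= b s.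
  have c : \sum_(i < n) q i * b_ x (s - y i) - L * r @[x --> U] -->
      \sum_(i < n) q i * b (s - y i) - L * r.
    apply: cvgB; last exact: cvg_cst.
    by apply: cvg_sumr => i; apply: cvgM; [exact: cvg_cst|exact: cvg_b].
  apply: (ler_cvg_to c (cvg_b s)); apply: oo_U.
  have : \forall x \near +oo, forall i, (i < n)%N -> z0 - s + y i + w <= x.
    by apply: near_forall_lt => i; apply: nbhs_pinfty_ge; rewrite num_real.
  by apply: filterS => x xz; apply: sup => i; have := xz i (ltn_ord i); lra.
have Sb u : b (s - u) <= \sum_(i < n) bump (y i) r u * (b (s - y i) + L * r) +
    k * Num.max (`|u| - A) 0.
  have bu : 0 <= b (s - u) <= k by exact: b_bounds.
  have tail : (1 - \sum_(i < n) bump (y i) r u) * b (s - u) <=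
      k * Num.max (`|u| - A) 0.
    move: bu => /andP[bu0 buk]; move: (b (s - u)) bu0 buk => c c0 ck.
    rewrite mulrC; apply: ler_pM => //; first by rewrite subr_ge0.
    (* The grid covers |u| <= A + 1; beyond it (|u| - A)^+ is at least 1 and k times it dominates
       b. *)
    have [uA|uA] := leP `|u| (A + 1).
      rewrite sum_bump_eq1 ?subrr ?le_max ?lexx ?orbT//.
        by move: uA; rewrite ler_norml => /andP[].
      apply: le_trans nr; by move: uA; rewrite ler_norml => /andP[].
    rewrite le_max; apply/orP; left.
    have : 0 <= \sum_(i < n) bump (y i) r u by apply: sumr_ge0.
    lra.
  have : (\sum_(i < n) bump (y i) r u) * b (s - u) <=
      \sum_(i < n) bump (y i) r u * (b (s - y i) + L * r).
    rewrite mulr_suml; apply: ler_sum => i _.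
    have [b_gt0|b_le0] := ltP 0 (bump (y i) r u); last first.
      have -> : bump (y i) r u = 0 by apply/eqP; rewrite eq_le b_le0 bump0.
      by rewrite !mul0r.
    rewrite ler_pM2l//.
    have := b_lip (s - u) (s - y i).
    have -> : s - u - (s - y i) = - (u - y i) by ring.
    rewrite normrN -/L => /(le_trans (ler_norm _)).
    have : L * `|u - y i| <= L * r by rewrite ler_pM2l// ltW// bump_gt0.
    lra.
  by rewrite mulrBl mul1r in tail; lra.
apply: (@le_trans _ _ (\sum_(i < n) p i * (b (s - y i) + L * r) +
    k * mean P1 xi (fun u => Num.max (`|u| - A) 0))).
  have lmax : lipschitz_fun (fun u : R => Num.max (`|u| - A) 0) by lipschitz.
  have lsum : lipschitz_fun (fun u => \sum_(i < n) bump (y i) r u * (b (s - y i) + L * r)).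
    apply: lipschitz_fun_sum => i.
    rewrite (_ : (fun u => _) = (fun u => (b (s - y i) + L * r) * bump (y i) r u)).
      exact: lipschitz_funZ.
    by apply/funext => u; rewrite mulrC.
  rewrite -(meanZ hE)//.
  have -> : \sum_(i < n) p i * (b (s - y i) + L * r) =
      mean P1 xi (fun u => \sum_(i < n) bump (y i) r u * (b (s - y i) + L * r)).
    rewrite (mean_sum hE) => [|i].
      apply: eq_bigr => i _; rewrite mulrC -(meanZ hE)//.
      by congr mean; apply/funext => u; rewrite mulrC.
    rewrite (_ : (fun u => _) = (fun u => (b (s - y i) + L * r) * bump (y i) r u)).
      exact: lipschitz_funZ.
    by apply/funext => u; rewrite mulrC.
  rewrite -(meanD hE)//; last exact: lipschitz_funZ.
  apply: (mean_mono hE) => //.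
    by apply: (lipschitz_fun_comp lb); lipschitz.
  by apply: lipschitz_funD => //; exact: lipschitz_funZ.
have tail_le : k * mean P1 xi (fun u => Num.max (`|u| - A) 0) <= e / 4.
  have -> : e / 4 = k * (e / (4 * k)) by field; rewrite gt_eqF.
  by rewrite ler_pM2l.
have sum_le : \sum_(i < n) p i * (b (s - y i) + L * r) <=
    \sum_(i < n) q i * b (s - y i) + n%:R * dl * k + L * r.
  have : \sum_(i < n) p i * b (s - y i) <= \sum_(i < n) (q i * b (s - y i) + dl * k).
    apply: ler_sum => i _; have /andP[b0 bk] := b_bounds (s - y i).
    apply: (@le_trans _ _ ((q i + dl) * b (s - y i))).
      by rewrite ler_wpM2r//; have := pdl i; lra.
    by rewrite mulrDl lerD2l ler_wpM2l// ltW.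
  rewrite big_split/= sumr_const card_ord -[(dl * k) *+ n]mulr_natl mulrA.
  under [in X in _ -> X]eq_bigr do rewrite mulrDr.
  rewrite big_split/= -mulr_suml.
  have : (\sum_(i < n) p i) * (L * r) <= 1 * (L * r).
    by rewrite ler_wpM2r// mulr_ge0// ltW.
  lra.
lra.
Qed.

End limit_superharmonic.

(** * Periods generated by the limiting jump *)

Section charged_points.
Context (R : realType) (d : measure_display) (T : measurableType d)
  (P : probability T R) (X : {RV P >-> R}).
Hypothesis iX : P.-integrable setT (EFin \o X).

Let ball_event (q : rat * rat) := [set t | `|X t - ratr q.1| < ratr q.2].

Let measurable_ball_event q : measurable (ball_event q).
Proof.
rewrite (_ : ball_event q = X @^-1` `](ratr q.1 - ratr q.2), (ratr q.1 + ratr q.2)[%classic).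
  exact: measurable_funPTI.
by apply/seteqP; split=> t; rewrite /ball_event/= in_itv/= ltr_distl.
Qed.

Let uncharged_null a : ~ charged (mean P X) a -> exists q,
  `|a - ratr q.1| < ratr q.2 /\ P (ball_event q) = 0%E.
Proof.
move=> /existsNP[r /not_implyP[r0 /negP]]; rewrite -leNgt => r_null.
have r4 : 0 < r / 4 by rewrite divr_gt0.
have [q1] : exists q : rat, ratr q \in `](a - r / 4), (a + r / 4)[.
  by apply: rat_in_itvoo; move: r4; lra.
have [q2] : exists q : rat, ratr q \in `](r / 4), (r / 2)[.
  by apply: rat_in_itvoo; move: r4; lra.
rewrite !in_itv/= => /andP[q2l q2u] /andP[q1l q1u].
have aq : `|a - ratr q1| < r / 4 by rewrite ltr_norml; lra.
(* Points of this ball are within 3 * r / 4 of a, so the null tent at a is at least r / 4 on it. *)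
exists (q1, q2); split=> /=; first exact: lt_trans q2l.
have lr : lipschitz_fun (fun y => Num.max (r - `|y - a|) 0) by lipschitz.
have mB := measurable_ball_event (q1, q2).
have iB : P.-integrable setT (EFin \o (\1_(ball_event (q1, q2)) : T -> R)).
  by apply: integrable_indic => //; rewrite setIT.
have le1 : \int[P]_w (r / 4 * \1_(ball_event (q1, q2)) w) <=
    mean P X (fun y => Num.max (r - `|y - a|) 0).
  apply: le_Rintegral => //.
  - by apply: (@integrableZl _ _ _ _ _ measurableT (r / 4) _ iB).
  - exact: (integrable_lipschitz iX lr).
  move=> t _; rewrite indicE; case: (boolP (t \in _)); rewrite ?mulr0 ?mulr1.
    rewrite inE /ball_event/= => tB; rewrite le_max; apply/orP; left.
    have := ler_normD (X t - ratr q1) (ratr q1 - a).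
    rewrite addrA subrK distrC (distrC _ a); lra.
  by rewrite le_max lexx orbT.
have PB : (fine (P (ball_event (q1, q2))))%:E = P (ball_event (q1, q2)).
  by rewrite fineK// fin_num_measure.
move: le1; rewrite RintegralZl// /Rintegral integral_indic// setIT => le1.
rewrite -PB; congr EFin; apply/eqP; rewrite eq_le fine_ge0// andbT.
by rewrite -(pmulr_rle0 _ r4); exact: le_trans r_null.
Qed.

(** The complement of the support is covered by countably many null balls with rational centre and
    radius. *)
Lemma charged_concentrated (G : set R) : measurable G ->
  charged (mean P X) `<=` G -> P (X @^-1` G) = 1%E.
Proof.
move=> mG chG; have mXG : measurable (X @^-1` G) by exact: measurable_funPTI.
suff nG : P (~` (X @^-1` G)) = 0%E.
  by have := probability_setC P (measurableC mXG); rewrite setCK nG sube0.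
apply: measure_negligible; first exact: measurableC.
pose N n : set T := if unpickle n is Some q then
  (if P (ball_event q) == 0%E then ball_event q else set0) else set0.
apply: (@negligibleS _ _ _ _ (\bigcup_n N n)); last first.
  apply: negligible_bigcup => n; rewrite /N; case: (unpickle n) => [q|]; last exact: negligible_set0.
  case: eqP => [P0|_]; last exact: negligible_set0.
  by apply/negligibleP.
move=> t /= nGt; have [q [tq q0]] := uncharged_null (fun h => nGt (chG _ h)).
exists (pickle q); first exact: I.
by rewrite /N pickleK q0 eqxx.
Qed.

Lemma concentrated_sub (A B : set R) : measurable A -> measurable B -> A `<=` B ->
  concentrated_on X A -> concentrated_on X B.
Proof.
move=> mA mB AB XA; have mX C : measurable C -> measurable (X @^-1` C).
  by move=> mC; exact: measurable_funPTI.
apply/eqP; rewrite eq_le probability_le1/=; last exact: mX.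
rewrite -XA; apply: le_measure; rewrite ?inE; [exact: mX|exact: mX|].
by move=> t; exact: AB.
Qed.

End charged_points.

Section generated_period.
Context (R : realType) (d : measure_display) (T : measurableType d)
  (P : probability T R) (X : {RV P >-> R}).
Hypothesis iX : P.-integrable setT (EFin \o X).
Variable G : set R.
Hypothesis G0 : G 0.
Hypothesis GB : forall x y, G x -> G y -> G (x - y).
Hypothesis Gc : closed G.
Hypothesis chG : charged (mean P X) `<=` G.

Let XG : concentrated_on X G.
Proof. by apply: charged_concentrated => //; exact: closed_measurable. Qed.

Let X_lattice (h : R) : measurable (lattice h) -> G `<=` [set 0] ->
  concentrated_on X (lattice h).
Proof.
move=> mh G00; apply: (concentrated_sub _ _ _ XG) => //.
  exact: closed_measurable.
by move=> x /G00 ->; exists 0 => //; rewrite mul0r.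
Qed.

Lemma measurable_lattice (h : R) : measurable (lattice h).
Proof.
rewrite (_ : lattice h = \bigcup_n
    (if unpickle n is Some k then [set (k : int)%:~R * h] else set0)).
  by apply: bigcupT_measurable => n; case: (unpickle n) => // k; exact: measurable_set1.
apply/seteqP; split=> [x [k _ <-]|x [n _]].
  exists (pickle k); first exact: I.
  by rewrite pickleK.
by case: (unpickle n) => // k /= ->; exists k.
Qed.

Lemma non_lattice_generated : non_lattice X -> forall w, G w.
Proof.
move=> nl w; have [->//|G00|[h h0 Gh]] := closed_subgroup G0 GB Gc.
  by exfalso; apply: nl; exists 1 => //; apply: X_lattice => //; exact: measurable_lattice.
by exfalso; apply: nl; exists h => //; rewrite -Gh.
Qed.

Lemma minimal_lattice_generated h : minimal_lattice X h -> G h.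
Proof.
move=> [h0 _ hmin]; have lh : lattice h h by exists 1 => //; rewrite mul1r.
have [->//|G00|[h' h'0 Gh]] := closed_subgroup G0 GB Gc; last first.
  by rewrite Gh; apply: hmin lh => //; rewrite -Gh.
(* If xi were 0 almost surely, it would be concentrated on the lattice of 2 * h, which does not
   contain h. *)
have h2 : 0 < 2 * h by rewrite mulr_gt0.
have [|k _] := hmin _ h2 _ h lh.
  by apply: X_lattice => //; exact: measurable_lattice.
rewrite mulrA -[RHS]mul1r => /(mulIf (lt0r_neq0 h0)).
have -> : k%:~R * 2 = (k * 2)%:~R :> R by rewrite intrM.
move=> /(@intr_inj R (k * 2) 1) k2.
have : (2 %| k * 2)%Z by exact: dvdz_mull.
by rewrite k2.
Qed.

End generated_period.

(** * The local limit *)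

Lemma cvge_distP (R : realType) (I : Type) (F : set_system I) {FF : Filter F}
    (f : I -> \bar R) (l : R) :
  (f i @[i --> F] --> l%:E) <->
  forall e, 0 < e -> \forall i \near F, ((l - e)%:E <= f i <= (l + e)%:E)%E.
Proof.
split=> [/fine_cvgP[fin /cvgrPdist_le cl] e e0|close].
  apply: filterS2 fin (cl _ e0) => i fi; rewrite ler_distlC => h.
  by rewrite -(fineK fi) !lee_fin.
apply/fine_cvgP; split.
  apply: filterS (close 1 ltr01) => i /andP[l1 l2].
  rewrite fin_numElt (lt_le_trans _ l1) ?ltNyr//=.
  by rewrite (le_lt_trans l2)// ltry.
apply/cvgrPdist_le => e e0; apply: filterS (close e e0) => i /=.
by case: (f i) => [r| |]//=; rewrite ?leye_eq ?andbF// !lee_fin ler_distlC.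
Qed.

Section local_limit.
Context (R : realType)
    (d : measure_display) (Omega : measurableType d) (P : probability Omega R)
    (S : set R) (K : R.-pker R ~> R) (X : nat -> {RV P >-> R})
    (d1 : measure_display) (T1 : measurableType d1) (P1 : probability T1 R)
    (xi : {RV P1 >-> R})
    (d2 : measure_display) (T2 : measurableType d2) (P2 : probability T2 R)
    (Xi : {RV P2 >-> R}) (v t_ : R -> R) (C_H : R).
Hypothesis chainX : markov_chain S K X.
Hypothesis limsupX : {ae P, forall w, limn_esup (fun n => (X n w)%:E) = +oo%E}.
Hypothesis cvg_xi :
  cvg_in_distribution (within S (pinfty_nbhs R)) (jump K) xi.
Hypothesis Xi_mean : ('E_P2[Xi] < +oo)%E.
Hypothesis xi_le_Xi : forall x, S x ->
  st_le (step_law K x) (fun y => `|jump K x y|) P2 Xi.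
Hypothesis v_gt0 : forall x, 0 < v x.
Hypothesis t_oo : increases_to_infinity t_.
Hypothesis local_H : forall t : R -> R, increases_to_infinity t ->
  (forall x, t x <= t_ x) ->
  ((v x)%:E * renewal X `]x, (x + t x)%R]%classic / (t x)%:E)%E
    @[x --> +oo] --> C_H%:E.

Let S_unbounded := state_unbounded chainX limsupX.
Let iXi := Xi_integrable S_unbounded Xi_mean xi_le_Xi.
Let ijump := jump_integrable S_unbounded Xi_mean xi_le_Xi.
Let ixi := xi_integrable S_unbounded cvg_xi Xi_mean xi_le_Xi.

(** A negative mean makes [H] infinite on all far intervals of some fixed length Y, whereas windows
    of length Y + 1 far out have finite mass. *)
Lemma limit_mean_ge0 : 0 <= mean P1 xi id.
Proof.
rewrite leNgt; apply/negP => m0.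
have [A [g [x0 [A0 g0 drift]]]] := negative_drift S_unbounded cvg_xi Xi_mean xi_le_Xi m0.
have [Y Y0 infY] := negative_drift_renewal_infinite chainX limsupX iXi ijump
  (fun z t Sz => rtail_jump_le xi_le_Xi t Sz) A0 g0 drift.
have := window_lty v_gt0 t_oo local_H (Y + 1).
have xx0 : \forall x \near +oo, x0 <= x by apply: nbhs_pinfty_ge; rewrite num_real.
move=> /(filterI xx0)/filter_ex[x [x0x]].
apply/negP; rewrite -leNgt -(infY (x + 1)); last by rewrite (le_trans x0x)// lerDl.
rewrite -renewalE; apply: le_measure; rewrite ?inE// => y.
rewrite /= !in_itv/= => /andP[h1 h2]; apply/andP; split; lra.
Qed.

Variable w : R.
Hypothesis w0 : 0 < w.
Hypothesis w_generated : forall G : set R, G 0 ->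
  (forall x y, G x -> G y -> G (x - y)) -> closed G ->
  charged (mean P1 xi) `<=` G -> G w.

Let mass := scaled_mass (renewal X) v.

Lemma measurable_bump s r : measurable_fun setT (bump s r : R -> R).
Proof. by apply: measurable_lipschitz; exact: lipschitz_bump. Qed.

Lemma mass_sum_bump_le x t m : (\sum_(j < m) mass x (bump (t + j%:R * w) w) <=
  (v x)%:E * renewal X `](x + (t - w))%R, (x + (t + m%:R * w))%R]%classic)%E.
Proof.
rewrite -scaled_mass_indic// /mass -scaled_mass_sum//; last 2 first.
- by move=> i u; exact: bump_ge0.
- by move=> i; exact: measurable_bump.
apply: le_scaled_mass => //.
- by move=> u; apply: sumr_ge0 => i _; exact: bump_ge0.
- move=> u; rewrite indicE; case: (boolP (u \in _)) => [_|]; first exact: sum_bump_le1.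
  rewrite notin_setE/= in_itv/= => /negP; rewrite negb_and -leNgt -ltNge => h.
  by rewrite sum_bump_eq0//; case/orP: h => [->//|/ltW ->]; rewrite orbT.
- by apply: measurable_lipschitz; apply: lipschitz_fun_sum => i; exact: lipschitz_bump.
Qed.

Lemma mass_sum_bump_ge x t m :
  ((v x)%:E * renewal X `](x + t)%R, (x + (t + m%:R * w - w))%R]%classic <=
  \sum_(j < m) mass x (bump (t + j%:R * w) w))%E.
Proof.
rewrite -scaled_mass_indic// /mass -scaled_mass_sum//; last 2 first.
- by move=> i u; exact: bump_ge0.
- by move=> i; exact: measurable_bump.
apply: le_scaled_mass => //.
- move=> u; rewrite indicE; case: (boolP (u \in _)) => [|_]; last first.
    by apply: sumr_ge0 => i _; exact: bump_ge0.
  rewrite inE/= in_itv/= => /andP[h1 h2].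
  by rewrite sum_bump_eq1// ltW.
- by apply: measurable_lipschitz; apply: lipschitz_fun_sum => i; exact: lipschitz_bump.
Qed.

Let b_ k x s := reg_mass (renewal X) v w k x s.

Let reg_mass_to_limit k s l : 0 < k ->
  (forall U : set_system R, UltraFilter U -> pinfty_nbhs R `<=` U ->
    limit_mass X v w k U s = l) ->
  b_ k x s @[x --> +oo] --> l.
Proof.
move=> k0 Ul; apply: cvg_ultra => U UU oo_U; rewrite -(Ul U UU oo_U).
exact: cvg_limit_mass.
Qed.

Lemma bump_mass_cvg_pos s : 0 < C_H ->
  mass x (bump s w) @[x --> +oo] --> (C_H * w)%:E.
Proof.
move=> C0.
have [T0 T00 T0P] := window_shift v_gt0 t_oo local_H C0 ltr01.
pose T := Num.max T0 (2 * w).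
have TT0 : T0 <= T by rewrite le_max lexx.
have Tw : 2 * w <= T by rewrite le_max lexx orbT.
(* Dominates the scaled mass of a window of length T >= 2 * w, hence of the support of a tent: the
   truncation is eventually inactive. *)
pose k := (C_H + 1) * T.
have k0 : 0 < k by rewrite mulr_gt0 ?addr_gt0// (lt_le_trans T00).
have mass_reg u : \forall x \near +oo, mass x (bump u w) = (b_ k x u)%:E.
  apply: filterS (T0P T (u - w) TT0) => x [fin /andP[_ le_k]].
  apply: reg_massE_le => //; rewrite scaled_mass_indic//.
  apply: (@le_trans _ _ ((v x)%:E * renewal X `](x + (u - w))%R, (x + (u - w) + T)%R]%classic)%E).
    rewrite lee_pmul2l ?lte_fin//; apply: le_measure; rewrite ?inE// => y.
    rewrite /= !in_itv/= => /andP[-> h]; apply: le_trans h _.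
    by move: Tw; lra.
  by rewrite -(fineK fin) lee_fin.
have mass_cvg : b_ k x s @[x --> +oo] --> C_H * w.
  apply: reg_mass_to_limit => // U UU oo_U.
  set b := limit_mass X v w k U.
  have cvg_b u : b_ k x u @[x --> U] --> b u by exact: cvg_limit_mass.
  have avg e : 0 < e -> exists m0, forall m, (m0 <= m)%N -> forall t,
      `|\sum_(j < m) b (t + j%:R * w) - C_H * w * m%:R| <= e * m%:R.
    (* The sum of m tents lies between windows of lengths m * w - w and m * w + w. The window error
       takes e * m / 2, and the two boundary pieces the other half once m is large. *)
    move=> e0; pose e' := e / (2 * w).
    have e'0 : 0 < e' by rewrite divr_gt0// mulr_gt0.
    have e'w : e' * w = e / 2 by rewrite /e'; field; rewrite gt_eqF.
    have [T1' T10 T1P] := window_shift v_gt0 t_oo local_H C0 e'0.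
    pose m0 := Num.bound (T1' / w + (C_H + e') * w / (e / 2) + 1).
    have a0 : 0 <= T1' / w by rewrite divr_ge0 ?ltW.
    have a1 : 0 <= (C_H + e') * w / (e / 2).
      by rewrite divr_ge0 ?(ltW (divr_gt0 e0 (ltr0n R 2)))// mulr_ge0 ?(ltW w0)// addr_ge0// ltW.
    exists m0 => m m0m t.
    have mm : T1' / w + (C_H + e') * w / (e / 2) + 1 <= m%:R.
      apply: (@le_trans _ _ m0%:R); last by rewrite ler_nat.
      by rewrite ltW// archi_boundP// !addr_ge0.
    have mT : T1' <= m%:R * w - w.
      have : (T1' / w + 1) * w <= m%:R * w by rewrite ler_pM2r//; lra.
      by rewrite mulrDl divfK ?gt_eqF// mul1r; lra.
    have me : (C_H + e') * w <= e / 2 * m%:R.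
      have e20 : 0 < e / 2 by rewrite divr_gt0.
      rewrite -ler_pdivrMl// mulrC; lra.
    have c : \sum_(j < m) b_ k x (t + j%:R * w) @[x --> U] -->
        \sum_(j < m) b (t + j%:R * w) by apply: cvg_sumr => j; exact: cvg_b.
    have near_sum : \forall x \near U,
        (C_H - e') * (m%:R * w - w) <= \sum_(j < m) b_ k x (t + j%:R * w) <=
        (C_H + e') * (m%:R * w + w).
      apply: oo_U.
      have n1 : \forall x \near +oo, forall j, (j < m)%N ->
          mass x (bump (t + j%:R * w) w) = (b_ k x (t + j%:R * w))%:E.
        by apply: near_forall_lt => j; exact: mass_reg.
      have n2 := T1P (m%:R * w - w) t mT.
      have n3 := T1P (m%:R * w + w) (t - w).
      have {}n3 := n3 (le_trans mT _).
      apply: filterS3 n1 n2 (n3 _) => [x|]; last by move: w0; lra.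
      move=> massE [f1 /andP[l1 _]] [f2 /andP[_ u2]].
      have le1 := mass_sum_bump_le x t m; have le2 := mass_sum_bump_ge x t m.
      move: le1 le2.
      under eq_bigr => j _ do rewrite massE//.
      rewrite sumEFin => le1 le2.
      rewrite -!lee_fin; apply/andP; split.
        apply: le_trans le2.
        have -> : x + (t + m%:R * w - w) = x + t + (m%:R * w - w) by ring.
        by rewrite -(fineK f1) -EFinM lee_fin.
      apply: le_trans le1 _.
      have -> : x + (t + m%:R * w) = x + (t - w) + (m%:R * w + w) by ring.
      by rewrite -(fineK f2) -EFinM lee_fin.
    have lo : (C_H - e') * (m%:R * w - w) <= \sum_(j < m) b (t + j%:R * w).
      by apply: (cvgr_to_ge c); apply: filterS near_sum => x /andP[].
    have hi : \sum_(j < m) b (t + j%:R * w) <= (C_H + e') * (m%:R * w + w).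
      by apply: (cvgr_to_le c); apply: filterS near_sum => x /andP[].
    rewrite ler_norml; apply/andP; split; nra.
  have super u : mean P1 xi (fun y => b (u - y)) <= b u.
    exact: (limit_mass_superharmonic chainX ijump ixi cvg_xi v_gt0 w0 k0 oo_U).
  have per := uniform_average_periodic (mean_lipschitz ixi) w0
    (limit_mass_bounds X v_gt0 w0 k0 (U := U)) (lipschitz_limit_mass X v_gt0 w0 k0 (U := U))
    super w_generated avg.
  have {}per u : b (u + w) = b u by exact: per.
  have perM m : b (s + m%:R * w) = b s.
    elim: m => [|m IH]; first by rewrite mul0r addr0.
    by rewrite -natr1 mulrDl mul1r addrA per.
  apply/eqP; rewrite -subr_eq0 -normr_le0; apply/ler_addgt0Pr => e e0; rewrite add0r.
  have [m0 /(_ m0.+1 (leqnSn _) s)] := avg e e0.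
  under eq_bigr do rewrite perM.
  rewrite sumr_const card_ord -[b s *+ _]mulr_natr -mulrBl normrM (ger0_norm (ler0n _ _)).
  by rewrite ler_pM2r.
apply/cvge_distP => e e0.
move/cvgrPdist_le: mass_cvg => /(_ e e0); apply: filterS2 (mass_reg s) => x -> /=.
by rewrite !lee_fin ler_distlC.
Qed.

Lemma bump_mass_cvg_zero s : C_H = 0 -> mass x (bump s (w / 4)) @[x --> +oo] --> 0%E.
Proof.
move=> C0.
have reg_cvg : b_ 1 x s @[x --> +oo] --> 0.
  apply: reg_mass_to_limit => // U UU oo_U.
  set b := limit_mass X v w 1 U.
  have cvg_b u : b_ 1 x u @[x --> U] --> b u by exact: cvg_limit_mass.
  have avg u e : w <= u -> 0 < e -> exists m0, forall m, (m0 <= m)%N ->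
      forall t, 0 <= t <= w -> \sum_(j < m) b (u + t + j%:R * w) <= e * m%:R.
    move=> wu e0; pose e' := e / (u + 2 * w).
    have uw : 0 < u + 2 * w by move: w0 wu; lra.
    have e'0 : 0 < e' by rewrite divr_gt0.
    have [T0 T00 T0P] := window_fine v_gt0 t_oo local_H e'0.
    have a0 : 0 <= T0 / w by rewrite divr_ge0 ?ltW.
    exists (Num.bound (T0 / w)).+1 => m m0m t /andP[t0 tw].
    have mm : T0 / w + 1 <= m%:R.
      apply: (@le_trans _ _ (Num.bound (T0 / w)).+1%:R); last by rewrite ler_nat.
      by rewrite -natr1 lerD2r ltW// archi_boundP.
    have m1 : 1 <= m%:R :> R by apply: le_trans mm; rewrite lerDr.
    (* The window (x, x + T] contains the supports of all m tents: w <= u keeps them to the right of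
       x, and t <= w below x + T. *)
    pose T := u + w + m%:R * w.
    have TT : T0 <= T.
      have : T0 / w * w <= m%:R * w by rewrite ler_pM2r//; lra.
      by rewrite divfK ?gt_eqF// /T; move: w0 wu; lra.
    have Tm : T <= (u + 2 * w) * m%:R.
      have : (u + w) * 1 <= (u + w) * m%:R by rewrite ler_pM2l//; move: w0 wu; lra.
      by rewrite /T; move: w0; lra.
    have e'T : e' * T <= e * m%:R.
      have -> : e * m%:R = e' * ((u + 2 * w) * m%:R).
        by rewrite /e'; field; rewrite gt_eqF.
      by rewrite ler_pM2l.
    have c : \sum_(j < m) b_ 1 x (u + t + j%:R * w) @[x --> U] -->
        \sum_(j < m) b (u + t + j%:R * w) by apply: cvg_sumr => j; exact: cvg_b.
    apply: (cvgr_to_le c); apply: oo_U; apply: filterS (T0P T TT) => x [fin /andP[_ hi]].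
    rewrite C0 add0r in hi; apply: le_trans e'T; apply: le_trans hi.
    rewrite -lee_fin -sumEFin.
    apply: (@le_trans _ _ (\sum_(j < m) mass x (bump (u + t + j%:R * w) w))%E).
      by apply: lee_sum => j _; exact: reg_mass_le_scaled_mass.
    apply: le_trans (mass_sum_bump_le _ _ _) _.
    rewrite EFinM fineK// lee_pmul2l ?lte_fin//; apply: le_measure; rewrite ?inE// => y.
    rewrite /= !in_itv/= => /andP[h1 h2]; rewrite /T; apply/andP; split; lra.
  have super u : mean P1 xi (fun y => b (u - y)) <= b u.
    exact: (limit_mass_superharmonic chainX ijump ixi cvg_xi v_gt0 w0 ltr01 oo_U).
  have b_bounds u : 0 <= b u <= 1 by exact: limit_mass_bounds.
  have per := right_average_null_periodic (mean_lipschitz ixi) w0 b_bounds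
    (lipschitz_limit_mass X v_gt0 w0 ltr01 (U := U)) super w_generated limit_mean_ge0 avg.
  have {}per u : b (u + w) = b u by exact: per.
  have perM u m : b (u + m%:R * w) = b u.
    elim: m => [|m IH]; first by rewrite mul0r addr0.
    by rewrite -natr1 mulrDl mul1r addrA per.
  (* Averages are controlled only from w on; periodicity carries s there. *)
  have [N wN] : exists N : nat, w <= s + N%:R * w.
    exists (Num.bound (`|s| / w)).+1.
    have : `|s| <= (Num.bound (`|s| / w))%:R * w.
      by rewrite -ler_pdivrMr// ltW// archi_boundP// divr_ge0// ltW.
    by have := ler_norm (- s); rewrite normrN -natr1 mulrDl mul1r; lra.
  apply/eqP; rewrite eq_le; have /andP[-> _] := b_bounds s; rewrite andbT.
  apply/ler_addgt0Pr => e e0; rewrite add0r.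
  have [m0 /(_ m0.+1 (leqnSn _) 0)] := avg _ e wN e0.
  rewrite lexx ltW// => /(_ isT).
  under eq_bigr do rewrite addr0 !perM.
  by rewrite sumr_const card_ord -[b s *+ _]mulr_natr ler_pM2r.
(* On the support of the narrow tent the wide one is at least 3/4, so removing h <= 1/4 leaves at
   least 1/2. *)
have bump_le u h : 0 <= h <= 4^-1 -> bump s (w / 4) u <= 2 * Num.max (bump s w u - h) 0.
  move=> /andP[h0 h4]; have w4 : 0 < w / 4 by rewrite divr_gt0.
  have [bu|bu] := ltP 0 (bump s (w / 4) u); last first.
    by rewrite (le_trans bu)// mulr_ge0// le_max lexx orbT.
  apply: le_trans (bump_le1 w4 _ _) _.
  have : 1 - `|u - s| / w - h <= Num.max (bump s w u - h) 0.
    by rewrite (bumpE w0) le_max lerD2r le_max lexx.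
  have : `|u - s| / w <= 4^-1.
    by rewrite ler_pdivrMr// mulrC; apply: ltW; exact: bump_gt0.
  lra.
apply/cvge_distP => e e0.
pose h := Num.min 4^-1 (e / 2).
have h0 : 0 < h by rewrite lt_min divr_gt0// invr_gt0 ltr0n.
move/cvgrPdist_lt: reg_cvg => /(_ h h0); apply: filterS => x.
rewrite sub0r normrN ger0_norm; last exact: reg_mass_ge0.
move=> /(reg_mass_near v_gt0 w0 ltr01)[h' h'0 lt_h]; rewrite sub0r add0r; apply/andP; split.
  rewrite (@le_trans _ _ 0%E)//; first by rewrite lee_fin oppr_le0 ltW.
  by apply: scaled_mass_ge0 => // u; apply: bump_ge0; rewrite divr_gt0.
have mexc : measurable_fun setT (fun u => Num.max (bump s w u - h') 0).
  apply: measurable_lipschitz; apply: lipschitz_fun_max; last exact: lipschitz_fun_cst.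
  by apply: lipschitz_funB; [exact: lipschitz_bump|exact: lipschitz_fun_cst].
have h'h : h' <= h.
  rewrite -lee_fin; apply: le_trans (ltW lt_h); rewrite mul1r leeDr//.
  by apply: scaled_mass_ge0 => // u; rewrite le_max lexx orbT.
apply: (@le_trans _ _ (mass x (fun u => 2 * Num.max (bump s w u - h') 0))).
  apply: le_scaled_mass => //.
  - by move=> u; apply: bump_ge0; rewrite divr_gt0.
  - by move=> u; apply: bump_le; rewrite h'0 (le_trans h'h)// ge_min lexx.
  - exact: measurable_bump.
  - exact: measurable_funM.
rewrite /mass scaled_massZ//; last by move=> u; rewrite le_max lexx orbT.
apply: (@le_trans _ _ (2%:E * h%:E)%E).
  rewrite lee_pmul2l ?lte_fin//; apply: le_trans (ltW lt_h).
  by rewrite mul1r leeDl// lee_fin.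
by rewrite -EFinM lee_fin mulrC -ler_pdivlMr// ge_min lexx orbT.
Qed.

End local_limit.

(** * From tents to intervals and integer points *)

Section bump_limits.
Context (R : realType) (d : measure_display) (Omega : measurableType d)
  (P : probability Omega R) (X : nat -> {RV P >-> R}) (v : R -> R) (c : R).
Hypothesis v_gt0 : forall x, 0 < v x.
Hypothesis c0 : 0 <= c.

Let mass := scaled_mass (renewal X) v.

Lemma interval_mass_cvg :
  (forall s r, 0 < r -> mass x (bump s r) @[x --> +oo] --> (c * r)%:E) ->
  forall h, 0 < h ->
  ((v x)%:E * renewal_measure X `]x, (x + h)%R])%E @[x --> +oo] --> (c * h)%:E.
Proof.
move=> bump_cvg h h0; apply/cvge_distP => e e0.
(* The interval of length h = (N + 1) * r is squeezed between sums of N and of N + 2 tents. Either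
   sum is off by one tent mass c * r <= e / 2, plus at most e / 2 from convergence of the tents. *)
pose N := Num.bound (c * h / (e / 2)).
have N0 : 0 < N.+1%:R :> R by [].
pose r := h / N.+1%:R.
have r0 : 0 < r by rewrite divr_gt0.
have rN : N.+1%:R * r = h by rewrite /r mulrC divfK// gt_eqF.
have cr : c * r <= e / 2.
  rewrite /r mulrA ler_pdivrMr// -ler_pdivrMl ?divr_gt0// mulrC.
  apply: ltW; apply: (@lt_trans _ _ N%:R); last by rewrite ltr_nat.
  apply: archi_boundP; apply: divr_ge0; last by rewrite ltW// divr_gt0.
  by rewrite mulr_ge0// ltW.
pose dl := e / (2 * N.+2%:R).
have dl0 : 0 < dl by rewrite divr_gt0.
have dlN : N.+2%:R * dl = e / 2 by rewrite /dl; field; rewrite gt_eqF.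
have near_bump (s : nat -> R) m : \forall x \near +oo, forall j, (j < m)%N ->
    ((c * r - dl)%:E <= mass x (bump (s j) r) <= (c * r + dl)%:E)%E.
  apply: near_forall_lt => j; have /cvge_distP := bump_cvg (s j) _ r0.
  exact.
have up := near_bump (fun j => 0 + j%:R * r) N.+2.
have lo := near_bump (fun j => r + j%:R * r) N.
apply: filterS2 up lo => x up lo; rewrite -renewalE; apply/andP; split.
  have := mass_sum_bump_le X v_gt0 r0 x r N.
  have -> : x + (r - r) = x by ring.
  have -> : x + (r + N%:R * r) = x + h by rewrite -rN -natr1; ring.
  apply: le_trans.
  apply: (@le_trans _ _ (\sum_(j < N) (c * r - dl)%:E)%E); last first.
    by apply: lee_sum => j _; have /andP[] := lo j (ltn_ord j).
  rewrite sumEFin lee_fin sumr_const card_ord -[_ *+ N]mulr_natr.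
  have : N.+2%:R * dl = N%:R * dl + 2 * dl by rewrite -addn2 natrD mulrDl.
  have : N.+1%:R * (c * r) = c * h by rewrite -rN; ring.
  rewrite -natr1 mulrDl mul1r dlN; move: dl0; lra.
have := mass_sum_bump_ge X v_gt0 r0 x 0 N.+2.
have -> : x + 0 = x by ring.
have -> : x + (0 + N.+2%:R * r - r) = x + h by rewrite -rN -natr1; ring.
move=> /le_trans; apply.
apply: (@le_trans _ _ (\sum_(j < N.+2) (c * r + dl)%:E)%E).
  by apply: lee_sum => j _; have /andP[] := up j (ltn_ord j).
rewrite sumEFin lee_fin sumr_const card_ord -[_ *+ _]mulr_natl mulrDr dlN.
have : N.+1%:R * (c * r) = c * h by rewrite -rN; ring.
rewrite -natr1 mulrDl mul1r; lra.
Qed.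

(** A tent of half-width at most 1 centred at k vanishes at every other integer and equals 1 at
    k. *)
Lemma integer_bump_mass r k : (forall n w, X n w \is a Num.int) -> 0 < r <= 1 ->
  mass k%:R (bump 0 r) = ((v k%:R)%:E * renewal_measure X [set k%:R])%E.
Proof.
move=> Xint /andP[r0 r1]; rewrite /mass /scaled_mass; congr (_ * _)%E.
have mb : measurable_fun setT (fun z : R => (bump 0 r (z - k%:R))%:E).
  apply/measurable_EFinP; apply: measurable_lipschitz.
  by apply: (lipschitz_fun_comp (lipschitz_bump 0 r)); lipschitz.
rewrite integral_renewal//; last by move=> y; rewrite lee_fin bump_ge0.
apply: eq_eseriesr => n _.
have mX : measurable (X n @^-1` [set k%:R]) by exact: measurable_funPTI.
transitivity (\int[P]_w (\1_(X n @^-1` [set k%:R]) w)%:E)%E; last first.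
  by rewrite integral_indic// setIT.
apply: eq_integral => w _; congr EFin; rewrite (bumpE r0) subr0 indicE.
have [Xk|Xk] := eqVneq (X n w) k%:R.
  by rewrite mem_set//= Xk subrr normr0 mul0r subr0 max_l.
rewrite memNset/=; last by move=> /= E; rewrite E eqxx in Xk.
rewrite max_r// subr_le0 ler_pdivlMr// mul1r (le_trans r1)//.
apply: norm_intr_ge1; last by rewrite subr_eq0.
by rewrite rpredB// natr_int.
Qed.

End bump_limits.

Local Open Scope ereal_scope.

Theorem theorem4 (R : realType)
    (d : measure_display) (Omega : measurableType d) (P : probability Omega R)
    (S : set R) (mS : measurable S)
    (K : R.-pker R ~> R)
    (X : nat -> {RV P >-> R})
    (chainX : markov_chain S K X)
    (limsupX : {ae P, forall w, limn_esup (fun n => (X n w)%:E) = +oo})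
    (d1 : measure_display) (T1 : measurableType d1) (P1 : probability T1 R)
    (xi : {RV P1 >-> R})
    (cvg_xi : cvg_in_distribution (within S (pinfty_nbhs R)) (jump K) xi)
    (d2 : measure_display) (T2 : measurableType d2) (P2 : probability T2 R)
    (Xi : {RV P2 >-> R})
    (Xi_mean : 'E_P2[Xi] < +oo)
    (xi_le_Xi : forall x, S x ->
       st_le (step_law K x) (fun y => `|jump K x y|%R) P2 Xi)
    (v : R -> R) (v_gt0 : forall x, (0 < v x)%R) (v_bounded : bounded_fun v)
    (t_ : R -> R) (t_oo : increases_to_infinity t_)
    (C_H : R)
    (local_H : forall t : R -> R, increases_to_infinity t ->
       (forall x, (t x <= t_ x)%R) ->
       (v x)%:E * renewal_measure X `]x, (x + t x)%R] / (t x)%:E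
         @[x --> +oo%R] --> C_H%:E) :
  (non_lattice xi ->
     forall h : R, (0 < h)%R ->
       (v x)%:E * renewal_measure X `]x, (x + h)%R]
         @[x --> +oo%R] --> (C_H * h)%:E)
  /\
  ((forall n w, X n w \is a Num.int) -> minimal_lattice xi 1%R ->
     (v k%:R)%:E * renewal_measure X [set k%:R%R] @[k --> \oo] --> C_H%:E).
Proof.
have S_unbounded := state_unbounded chainX limsupX.
have ixi := xi_integrable S_unbounded cvg_xi Xi_mean xi_le_Xi.
have C0 : (0 <= C_H)%R by exact: (local_H_ge0 (H := renewal X) v_gt0 t_oo local_H).
have cvg_pos w := bump_mass_cvg_pos chainX limsupX cvg_xi Xi_mean xi_le_Xi v_gt0 t_oo
  local_H (w := w).
have cvg_zero w := bump_mass_cvg_zero chainX limsupX cvg_xi Xi_mean xi_le_Xi v_gt0 t_oo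
  local_H (w := w).
split=> [nl|Xint ml].
  apply: (interval_mass_cvg v_gt0 C0) => s r r0.
  have gen w (G : set R) (G0 : G 0%R) (GB : forall x y, G x -> G y -> G (x - y)%R)
      (Gc : closed G) (chG : charged (mean P1 xi) `<=` G) : G w.
    exact: (non_lattice_generated ixi G0 GB Gc chG nl).
  have [C_gt0|] := ltP 0%R C_H; first exact: cvg_pos (gen r) s C_gt0.
  move=> C_le0; have C_eq0 : C_H = 0%R by apply/eqP; rewrite eq_le C_le0 C0.
  (* For C_H = 0 a period w yields tents of half-width w / 4; in the non-lattice case any period is
     allowed, so 4 * r is taken. *)
  have r4 : (0 < 4 * r)%R by rewrite mulr_gt0.
  rewrite C_eq0 mul0r; have := cvg_zero _ r4 (gen _) s C_eq0.
  have -> // : (4 * r / 4 = r)%R by field.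
have gen (G : set R) (G0 : G 0%R) (GB : forall x y, G x -> G y -> G (x - y)%R)
    (Gc : closed G) (chG : charged (mean P1 xi) `<=` G) : G 1%R.
  exact: (minimal_lattice_generated ixi G0 GB Gc chG ml).
(* The only period is 1, giving half-width 1 if C_H > 0 and 1/4 if C_H = 0; either tent sees a
   single integer. *)
have [r r01 bump_cvg] : exists2 r : R, (0 < r <= 1)%R &
    scaled_mass (renewal X) v x (bump 0 r) @[x --> +oo%R] --> C_H%:E.
  have [C_gt0|C_le0] := ltP 0%R C_H.
    exists 1%R; first by rewrite ltr01 lexx.
    by have := cvg_pos _ ltr01 gen 0%R C_gt0; rewrite mulr1.
  have C_eq0 : C_H = 0%R by apply/eqP; rewrite eq_le C_le0 C0.
  exists (1 / 4)%R; first by rewrite divr_gt0//= ler_pdivrMr// mul1r ler1n.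
  by rewrite C_eq0; exact: cvg_zero _ ltr01 gen 0%R C_eq0.
under eq_cvg do rewrite -(integer_bump_mass v _ Xint r01).
exact: (cvg_comp _ _ (cvgr_idn (R := R)) bump_cvg).
Qed.
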